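(* Let $\gamma_+,\gamma_-$ be two $C^3$ arcs in the plane with a common end-point $O$ at which they share a tangent line and have different curvatures of the same sign, forming a horn at $O$. Then there exists a neighborhood of $O$ such that any billiard trajectory in the horn starting in this neighborhood leaves this neighborhood after finitely many collisions.
   Context: Horn: two arcs emanate from the common end-point $O$ in the same direction along their common tangent line, and their curvatures at $O$ (with respect to a common orientation) are nonzero, have the same sign, and are different. Thus both arcs bend to the same side of the tangent line. Near $O$ the arcs meet only at $O$, and the horn (the billiard table near $O$) is the thin region between the two arcs with tip $O$. One of the arcs (the one with smaller absolute curvature at $O$) is a focusing boundary of the table, and the other (with larger absolute curvature) is a dispersing boundary. Neighborhoods of $O$ are understood relative to this region. Billiard trajectory: a point particle moves in the region at unit speed along straight lines and reflects at the arcs according to the law that the angle of incidence equals the angle of reflection, i.e. $\vec v_+=\vec v_--2(\vec v_-\cdot\vec n)\vec n$, where $\vec v_-$ and $\vec v_+$ are the velocities before and after the collision and $\vec n$ is the unit normal at the collision point pointing out of the table. *)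

(* Defs.v *)
(* Stdlib real numbers with Coquelicot.  Points and vectors of the plane are
   elements of [R * R], with Coquelicot's module structure and topology. *)
From Stdlib Require Import Reals.
From Coquelicot Require Import Coquelicot.
Open Scope R_scope.

Definition dot (u v : R * R) : R := fst u * fst v + snd u * snd v.
Definition enorm (u : R * R) : R := sqrt (dot u u).

(* [D_in] and [continue_in] are relative to the set [fun t => a <= t <= b], so
   the derivatives are one-sided at [a] and [b], and only the values on
   [a, b] matter. *)
Definition derivative_on (a b : R) (f df : R -> R * R) : Prop :=
  forall t : R, a <= t <= b ->
    D_in (fun s => fst (f s)) (fun s => fst (df s)) (fun s => a <= s <= b) t /\
    D_in (fun s => snd (f s)) (fun s => snd (df s)) (fun s => a <= s <= b) t.

Definition continuous_on_segment (a b : R) (f : R -> R * R) : Prop :=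
  forall t : R, a <= t <= b ->
    continue_in (fun s => fst (f s)) (fun s => a <= s <= b) t /\
    continue_in (fun s => snd (f s)) (fun s => a <= s <= b) t.

(* A simple regular C^3 arc, parametrized on [0, arc_end] (not necessarily by
   arc length).  The derivatives are part of the data, but are determined on
   [0, arc_end] by [pt]. *)
Record arc : Type := mk_arc {
  arc_end : R;
  pt : R -> R * R;
  d1 : R -> R * R;
  d2 : R -> R * R;
  d3 : R -> R * R;
  arc_end_pos : 0 < arc_end;
  arc_d1 : derivative_on 0 arc_end pt d1;
  arc_d2 : derivative_on 0 arc_end d1 d2;
  arc_d3 : derivative_on 0 arc_end d2 d3;
  arc_d3_cont : continuous_on_segment 0 arc_end d3;
  arc_regular : forall t : R, 0 <= t <= arc_end -> d1 t <> (0, 0);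
  arc_simple : forall s t : R, 0 <= s <= arc_end -> 0 <= t <= arc_end ->
    pt s = pt t -> s = t
}.

Definition on_arc (g : arc) (p : R * R) : Prop :=
  exists t : R, 0 <= t <= arc_end g /\ pt g t = p.

(* Signed curvature, for the orientation given by the parametrization. *)
Definition curvature (g : arc) (t : R) : R :=
  (fst (d1 g t) * snd (d2 g t) - snd (d1 g t) * fst (d2 g t))
  / enorm (d1 g t) ^ 3.

(* The parametrizations both start at the tip, so that tangent vectors there
   pointing in the same direction give the two curvatures a common
   orientation. *)
Definition forms_horn (gp gm : arc) (tip : R * R) : Prop :=
  pt gp 0 = tip /\
  pt gm 0 = tip /\
  (exists c : R, 0 < c /\ d1 gm 0 = scal c (d1 gp 0)) /\
  curvature gp 0 <> 0 /\
  curvature gm 0 <> 0 /\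
  0 < curvature gp 0 * curvature gm 0 /\
  curvature gp 0 <> curvature gm 0.

(* The part of [g] up to parameter [t] is a graph over the line directed
   by [T]. *)
Definition graph_up_to (T : R * R) (g : arc) (t : R) : Prop :=
  0 <= t <= arc_end g /\ forall u : R, 0 <= u <= t -> 0 < dot T (d1 g u).

(* The closed region between the two arcs, swept by the segments perpendicular
   to the common tangent at the tip that join the two arcs.  Only the initial
   parts of the arcs that are graphs over this tangent are used: these contain
   all points of the arcs close to the tip, and the sweep stays faithful to the
   planar picture near the tip whatever the arcs do farther away. *)
Definition horn (gp gm : arc) (p : R * R) : Prop :=
  exists tp tm lam : R,
    graph_up_to (d1 gp 0) gp tp /\
    graph_up_to (d1 gp 0) gm tm /\
    dot (d1 gp 0) (minus (pt gp tp) (pt gm tm)) = 0 /\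
    0 <= lam <= 1 /\
    p = plus (scal (1 - lam) (pt gp tp)) (scal lam (pt gm tm)).

Definition horn_inside (gp gm : arc) (p : R * R) : Prop :=
  horn gp gm p /\ ~ on_arc gp p /\ ~ on_arc gm p.

(* Its orientation is immaterial, since [reflect] is even in the normal: the
   outward normal of the table gives the same reflection. *)
Definition unit_normal (g : arc) (t : R) : R * R :=
  (- snd (d1 g t) / enorm (d1 g t), fst (d1 g t) / enorm (d1 g t)).

Definition reflect (n v : R * R) : R * R := minus v (scal (2 * dot v n) n).

Definition fly (p v : R * R) (s : R) : R * R := plus p (scal s v).

(* A tangential contact counts as a collision, with [v' = v].  The parameter
   [0] is excluded: there is no reflection at the tip. *)
Definition bounce (g : arc) (p v p' v' : R * R) : Prop :=
  exists t : R, 0 < t <= arc_end g /\ p' = pt g t /\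
    v' = reflect (unit_normal g t) v.

Definition free_flight (gp gm : arc) (p v : R * R) (l : R) : Prop :=
  forall s : R, 0 < s < l -> horn_inside gp gm (fly p v s).

Definition next_collision (gp gm : arc) (p v p' v' : R * R) : Prop :=
  exists l : R, 0 < l /\ free_flight gp gm p v l /\ p' = fly p v l /\
    (bounce gp p v p' v' \/ bounce gm p v p' v').

(* The number of collisions of a trajectory; [None] stands for infinity. *)
Definition more_than (N : option nat) (k : nat) : Prop :=
  match N with None => True | Some n => (k < n)%nat end.

Definition at_least (N : option nat) (k : nat) : Prop :=
  match N with None => True | Some n => (k <= n)%nat end.

(* A maximal billiard trajectory in the horn.  [tr_pos 0] and [tr_vel 0] are
   the initial position and velocity; for [k > 0], [tr_pos k] is the point of
   the [k]-th collision and [tr_vel k] the velocity just after it.  Values with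
   an index larger than the number of collisions are irrelevant.
   [tr_starts] asks that the particle can start moving in the table: it excludes
   an initial point on an arc with a velocity pointing out of the table.
   [tr_maximal] says that a trajectory with finitely many collisions cannot be
   prolonged by another collision. *)
Record trajectory (gp gm : arc) : Type := mk_trajectory {
  tr_ncoll : option nat;
  tr_pos : nat -> R * R;
  tr_vel : nat -> R * R;
  tr_init : horn gp gm (tr_pos 0%nat);
  tr_unit : enorm (tr_vel 0%nat) = 1;
  tr_starts : exists l : R, 0 < l /\
    free_flight gp gm (tr_pos 0%nat) (tr_vel 0%nat) l;
  tr_step : forall k : nat, more_than tr_ncoll k ->
    next_collision gp gm (tr_pos k) (tr_vel k) (tr_pos (S k)) (tr_vel (S k));
  tr_maximal : forall n : nat, tr_ncoll = Some n ->
    ~ exists p' v' : R * R, next_collision gp gm (tr_pos n) (tr_vel n) p' v'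
}.

Arguments tr_ncoll {gp gm} _.
Arguments tr_pos {gp gm} _ _.
Arguments tr_vel {gp gm} _ _.

(* The particle passes through [p] on the flight that follows the [k]-th
   collision: from there it flies for a time [s] (up to the next collision),
   staying in the horn and meeting no arc before time [s]. *)
Definition visits_after {gp gm : arc} (tr : trajectory gp gm) (k : nat)
    (p : R * R) : Prop :=
  at_least (tr_ncoll tr) k /\
  exists s : R, 0 <= s /\ p = fly (tr_pos tr k) (tr_vel tr k) s /\
    free_flight gp gm (tr_pos tr k) (tr_vel tr k) s /\ horn gp gm p.

Definition leaves_after_finitely_many_collisions {gp gm : arc}
    (tr : trajectory gp gm) (U : R * R -> Prop) : Prop :=
  exists (k : nat) (p : R * R), visits_after tr k p /\ ~ U p.

(* Main.v *)
Require Import Defs.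
From Stdlib Require Import Reals Lra Lia Classical ClassicalEpsilon.
From Coquelicot Require Import Coquelicot.
(* Again, since [d1] also names a field of a record of Reals. *)
Import Defs.
Open Scope R_scope.

(** Take the tip as origin, the common tangent as x-axis, and let both arcs
    bend upwards.  Near the tip the horn is the region
    [lo x <= y <= hi x], where the graph of [lo] (the floor) is the focusing
    arc and the graph of [hi] (the ceiling) the dispersing one.  Write
    [w = hi - lo], [h = y - lo x] for the height above the floor and [(u, v)]
    for the velocity.  Since the curvatures at the tip differ, [w] is of order
    [x ^ 2] and [w'] of order [x].

    A reflection preserves the scalar product of the velocity with any vector
    tangent to the wall that is hit.  Two vector fields make use of this.

    - The field [(w, w lo' + w' h)] is tangent to both walls, so its product
      with the velocity, the [flux], is the same before and after every
      collision.  On a flight its derivative is [w' + O(w)], hence at least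
      [w' / 2] close to the tip.  The flux is itself of order [x ^ 2].
    - The field [T - h kappa (1, 0)], where [T] is the unit tangent of the
      floor and [kappa] its curvature, is tangent to the floor and is, to first
      order in [h], an infinitesimal rotation about the center of curvature.  Its
      product with the velocity, the [momentum], is therefore preserved by
      collisions with the floor and has derivative [- h kappa' u ^ 2] on
      flights; here three derivatives of the arc are used.  A collision with
      the ceiling increases it.  When the particle moves almost along the axis,
      in the direction [sg = 1] or [sg = -1], the defect [1 - sg * momentum]
      is bounded below by a multiple of [h], so its logarithmic derivative on
      flights is bounded, and by Groenwall it cannot tend to zero in finite
      time.

    Suppose that infinitely many collisions take place near the tip.  The flux is
    increasing and bounded, and its increments control those of [x ^ 2]
    ([flux_step]), so [x] converges at the collisions.

    If the limit is [0], then [flux + (1 - O(d)) w], where [d] bounds [x], is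
    increasing with limit [0], hence negative.  This forces [u <= - 1 + O(x)]
    ([vx_toward_tip]): the particle runs straight into the tip, in finite time, and
    [1 + momentum] tends to zero, which is impossible ([not_into_tip]).

    If the limit is positive, the increments of the flux also bound the total
    time, so the collisions accumulate at one point, on one wall.  Two
    consecutive collisions with the convex ceiling are impossible, so the wall
    is the floor.  The flights are then shorter and shorter chords of the floor,
    the velocity becomes tangent to it, and the defect tends to zero in finite
    time, which is impossible again ([no_floor_accumulation]).

    So a trajectory that stays near the tip has finitely many collisions.  Its
    last flight enters the interior at its start ([departs]) and has bounded
    length, as the horn is bounded there.  It cannot end at the tip, since both
    arcs are tangent to the axis there and bend to the same side, so that a
    segment issued from the tip is outside the horn at first
    ([no_flight_ends_at_tip]).  Nor can it end inside the horn, and an end on an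
    arc is one more collision: a contradiction. *)

(** * One-variable calculus *)

Lemma is_derive_Rminus (f g : R -> R) (x df dg : R) :
  is_derive f x df -> is_derive g x dg ->
  is_derive (fun t => f t - g t) x (df - dg).
Proof. exact (is_derive_minus f g x df dg). Qed.

(** The function is eta-expanded to match the goals left by [auto_derive]. *)
Lemma Derive_at (f : R -> R) (x df : R) :
  is_derive f x df -> Derive (fun t : R => f t) x = df.
Proof. exact (is_derive_unique f x df). Qed.

Lemma increasing_of_derivative (f df : R -> R) (a b : R) :
  a <= b ->
  (forall s, a <= s <= b -> is_derive f s (df s)) ->
  (forall s, a <= s <= b -> 0 <= df s) ->
  f a <= f b.
Proof.
  intros ab Hd Hp.
  destruct (MVT_gen f a b df) as (s & Hs & E).
  - intros s Hs. rewrite Rmin_left, Rmax_right in Hs by lra. apply Hd; lra.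
  - intros s Hs. rewrite Rmin_left, Rmax_right in Hs by lra.
    apply continuity_pt_filterlim, (ex_derive_continuous (V := R_NormedModule)).
    exists (df s). apply Hd; lra.
  - rewrite Rmin_left, Rmax_right in Hs by lra.
    specialize (Hp s Hs). nra.
Qed.

Lemma mean_value (f df : R -> R) (a b : R) :
  (forall s, Rmin a b <= s <= Rmax a b -> is_derive f s (df s)) ->
  exists s, Rmin a b <= s <= Rmax a b /\ f b - f a = df s * (b - a).
Proof.
  intros Hd. apply MVT_gen.
  - intros s Hs. apply Hd; lra.
  - intros s Hs.
    apply continuity_pt_filterlim, (ex_derive_continuous (V := R_NormedModule)).
    exists (df s). now apply Hd.
Qed.

(** The tangent line at [x] is compared with the graph at the midpoint of
    [x] and [z] first, which makes the inequality strict on the second half. *)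
Lemma above_tangent (f f1 f2 : R -> R) (a x z : R) :
  (forall t, 0 < t < a -> is_derive f t (f1 t)) ->
  (forall t, 0 < t < a -> is_derive f1 t (f2 t)) ->
  (forall t, 0 < t < a -> 0 < f2 t) ->
  0 < x < a -> 0 < z < a -> x <> z ->
  f x + f1 x * (z - x) < f z.
Proof.
  intros H0 H1 H2 Hx Hz Hxz.
  assert (Hin : forall p q t, 0 < p < a -> 0 < q < a ->
            Rmin p q <= t <= Rmax p q -> 0 < t < a).
  { intros p q t Hp Hq. unfold Rmin, Rmax. destruct (Rle_dec p q); lra. }
  destruct (mean_value (fun t => f t - f1 x * t) (fun t => f1 t - f1 x)
              ((x + z) / 2) z) as (s & Hs & E).
  { intros t Ht.
    assert (0 < t < a) by (apply (Hin ((x + z) / 2) z); try assumption; lra).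
    apply is_derive_Rminus; [now apply H0|].
    auto_derive; [exact I|ring]. }
  assert (Hsa : 0 < s < a) by (apply (Hin ((x + z) / 2) z); try assumption; lra).
  destruct (mean_value (fun t => f t - f1 x * t) (fun t => f1 t - f1 x)
              x ((x + z) / 2)) as (r & Hr & E').
  { intros t Ht.
    assert (0 < t < a) by (apply (Hin x ((x + z) / 2)); try assumption; lra).
    apply is_derive_Rminus; [now apply H0|].
    auto_derive; [exact I|ring]. }
  assert (Hra : 0 < r < a) by (apply (Hin x ((x + z) / 2)); try assumption; lra).
  destruct (mean_value f1 f2 x s) as (s' & Hs' & Es).
  { intros t Ht. apply H1. now apply (Hin x s). }
  destruct (mean_value f1 f2 x r) as (r' & Hr' & Er).
  { intros t Ht. apply H1. now apply (Hin x r). }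
  assert (P1 := H2 s' (Hin _ _ _ Hx Hsa Hs')).
  assert (P2 := H2 r' (Hin _ _ _ Hx Hra Hr')).
  rewrite Es in E. rewrite Er in E'.
  clear Es Er Hs' Hr'. revert Hs Hr. unfold Rmin, Rmax.
  assert (Hlt : x < z \/ z < x) by lra.
  destruct Hlt as [Hlt | Hlt];
    destruct (Rle_dec ((x + z) / 2) z); destruct (Rle_dec x ((x + z) / 2));
    try lra; intros.
  - assert (0 < f2 s' * (s - x)) by (apply Rmult_lt_0_compat; lra).
    assert (0 <= f2 r' * (r - x)) by (apply Rmult_le_pos; lra).
    assert (0 < f2 s' * (s - x) * (z - (x + z) / 2)) by (apply Rmult_lt_0_compat; lra).
    assert (0 <= f2 r' * (r - x) * ((x + z) / 2 - x)) by (apply Rmult_le_pos; lra).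
    lra.
  - assert (0 < f2 s' * (x - s)) by (apply Rmult_lt_0_compat; lra).
    assert (0 <= f2 r' * (x - r)) by (apply Rmult_le_pos; lra).
    assert (0 < f2 s' * (x - s) * ((x + z) / 2 - z)) by (apply Rmult_lt_0_compat; lra).
    assert (0 <= f2 r' * (x - r) * (x - (x + z) / 2)) by (apply Rmult_le_pos; lra).
    lra.
Qed.

Lemma gronwall (f df : R -> R) (A l : R) : 0 <= l ->
  (forall s, 0 <= s <= l -> is_derive f s (df s)) ->
  (forall s, 0 <= s <= l -> - A * f s <= df s) ->
  f 0 * exp (- A * l) <= f l.
Proof.
  intros Hl Hd Hb.
  assert (M := increasing_of_derivative (fun s => f s * exp (A * s))
    (fun s => (df s + A * f s) * exp (A * s)) 0 l Hl).
  cbv beta in M. rewrite Rmult_0_r, exp_0, Rmult_1_r in M.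
  replace (f l) with (f l * exp (A * l) * exp (- A * l)).
  2:{ rewrite Rmult_assoc, <- exp_plus.
      replace (A * l + - A * l) with 0 by ring. rewrite exp_0; ring. }
  apply Rmult_le_compat_r; [apply Rlt_le, exp_pos|].
  apply M.
  - intros s Hs. specialize (Hd s Hs). auto_derive.
    + eexists; eassumption.
    + rewrite (Derive_at f _ _ Hd). ring.
  - intros s Hs. specialize (Hb s Hs).
    apply Rmult_le_pos; [lra|apply Rlt_le, exp_pos].
Qed.

(** The bound by a multiple of [t] says that [f] vanishes at the left end point,
    where [f] itself need not be given the value [0]. *)
Lemma nonneg_from_zero (f f1 : R -> R) (a B x : R) :
  (forall t, 0 < t < a -> is_derive f t (f1 t)) ->
  (forall t, 0 < t < a -> 0 <= f1 t) ->
  (forall t, 0 < t < a -> Rabs (f t) <= B * t) ->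
  0 < x < a -> 0 <= f x.
Proof.
  intros D P1 Bd Hx. apply Rnot_lt_le. intros N.
  set (t := Rmin (x / 2) (- f x / (2 * (Rabs B + 1)))).
  assert (HB : 0 <= Rabs B) by apply Rabs_pos.
  assert (0 < - f x / (2 * (Rabs B + 1))) by (apply Rdiv_lt_0_compat; lra).
  assert (0 < t) by (unfold t; apply Rmin_case; lra).
  assert (t <= x / 2) by apply Rmin_l.
  assert (Ht : t <= - f x / (2 * (Rabs B + 1))) by apply Rmin_r.
  assert (M := increasing_of_derivative f f1 t x ltac:(lra)
    ltac:(intros; apply D; lra) ltac:(intros; apply P1; lra)).
  specialize (Bd t ltac:(lra)). apply Rabs_le_between in Bd.
  assert (B * t <= (Rabs B + 1) * t).
  { apply Rmult_le_compat_r; [lra|]. generalize (Rle_abs B). lra. }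
  assert ((Rabs B + 1) * t <= - f x / 2).
  { replace (- f x / 2) with ((Rabs B + 1) * (- f x / (2 * (Rabs B + 1))))
      by (field; lra). apply Rmult_le_compat_l; lra. }
  lra.
Qed.

(** Closed half-planes contain the end point of a flight whose inner points
    they contain. *)
Lemma affine_limit (x u l M : R) : 0 < l ->
  (forall s, 0 < s < l -> x + s * u <= M) -> x + l * u <= M.
Proof.
  intros Hl H. apply Rnot_lt_le. intros N.
  set (t := Rmin (l / 2) ((x + l * u - M) / (2 * (Rabs u + 1)))).
  assert (Hu : 0 <= Rabs u) by apply Rabs_pos.
  assert (0 < (x + l * u - M) / (2 * (Rabs u + 1))) by (apply Rdiv_lt_0_compat; lra).
  assert (0 < t) by (unfold t; apply Rmin_case; lra).
  assert (t <= l / 2) by apply Rmin_l.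
  assert (Ht : t <= (x + l * u - M) / (2 * (Rabs u + 1))) by apply Rmin_r.
  specialize (H (l - t) ltac:(lra)).
  assert ((Rabs u + 1) * t <= (x + l * u - M) / 2).
  { replace ((x + l * u - M) / 2) with
      ((Rabs u + 1) * ((x + l * u - M) / (2 * (Rabs u + 1)))) by (field; lra).
    apply Rmult_le_compat_l; lra. }
  assert (u <= Rabs u) by apply Rle_abs. nra.
Qed.

(** * The horn between two graphs *)

(** The constant [curv_gap] bounds from below the second derivative of the floor and
    its difference to that of the ceiling; [curv_bnd] bounds the second
    derivatives and the third derivative of the floor from above.  [reach_small] makes every relative error of the form
    [curv_bnd * x] small, so that leading terms decide. *)
Record profile := mk_profile {
  reach : R; curv_bnd : R; curv_gap : R;
  lo : R -> R; lo1 : R -> R; lo2 : R -> R; lo3 : R -> R;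
  hi : R -> R; hi1 : R -> R; hi2 : R -> R;
  reach_pos : 0 < reach;
  curv_gap_pos : 0 < curv_gap;
  curv_bnd_ge1 : 1 <= curv_bnd;
  reach_small : curv_bnd * reach <= 1 / 100;
  lo_d : forall x, 0 < x < reach -> is_derive lo x (lo1 x);
  lo1_d : forall x, 0 < x < reach -> is_derive lo1 x (lo2 x);
  lo2_d : forall x, 0 < x < reach -> is_derive lo2 x (lo3 x);
  hi_d : forall x, 0 < x < reach -> is_derive hi x (hi1 x);
  hi1_d : forall x, 0 < x < reach -> is_derive hi1 x (hi2 x);
  lo2_range : forall x, 0 < x < reach -> curv_gap <= lo2 x <= curv_bnd;
  hi2_range : forall x, 0 < x < reach -> lo2 x + curv_gap <= hi2 x <= curv_bnd;
  lo3_bound : forall x, 0 < x < reach -> Rabs (lo3 x) <= curv_bnd;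
  lo1_range : forall x, 0 < x < reach -> 0 <= lo1 x <= curv_bnd * x;
  hi1_range : forall x, 0 < x < reach -> lo1 x + curv_gap * x <= hi1 x <= curv_bnd * x;
  lo_range : forall x, 0 < x < reach -> 0 < lo x;
  hi_range : forall x, 0 < x < reach ->
    lo x + curv_gap / 2 * x ^ 2 <= hi x <= curv_bnd * x ^ 2;
  width_le : forall x, 0 < x < reach -> hi x - lo x <= x * (hi1 x - lo1 x)
}.

Record state := mk_state { px : R; py : R; vx : R; vy : R }.

Definition move (z : state) (s : R) : state :=
  mk_state (px z + s * vx z) (py z + s * vy z) (vx z) (vy z).

(** The law of reflection on a line of slope [p]; [vy z - p * vx z] is the
    component of the velocity along the upward normal [(- p, 1)]. *)
Definition reflect_slope (p : R) (z : state) : state :=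
  mk_state (px z) (py z)
    (vx z + 2 * p * (vy z - p * vx z) / (1 + p ^ 2))
    (vy z - 2 * (vy z - p * vx z) / (1 + p ^ 2)).

Lemma unit_components (u v : R) : u ^ 2 + v ^ 2 = 1 -> -1 <= u <= 1 /\ -1 <= v <= 1.
Proof. intros. nra. Qed.

Lemma reflect_slope_unit (p : R) (z : state) :
  vx z ^ 2 + vy z ^ 2 = 1 ->
  vx (reflect_slope p z) ^ 2 + vy (reflect_slope p z) ^ 2 = 1.
Proof.
  intros Hv. rewrite <- Hv. simpl. field. nra.
Qed.

Lemma reflect_slope_normal (p : R) (z : state) :
  vy (reflect_slope p z) - p * vx (reflect_slope p z) = - (vy z - p * vx z).
Proof. simpl. field. nra. Qed.

Section Billiard.
Context (P : profile).

Local Notation a := (reach P).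
Local Notation K := (curv_bnd P).
Local Notation c := (curv_gap P).

Definition inside (z : state) : Prop :=
  0 < px z < reach P /\ lo P (px z) < py z < hi P (px z).

Definition admissible (z : state) : Prop :=
  0 < px z < reach P /\ lo P (px z) <= py z <= hi P (px z) /\
  vx z ^ 2 + vy z ^ 2 = 1.

Definition lower_bounce (z z' : state) : Prop :=
  py z = lo P (px z) /\ z' = reflect_slope (lo1 P (px z)) z.

Definition upper_bounce (z z' : state) : Prop :=
  py z = hi P (px z) /\ z' = reflect_slope (hi1 P (px z)) z.

Definition flight (z : state) (l : R) : Prop :=
  0 < l /\ forall s, 0 < s < l -> inside (move z s).

(** The signs of the normal velocities at the ends of the flight follow from the
    flight lying inside the horn. *)
Definition step (z : state) (l : R) (z' : state) : Prop :=
  admissible z /\ flight z l /\ admissible z' /\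
  (lower_bounce (move z l) z' \/ upper_bounce (move z l) z').

Lemma lo_above_tangent (x t : R) : 0 < x < a -> 0 < t < a -> x <> t ->
  lo P x + lo1 P x * (t - x) < lo P t.
Proof.
  apply (above_tangent _ _ (lo2 P)); [apply lo_d|apply lo1_d|].
  intros s Hs. generalize (lo2_range P s Hs) (curv_gap_pos P); lra.
Qed.

Lemma hi_above_tangent (x t : R) : 0 < x < a -> 0 < t < a -> x <> t ->
  hi P x + hi1 P x * (t - x) < hi P t.
Proof.
  apply (above_tangent _ _ (hi2 P)); [apply hi_d|apply hi1_d|].
  intros s Hs.
  generalize (hi2_range P s Hs) (lo2_range P s Hs) (curv_gap_pos P); lra.
Qed.

Lemma gap_pos (x : R) : 0 < x < a -> 0 < hi P x - lo P x.
Proof.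
  intros Hx. assert (W := hi_range P _ Hx). assert (Hc := curv_gap_pos P).
  assert (0 < c / 2 * x ^ 2) by (apply Rmult_lt_0_compat; [lra|apply pow_lt; lra]).
  lra.
Qed.

Lemma step_px (z z' : state) (l : R) : step z l z' -> px z' = px z + l * vx z.
Proof. intros (_ & _ & _ & [[_ ->] | [_ ->]]); reflexivity. Qed.

Lemma step_py (z z' : state) (l : R) : step z l z' -> py z' = py z + l * vy z.
Proof. intros (_ & _ & _ & [[_ ->] | [_ ->]]); reflexivity. Qed.

(** Estimates at the two collision points are read off from this, on the same
    footing as those inside the flight. *)
Lemma step_flight_closed (z z' : state) (l s : R) : step z l z' ->
  0 <= s <= l -> admissible (move z s).
Proof.
  intros H Hs. assert (Ex := step_px _ _ _ H). assert (Ey := step_py _ _ _ H).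
  destruct H as ((A1 & A2 & A3) & (Hl & Hf) & (B1 & B2 & _) & _).
  rewrite Ex, Ey in B2. rewrite Ex in B1.
  destruct (Req_dec s 0) as [->|].
  { unfold admissible, move; simpl. rewrite !Rmult_0_l, !Rplus_0_r. tauto. }
  destruct (Req_dec s l) as [->|].
  { unfold admissible, move; simpl. tauto. }
  destruct (Hf s) as [I1 I2]; [lra|].
  split; [exact I1|split; [lra|exact A3]].
Qed.

(** * The flux *)

(** The product of the velocity with a field tangent to both walls: at height
    [h = 0] the field is [w * (1, lo')], at height [h = w] it is [w * (1, hi')]. *)
Definition flux (z : state) : R :=
  (hi P (px z) - lo P (px z)) * (vx z + lo1 P (px z) * vy z)
  + (hi1 P (px z) - lo1 P (px z)) * (py z - lo P (px z)) * vy z.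

Lemma flux_bounce (z z' : state) :
  lower_bounce z z' \/ upper_bounce z z' -> flux z' = flux z.
Proof.
  intros [[E ->] | [E ->]]; unfold flux, reflect_slope; simpl; rewrite E.
  - set (p := lo1 P (px z)). field. nra.
  - set (p := hi1 P (px z)). field. nra.
Qed.

(** The product of the velocity with a field tangent to both walls: at height
    [h = 0] the field is [w * (1, lo')], at height [h = w] it is [w * (1, hi')]. *)
(** The matrix of derivatives of the field has [w'] twice on its diagonal, which
    gives the first term; the off-diagonal entry, in the second term, is [O(w)]. *)
Definition flux_rate (z : state) : R :=
  (hi1 P (px z) - lo1 P (px z)) * (vx z ^ 2 + vy z ^ 2)
  + vx z * vy z * ((hi P (px z) - lo P (px z)) * lo2 P (px z)
    + (hi2 P (px z) - lo2 P (px z)) * (py z - lo P (px z))).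

Lemma flux_derive (z : state) (s : R) : 0 < px (move z s) < a ->
  is_derive (fun t => flux (move z t)) s (flux_rate (move z s)).
Proof.
  intros Hx. unfold flux, flux_rate, move in *; simpl in *.
  assert (D0 := lo_d P _ Hx). assert (D1 := lo1_d P _ Hx).
  assert (D2 := hi_d P _ Hx). assert (D3 := hi1_d P _ Hx).
  auto_derive.
  - repeat split; eexists; eassumption.
  - rewrite (Derive_at (lo P) _ _ D0),
      (Derive_at (lo1 P) _ _ D1),
      (Derive_at (hi P) _ _ D2),
      (Derive_at (hi1 P) _ _ D3).
    ring.
Qed.

Lemma gap_derive (z : state) (s : R) : 0 < px (move z s) < a ->
  is_derive (fun t => hi P (px (move z t)) - lo P (px (move z t))) s
    ((hi1 P (px (move z s)) - lo1 P (px (move z s))) * vx z).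
Proof.
  intros Hx. unfold move in *; simpl in *.
  assert (D0 := lo_d P _ Hx). assert (D2 := hi_d P _ Hx).
  auto_derive.
  - repeat split; eexists; eassumption.
  - rewrite (Derive_at (lo P) _ _ D0),
      (Derive_at (hi P) _ _ D2).
    ring.
Qed.

(** By convexity [w <= x w'], so the terms of order [w] lose only a factor
    [1 - O(x)] against [w']. *)
Lemma flux_rate_ge (z : state) : admissible z ->
  (hi1 P (px z) - lo1 P (px z)) * (1 - 3 * K * px z) <= flux_rate z.
Proof.
  intros (Hx & Hy & Hv). unfold flux_rate. rewrite Hv.
  assert (H1 := lo2_range P _ Hx). assert (H2 := hi2_range P _ Hx).
  assert (H3 := width_le P _ Hx). assert (Hc := curv_gap_pos P).
  assert (H4 := curv_bnd_ge1 P). set (w := hi P (px z) - lo P (px z)) in *.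
  set (h := py z - lo P (px z)) in *.
  set (w1 := hi1 P (px z) - lo1 P (px z)) in *.
  assert (0 <= h <= w) by (unfold h, w; lra).
  set (e := w * lo2 P (px z) + (hi2 P (px z) - lo2 P (px z)) * h).
  assert (0 <= e <= 3 * K * w).
  { unfold e. split.
    - apply Rplus_le_le_0_compat; apply Rmult_le_pos; lra.
    - assert (w * lo2 P (px z) <= w * K) by (apply Rmult_le_compat_l; lra).
      assert ((hi2 P (px z) - lo2 P (px z)) * h <= K * w)
        by (apply Rmult_le_compat; lra).
      nra. }
  assert (- 1 <= vx z * vy z) by nra.
  assert (- e <= vx z * vy z * e) by nra.
  assert (3 * K * w <= 3 * K * (px z * w1)) by (apply Rmult_le_compat_l; lra).
  lra.
Qed.

Lemma slope_gap_ge (z : state) : admissible z ->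
  c * px z <= hi1 P (px z) - lo1 P (px z) <= K * px z.
Proof.
  intros (Hx & _). generalize (hi1_range P _ Hx) (lo1_range P _ Hx).
 lra.
Qed.

Lemma curv_bnd_px_small (z : state) : admissible z -> 0 < K * px z <= 1 / 100.
Proof.
  intros (Hx & _). generalize (reach_small P) (curv_bnd_ge1 P).  nra.
Qed.

(** The left side is a multiple of the integral of [x] along the flight, and the
    flux grows at least at the rate [c / 2 * x].  As [l] bounds the change of [x],
    the left side also bounds the change of [x ^ 2]. *)
Lemma flux_step (z z' : state) (l : R) : step z l z' ->
  c / 4 * (l * (px z + px z')) <= flux z' - flux z.
Proof.
  intros H.
  assert (Ef : flux z' = flux (move z l)).
  { apply flux_bounce. apply H. }
  rewrite Ef, (step_px _ _ _ H).
  assert (M := increasing_of_derivative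
    (fun s => flux (move z s) - c / 2 * (px z * s + vx z * (s ^ 2 / 2)))
    (fun s => flux_rate (move z s) - c / 2 * (px (move z s))) 0 l).
  cbv beta in M.
  replace (flux (move z 0)) with (flux z) in M.
  2:{ destruct z; unfold move; simpl; now rewrite !Rmult_0_l, !Rplus_0_r. }
  enough (flux z - c / 2 * (px z * 0 + vx z * (0 ^ 2 / 2)) <=
          flux (move z l) - c / 2 * (px z * l + vx z * (l ^ 2 / 2))) by lra.
  apply M; clear M.
  - apply Rlt_le, H.
  - intros s Hs. apply is_derive_Rminus.
    + apply flux_derive. apply (step_flight_closed _ _ _ _ H Hs).
    + auto_derive; [exact I|simpl; field].
  - intros s Hs. assert (A := step_flight_closed _ _ _ _ H Hs).
    assert (B := flux_rate_ge _ A). assert (C := slope_gap_ge _ A).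
    assert (D := curv_bnd_px_small _ A). assert (Hc := curv_gap_pos P).
    assert (0 < px (move z s)) by apply A.
    set (w1 := hi1 P (px (move z s)) - lo1 P (px (move z s))) in *.
    assert (w1 * (1 / 2) <= w1 * (1 - 3 * K * px (move z s))).
    { apply Rmult_le_compat_l; nra. }
    lra.
Qed.

Lemma flux_bound (z : state) : admissible z ->
  Rabs (flux z) <= 4 * K * px z ^ 2.
Proof.
  intros A. assert (B := curv_bnd_px_small _ A). assert (C := slope_gap_ge _ A).
  destruct A as (Hx & Hy & Hv).
  assert (H1 := lo1_range P _ Hx). assert (H2 := hi_range P _ Hx).
  assert (H3 := lo_range P _ Hx). assert (Hc := curv_gap_pos P).
  unfold flux.
  set (w := hi P (px z) - lo P (px z)) in *.
  set (h := py z - lo P (px z)) in *.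
  set (w1 := hi1 P (px z) - lo1 P (px z)) in *.
  assert (0 <= h <= w) by (unfold h, w; lra).
  assert (w <= K * px z ^ 2) by (unfold w; lra).
  assert (U1 : Rabs (vx z) <= 1) by (apply Rabs_le; nra).
  assert (U2 : Rabs (vy z) <= 1) by (apply Rabs_le; nra).
  assert (0 <= c * px z) by nra.
  assert (Rabs (lo1 P (px z) * vy z) <= 1).
  { rewrite Rabs_mult, (Rabs_pos_eq (lo1 P (px z))) by lra.
    assert (0 <= Rabs (vy z)) by apply Rabs_pos. nra. }
  assert (Rabs (vx z + lo1 P (px z) * vy z) <= 2)
    by (eapply Rle_trans; [apply Rabs_triang|lra]).
  assert (Rabs (w * (vx z + lo1 P (px z) * vy z)) <= w * 2).
  { rewrite Rabs_mult, (Rabs_pos_eq w) by lra. apply Rmult_le_compat_l; lra. }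
  assert (Rabs (w1 * h * vy z) <= w * 1).
  { rewrite Rabs_mult. rewrite (Rabs_pos_eq (w1 * h)) by (apply Rmult_le_pos; lra).
    apply Rmult_le_compat; [apply Rmult_le_pos; lra|apply Rabs_pos| |lra].
    rewrite <- (Rmult_1_l w). apply Rmult_le_compat; lra. }
  eapply Rle_trans; [apply Rabs_triang|]. lra.
Qed.

(** * The momentum along the floor *)

(** The cosine of the angle between the floor and the axis. *)
Definition slope_cos (x : R) : R := / sqrt (1 + lo1 P x ^ 2).

Lemma slope_cos_pos (x : R) : 0 < slope_cos x.
Proof. apply Rinv_0_lt_compat, sqrt_lt_R0. nra. Qed.

Lemma slope_cos_sqr (x : R) : slope_cos x ^ 2 * (1 + lo1 P x ^ 2) = 1.
Proof.
  unfold slope_cos. rewrite pow_inv. rewrite pow2_sqrt by nra. field. nra.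
Qed.

Lemma slope_cos_derive (x : R) : 0 < x < a ->
  is_derive slope_cos x (- lo1 P x * lo2 P x * slope_cos x ^ 3).
Proof.
  intros Hx. assert (D1 := lo1_d P _ Hx).
  assert (S : 0 < 1 + lo1 P x ^ 2) by nra.
  assert (S' := sqrt_lt_R0 _ S).
  unfold slope_cos. auto_derive.
  - repeat split; [eexists; eassumption| |];
      replace (1 + lo1 P x * (lo1 P x * 1)) with (1 + lo1 P x ^ 2) by ring; lra.
  - rewrite (Derive_at (lo1 P) _ _ D1).
    replace (1 + lo1 P x * (lo1 P x * 1)) with (1 + lo1 P x ^ 2) by ring.
    field. lra.
Qed.

(** [slope_cos ^ 3] turns the second derivative of [lo] into its curvature. *)
Definition floor_curv (x : R) : R := lo2 P x * slope_cos x ^ 3.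

(** [slope_cos ^ 3] turns the second derivative of [lo] into its curvature. *)
(** The derivative of [floor_curv]. *)
Definition floor_curv1 (x : R) : R :=
  lo3 P x * slope_cos x ^ 3 - 3 * lo1 P x * lo2 P x ^ 2 * slope_cos x ^ 5.

(** On the floor, the tangential velocity.  The correction by [h] makes the field
    [T - h * kappa * (1, 0)] differ from an infinitesimal rotation only at
    order [h], so that only the change of curvature along the floor moves the
    momentum on a flight. *)
Definition momentum (z : state) : R :=
  slope_cos (px z) * (vx z + lo1 P (px z) * vy z)
  - (py z - lo P (px z)) * floor_curv (px z) * vx z.

Lemma momentum_derive (z : state) (s : R) : 0 < px (move z s) < a ->
  is_derive (fun t => momentum (move z t)) s
    (- (py (move z s) - lo P (px (move z s))) * floor_curv1 (px (move z s))
     * vx z ^ 2).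
Proof.
  intros Hx. unfold momentum, floor_curv, floor_curv1, move in *; simpl in *.
  assert (D0 := lo_d P _ Hx). assert (D1 := lo1_d P _ Hx).
  assert (D2 := lo2_d P _ Hx). assert (D3 := slope_cos_derive _ Hx).
  assert (Q := slope_cos_sqr (px z + s * vx z)).
  auto_derive.
  - repeat split; eexists; eassumption.
  - rewrite (Derive_at (lo P) _ _ D0), (Derive_at (lo1 P) _ _ D1),
      (Derive_at (lo2 P) _ _ D2), (Derive_at slope_cos _ _ D3).
    set (m := slope_cos (px z + s * vx z)) in *.
    set (p := lo1 P (px z + s * vx z)) in *.
    set (q := lo2 P (px z + s * vx z)) in *.
    set (r := lo3 P (px z + s * vx z)) in *.
    set (b := lo P (px z + s * vx z)) in *.
    transitivity (m * q * vx z * vy z * (1 - m ^ 2 * (1 + p ^ 2))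
      - (py z + s * vy z - b) * (r * m ^ 3 - 3 * p * q ^ 2 * m ^ 5) * vx z ^ 2).
    + ring.
    + rewrite Q. ring.
Qed.

Lemma momentum_lower_bounce (z z' : state) :
  lower_bounce z z' -> momentum z' = momentum z.
Proof.
  intros [E ->]. unfold momentum, reflect_slope; simpl; rewrite E.
  set (p := lo1 P (px z)). field. nra.
Qed.

(** The ceiling is steeper than the floor, so the kick along its inward normal has a
    positive component along the field, which is nearly parallel to the floor. *)
Lemma momentum_upper_bounce (z z' : state) :
  0 < px z < a -> 0 <= vy z - hi1 P (px z) * vx z ->
  upper_bounce z z' -> momentum z <= momentum z'.
Proof.
  intros Hx Hq [E ->]. unfold momentum, reflect_slope; simpl; rewrite E.
  assert (L1 := lo1_range P _ Hx). assert (L2 := lo2_range P _ Hx).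
  assert (H1 := hi1_range P _ Hx). assert (W := width_le P _ Hx).
  assert (Hh := hi_range P _ Hx).
  assert (Hc := curv_gap_pos P). assert (HK := curv_bnd_ge1 P).
  assert (Hs : K * px z <= 1 / 100) by (generalize (reach_small P); nra).
  assert (Q := slope_cos_sqr (px z)). assert (Mp := slope_cos_pos (px z)).
  unfold floor_curv.
  set (m := slope_cos (px z)) in *. set (p := lo1 P (px z)) in *.
  set (r := hi1 P (px z)) in *. set (w := hi P (px z) - lo P (px z)) in *.
  set (k := lo2 P (px z)) in *. set (q := vy z - r * vx z) in *.
  assert (m <= 1) by nra.
  assert (Hm3 : 0 < m ^ 3 <= m) by (split; [apply pow_lt; lra|simpl; nra]).
  assert (Hcx : 0 < c * px z) by nra.
  assert (Hw0 : 0 <= w) by (unfold w; nra).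
  (* The product of the field with the normal [(- r, 1)] of the ceiling is negative:
     the difference of slopes is of order [x], the correction of order [x ^ 3]. *)
  assert (N : w * (k * m ^ 3) * r <= m * (r - p)).
  { assert (r <= 1) by lra.
    assert (0 <= k * m ^ 3) by (apply Rmult_le_pos; lra).
    assert (k * m ^ 3 <= K * m) by (apply Rmult_le_compat; lra).
    assert (w * (k * m ^ 3) <= px z * (r - p) * (K * m))
      by (apply Rmult_le_compat; lra).
    assert (0 <= w * (k * m ^ 3)) by (apply Rmult_le_pos; lra).
    assert (w * (k * m ^ 3) * r <= w * (k * m ^ 3) * 1)
      by (apply Rmult_le_compat_l; lra).
    assert (0 <= (r - p) * m) by (apply Rmult_le_pos; lra).
    assert ((K * px z) * ((r - p) * m) <= 1 * ((r - p) * m))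
      by (apply Rmult_le_compat_r; lra).
    nra. }
  assert (D : 0 <= 2 * q / (1 + r ^ 2)).
  { apply Rmult_le_pos; [lra|]. apply Rlt_le, Rinv_0_lt_compat. nra. }
  replace (vx z + 2 * r * q / (1 + r * (r * 1)))
    with (vx z + r * (2 * q / (1 + r ^ 2))) by (field; nra).
  replace (vy z - 2 * q / (1 + r * (r * 1)))
    with (vy z - (2 * q / (1 + r ^ 2))) by (field; nra).
  set (j := 2 * q / (1 + r ^ 2)) in *.
  assert (0 <= j * (m * (r - p) - w * (k * m ^ 3) * r))
    by (apply Rmult_le_pos; lra).
  simpl in *. nra.
Qed.

(** The rate in Groenwall's inequality: [K + K ^ 2] bounds the derivative of the
    curvature, and [16 / c] is the constant of [defect_ge]. *)
Definition drift_rate : R := 16 * (K + K ^ 2) / c.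

Lemma drift_rate_pos : 0 < drift_rate.
Proof.
  generalize (curv_bnd_ge1 P) (curv_gap_pos P); intros.
  apply Rdiv_lt_0_compat; nra.
Qed.

Lemma tangent_normal_sqr (z : state) : vx z ^ 2 + vy z ^ 2 = 1 ->
  (slope_cos (px z) * (vx z + lo1 P (px z) * vy z)) ^ 2
  + slope_cos (px z) ^ 2 * (vy z - lo1 P (px z) * vx z) ^ 2 = 1.
Proof.
  intros Hv.
  transitivity (slope_cos (px z) ^ 2 * (1 + lo1 P (px z) ^ 2)
                * (vx z ^ 2 + vy z ^ 2)); [ring|].
  rewrite slope_cos_sqr, Hv. ring.
Qed.

(** The defect [1 - sg * momentum] measures the distance from the motion along
    the floor in the direction [sg].  Its tangential part is nonnegative as the
    speed is [1], and the correction term of the momentum contributes [h]. *)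
Lemma defect_ge (sg : R) (z : state) : sg ^ 2 = 1 -> admissible z ->
  1 / 2 <= sg * vx z ->
  c / 16 * (py z - lo P (px z)) <= 1 - sg * momentum z.
Proof.
  intros Hsg A Hs. assert (B := curv_bnd_px_small _ A). destruct A as (Hx & Hy & Hv).
  assert (T := tangent_normal_sqr z Hv).
  assert (L1 := lo1_range P _ Hx). assert (L2 := lo2_range P _ Hx).
  assert (Hc := curv_gap_pos P). assert (HK := curv_bnd_ge1 P).
  assert (Q := slope_cos_sqr (px z)). assert (Mp := slope_cos_pos (px z)).
  unfold momentum, floor_curv.
  set (m := slope_cos (px z)) in *. set (p := lo1 P (px z)) in *.
  set (h := py z - lo P (px z)) in *. set (k := lo2 P (px z)) in *.
  set (t := m * (vx z + p * vy z)) in *.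
  assert (0 <= m ^ 2 * (vy z - p * vx z) ^ 2)
    by (apply Rmult_le_pos; apply pow2_ge_0).
  assert ((sg * t) ^ 2 <= 1) by (rewrite Rpow_mult_distr, Hsg; lra).
  assert (sg * t <= 1) by nra.
  assert (Hm : 1 / 2 <= m) by nra.
  assert (1 / 8 <= m ^ 3).
  { apply (Rle_trans _ ((1 / 2) ^ 3)); [lra|apply pow_incr; lra]. }
  assert (c * (1 / 8) <= k * m ^ 3) by (apply Rmult_le_compat; lra).
  assert (0 <= h) by (unfold h; lra).
  assert (h * (c * (1 / 8)) <= h * (k * m ^ 3)) by (apply Rmult_le_compat_l; lra).
  assert (0 <= h * (c * (1 / 8))) by (apply Rmult_le_pos; lra).
  assert (h * (c * (1 / 8)) * (1 / 2) <= h * (k * m ^ 3) * (sg * vx z))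
    by (apply Rmult_le_compat; lra).
  nra.
Qed.

Lemma floor_curv1_bound (x : R) : 0 < x < a ->
  Rabs (floor_curv1 x) <= K + K ^ 2.
Proof.
  intros Hx. unfold floor_curv1.
  assert (L1 := lo1_range P _ Hx). assert (L2 := lo2_range P _ Hx).
  assert (L3 := lo3_bound P _ Hx).
  assert (Hc := curv_gap_pos P). assert (HK := curv_bnd_ge1 P).
  assert (Hs : K * x <= 1 / 100) by (generalize (reach_small P); nra).
  assert (Q := slope_cos_sqr x). assert (Mp := slope_cos_pos x).
  set (m := slope_cos x) in *. set (p := lo1 P x) in *.
  assert (m <= 1) by nra.
  assert (0 <= m ^ 3 <= 1).
  { split; [apply pow_le; lra|]. rewrite <- (pow1 3). apply pow_incr; lra. }
  assert (0 <= m ^ 5 <= 1).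
  { split; [apply pow_le; lra|]. rewrite <- (pow1 5). apply pow_incr; lra. }
  eapply Rle_trans; [apply Rabs_triang|]. rewrite Rabs_Ropp.
  apply Rplus_le_compat.
  - rewrite Rabs_mult, (Rabs_pos_eq (m ^ 3)) by lra.
    rewrite <- (Rmult_1_r K). apply Rmult_le_compat; try lra. apply Rabs_pos.
  - assert (0 <= lo2 P x ^ 2 <= K ^ 2)
      by (split; [apply pow2_ge_0|apply pow_incr; lra]).
    rewrite Rabs_pos_eq.
    2:{ repeat apply Rmult_le_pos; lra. }
    rewrite <- (Rmult_1_r (K ^ 2)).
    apply Rmult_le_compat; [repeat apply Rmult_le_pos; lra|lra| |lra].
    rewrite <- (Rmult_1_l (K ^ 2)).
    apply Rmult_le_compat; lra.
Qed.

(** The momentum drifts at a rate proportional to [h], which the defect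
    dominates. *)
Lemma defect_flight (sg : R) (z z' : state) (l : R) : sg ^ 2 = 1 ->
  step z l z' -> 1 / 2 <= sg * vx z ->
  (1 - sg * momentum z) * exp (- drift_rate * l)
  <= 1 - sg * momentum (move z l).
Proof.
  intros Hsg H Hs.
  assert (G := gronwall (fun s => 1 - sg * momentum (move z s))
    (fun s => sg * ((py (move z s) - lo P (px (move z s)))
       * floor_curv1 (px (move z s)) * vx z ^ 2)) drift_rate l).
  cbv beta in G.
  replace (momentum (move z 0)) with (momentum z) in G.
  2:{ destruct z; unfold move; simpl; now rewrite !Rmult_0_l, !Rplus_0_r. }
  apply G; clear G; [apply Rlt_le, H| |].
  - intros s Hl. assert (A := step_flight_closed _ _ _ _ H Hl).
    assert (D := momentum_derive z s (proj1 A)).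
    set (g := fun t => momentum (move z t)) in D.
    change (is_derive (fun t => 1 - sg * g t) s
      (sg * ((py (move z s) - lo P (px (move z s)))
       * floor_curv1 (px (move z s)) * vx z ^ 2))).
    auto_derive.
    + eexists; exact D.
    + rewrite (Derive_at g _ _ D). ring.
  - intros s Hl. assert (A := step_flight_closed _ _ _ _ H Hl).
    assert (B := defect_ge sg _ Hsg A Hs).
    assert (C := floor_curv1_bound _ (proj1 A)).
    destruct A as (Hx & Hy & Hv).
    change (vx (move z s)) with (vx z) in Hv.
    set (h := py (move z s) - lo P (px (move z s))) in *.
    set (k1 := floor_curv1 (px (move z s))) in *.
    assert (0 <= h) by (unfold h; lra).
    assert (Hc := curv_gap_pos P). assert (HK := curv_bnd_ge1 P).
    apply (Rle_trans _ (- (h * (K + K ^ 2)))).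
    + unfold drift_rate.
      assert (h * (K + K ^ 2) <=
        16 * (K + K ^ 2) / c * (1 - sg * momentum (move z s))); [|lra].
      replace (h * (K + K ^ 2)) with (16 * (K + K ^ 2) / c * (c / 16 * h))
        by (field; lra).
      apply Rmult_le_compat_l; [|exact B].
      apply Rlt_le, Rdiv_lt_0_compat; [nra|lra].
    + assert (Rabs (sg * (h * k1 * vx z ^ 2)) <= h * (K + K ^ 2)).
      { assert (Rabs sg <= 1) by (apply Rabs_le; split; nra).
        assert (0 <= vx z ^ 2 <= 1) by (split; [apply pow2_ge_0|nra]).
        rewrite !Rabs_mult, (Rabs_pos_eq h), (Rabs_pos_eq (vx z ^ 2)) by lra.
        assert (0 <= Rabs k1) by apply Rabs_pos.
        assert (h * Rabs k1 * vx z ^ 2 <= h * (K + K ^ 2) * 1).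
        { apply Rmult_le_compat; try lra; [apply Rmult_le_pos; lra|].
          apply Rmult_le_compat_l; lra. }
        assert (0 <= h * Rabs k1 * vx z ^ 2)
          by (apply Rmult_le_pos; [apply Rmult_le_pos|]; lra).
        apply (Rle_trans _ (1 * (h * Rabs k1 * vx z ^ 2))); [|lra].
        apply Rmult_le_compat_r; lra. }
      match goal with H : Rabs (sg * _) <= _ |- _ => apply Rabs_le_between in H end.
      lra.
Qed.

(** * Single flights between the walls *)

Lemma step_on_wall (z z' : state) (l : R) : step z l z' ->
  py z' = lo P (px z') \/ py z' = hi P (px z').
Proof.
  intros (_ & _ & _ & [[E ->] | [E ->]]); [left|right]; exact E.
Qed.

(** A tangent flight would fall below the convex floor. *)
Lemma leaves_floor (z : state) (l : R) : admissible z -> flight z l ->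
  py z = lo P (px z) -> 0 < vy z - lo1 P (px z) * vx z.
Proof.
  intros (Hx & _ & Hv) (Hl & Hf) E.
  destruct (Hf (l / 2)) as [Hx' [Hlo _]]; [lra|].
  unfold move in *; simpl in *.
  destruct (Req_dec (vx z) 0) as [V|V].
  - rewrite V in *. rewrite Rmult_0_r, Rplus_0_r in Hlo. nra.
  - assert (T := lo_above_tangent (px z) (px z + l / 2 * vx z) Hx Hx').
    assert (l / 2 * vx z <> 0) by (apply Rmult_integral_contrapositive; lra).
    assert (px z <> px z + l / 2 * vx z) by lra. specialize (T H0). nra.
Qed.

(** Only a weak inequality: the dispersing wall can be hit tangentially. *)
Lemma reaches_ceiling (z : state) (l : R) : flight z l ->
  0 < px (move z l) < a -> py (move z l) = hi P (px (move z l)) ->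
  0 <= vy z - hi1 P (px (move z l)) * vx z.
Proof.
  intros (Hl & Hf) Hx E.
  destruct (Rle_or_lt 0 (vy z - hi1 P (px (move z l)) * vx z)) as [|N];
    [assumption|exfalso].
  set (x := px (move z l)) in *.
  set (q := vy z - hi1 P x * vx z) in *.
  (* At time [s] before the collision the particle is below the ceiling, which
     lies within [K * (s * vx z) ^ 2] of its tangent at the collision point. *)
  assert (Hb : forall s, 0 < s < l -> - q <= K * vx z ^ 2 * s).
  { intros s Hs. destruct (Hf (l - s)) as [Hx' [_ Hhi]]; [lra|].
    assert (Ex : px (move z (l - s)) = x - s * vx z)
      by (unfold x, move; simpl; ring).
    assert (Ey : py (move z (l - s)) = hi P x - s * vy z)
      by (rewrite <- E; unfold move; simpl; ring).
    rewrite Ey, Ex in *.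
    assert (T : hi P (x - s * vx z) + hi1 P (x - s * vx z) * (s * vx z) <= hi P x).
    { destruct (Req_dec (s * vx z) 0) as [V|V].
      - rewrite V, Rmult_0_r, Rminus_0_r. lra.
      - assert (T := hi_above_tangent (x - s * vx z) x Hx' Hx ltac:(lra)). lra. }
    destruct (mean_value (hi1 P) (hi2 P) (x - s * vx z) x) as (t & Ht & Et).
    { intros t Ht. apply hi1_d. revert Ht. unfold Rmin, Rmax.
      destruct (Rle_dec (x - s * vx z) x); lra. }
    assert (Ht' : 0 < t < a).
    { revert Ht. unfold Rmin, Rmax. destruct (Rle_dec (x - s * vx z) x); lra. }
    assert (H2 := hi2_range P t Ht').
    assert (H2' := lo2_range P t Ht'). assert (Hc := curv_gap_pos P).
    replace (x - (x - s * vx z)) with (s * vx z) in Et by ring.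
    assert (G : s * (vy z - hi1 P x * vx z) >= - (hi2 P t * (s * vx z) * (s * vx z)))
      by nra.
    assert (B : hi2 P t * (s * vx z) ^ 2 <= K * (s * vx z) ^ 2)
      by (apply Rmult_le_compat_r; [apply pow2_ge_0|lra]).
    fold q in G.
    apply (Rmult_le_reg_l s); [lra|]. nra. }
  set (s := Rmin (l / 2) (- q / (2 * (K * vx z ^ 2 + 1)))).
  assert (HK := curv_bnd_ge1 P).
  assert (HV : 0 <= K * vx z ^ 2) by (apply Rmult_le_pos; [lra|apply pow2_ge_0]).
  assert (0 < - q / (2 * (K * vx z ^ 2 + 1))) by (apply Rdiv_lt_0_compat; lra).
  assert (0 < s) by (unfold s; apply Rmin_case; lra).
  assert (s <= l / 2) by apply Rmin_l.
  assert (s <= - q / (2 * (K * vx z ^ 2 + 1))) by apply Rmin_r.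
  specialize (Hb s ltac:(lra)).
  assert ((K * vx z ^ 2 + 1) * s <= - q / 2).
  { replace (- q / 2) with
      ((K * vx z ^ 2 + 1) * (- q / (2 * (K * vx z ^ 2 + 1)))) by (field; lra).
    apply Rmult_le_compat_l; lra. }
  lra.
Qed.

(** The midpoint of a chord of a convex function lies above the graph. *)
Lemma no_ceiling_to_ceiling (z : state) (l : R) : flight z l ->
  0 < px z < a -> 0 < px (move z l) < a ->
  py z = hi P (px z) -> py (move z l) = hi P (px (move z l)) -> False.
Proof.
  intros (Hl & Hf) Hx Hx' E E'.
  destruct (Hf (l / 2)) as [Hm [_ Hhi]]; [lra|].
  set (m := px (move z (l / 2))) in *.
  assert (Em : m = px z + l / 2 * vx z) by reflexivity.
  assert (El : px (move z l) = px z + l * vx z) by reflexivity.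
  assert (W : forall t, 0 < t < a -> hi P m + hi1 P m * (t - m) <= hi P t).
  { intros t Ht. destruct (Req_dec m t) as [->|].
    - lra.
    - now apply Rlt_le, hi_above_tangent. }
  assert (W1 := W _ Hx). assert (W2 := W _ Hx').
  rewrite <- E in W1. rewrite <- E' in W2.
  rewrite El, Em in W2. rewrite Em in W1. rewrite Em in Hhi.
  unfold move in *; simpl in *. nra.
Qed.

(** A zero defect needs zero height and a tangent velocity, and no flight starts
    like that. *)
Lemma defect_pos (sg : R) (z : state) (l : R) : sg ^ 2 = 1 ->
  admissible z -> flight z l -> 1 / 2 <= sg * vx z ->
  0 < 1 - sg * momentum z.
Proof.
  intros Hsg A F Hs. assert (B := defect_ge sg z Hsg A Hs).
  assert (Hc := curv_gap_pos P).
  destruct (Req_dec (py z) (lo P (px z))) as [E|E].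
  - assert (L := leaves_floor z l A F E).
    destruct A as (Hx & Hy & Hv).
    assert (T := tangent_normal_sqr z Hv).
    unfold momentum. rewrite E.
    assert (Mp := slope_cos_pos (px z)).
    set (t := slope_cos (px z) * (vx z + lo1 P (px z) * vy z)) in *.
    assert (0 < slope_cos (px z) ^ 2 * (vy z - lo1 P (px z) * vx z) ^ 2)
      by (apply Rmult_lt_0_compat; apply pow_lt; lra).
    assert ((sg * t) ^ 2 < 1) by (rewrite Rpow_mult_distr, Hsg; lra).
    nra.
  - destruct A as (Hx & Hy & Hv). nra.
Qed.

(** A collision with the ceiling raises the momentum, hence raises the defect when
    the particle moves to the left. *)
Lemma defect_step (sg : R) (z z' : state) (l : R) : sg ^ 2 = 1 ->
  step z l z' -> 1 / 2 <= sg * vx z ->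
  sg = -1 \/ lower_bounce (move z l) z' ->
  (1 - sg * momentum z) * exp (- drift_rate * l) <= 1 - sg * momentum z'.
Proof.
  intros Hsg H Hs Hb.
  eapply Rle_trans; [apply (defect_flight sg z z' l Hsg H Hs)|].
  assert (A : admissible (move z l)).
  { apply (step_flight_closed _ _ _ _ H). split; [apply Rlt_le, H|lra]. }
  destruct H as (_ & F & _ & [L | U]).
  - rewrite (momentum_lower_bounce _ _ L). lra.
  - destruct Hb as [->|L].
    + assert (momentum (move z l) <= momentum z'); [|lra].
      apply momentum_upper_bounce; [apply A| |exact U].
      exact (reaches_ceiling z l F (proj1 A) (proj1 U)).
    + rewrite (momentum_lower_bounce _ _ L). lra.
Qed.

(** A discrete Groenwall inequality; [B] is a bounded clock that controls the
    durations [l]. *)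
Lemma no_decay (D l B : nat -> R) (A M : R) : 0 <= A ->
  (forall k, D k * exp (- A * l k) <= D (S k)) ->
  (forall k, l k <= B (S k) - B k) ->
  (forall k, B k <= M) ->
  0 < D 0%nat ->
  exists eps, 0 < eps /\ forall k, eps <= D k.
Proof.
  intros HA HD Hl HB H0.
  assert (I : forall k, D 0%nat * exp (- A * (B k - B 0%nat)) <= D k).
  { induction k as [|k IH].
    - rewrite Rminus_diag, Rmult_0_r, exp_0. lra.
    - eapply Rle_trans; [|apply HD].
      apply (Rle_trans _ (D 0%nat * exp (- A * (B k - B 0%nat)) * exp (- A * l k))).
      + rewrite Rmult_assoc, <- exp_plus. apply Rmult_le_compat_l; [lra|].
        assert (E : - A * (B (S k) - B 0%nat) <= - A * (B k - B 0%nat) + - A * l k).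
        { specialize (Hl k). nra. }
        destruct E as [E | ->]; [|lra]. apply Rlt_le, exp_increasing, E.
      + apply Rmult_le_compat_r; [apply Rlt_le, exp_pos|exact IH]. }
  exists (D 0%nat * exp (- A * (M - B 0%nat))). split.
  - apply Rmult_lt_0_compat; [lra|apply exp_pos].
  - intros k. eapply Rle_trans; [|apply I]. apply Rmult_le_compat_l; [lra|].
    assert (E : - A * (M - B 0%nat) <= - A * (B k - B 0%nat)).
    { specialize (HB k). nra. }
    destruct E as [E | ->]; [|lra]. apply Rlt_le, exp_increasing, E.
Qed.

(** * Collisions cannot accumulate at the tip *)

(** The flux grows at least at the rate [(1 - 3 * K * d) * w'], and [w] changes at
    the rate [w' * u] with [u >= - 1]. *)
Lemma flux_plus_gap_step (z z' : state) (l d : R) : step z l z' ->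
  px z <= d -> px z' <= d -> d <= a ->
  flux z + (1 - 3 * K * d) * (hi P (px z) - lo P (px z)) <=
  flux z' + (1 - 3 * K * d) * (hi P (px z') - lo P (px z')).
Proof.
  intros H Hz Hz' Hd. assert (Ex := step_px _ _ _ H). rewrite Ex in Hz'.
  assert (Ef : flux z' = flux (move z l)) by (apply flux_bounce; apply H).
  rewrite Ef, Ex.
  assert (M := increasing_of_derivative
    (fun s => flux (move z s)
       - - (1 - 3 * K * d) * (hi P (px (move z s)) - lo P (px (move z s))))
    (fun s => flux_rate (move z s)
       - - (1 - 3 * K * d) *
           ((hi1 P (px (move z s)) - lo1 P (px (move z s))) * vx z)) 0 l).
  cbv beta in M.
  replace (flux (move z 0)) with (flux z) in M.
  2:{ destruct z; unfold move; simpl; now rewrite !Rmult_0_l, !Rplus_0_r. }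
  replace (px (move z 0)) with (px z) in M by (simpl; ring).
  change (px (move z l)) with (px z + l * vx z) in M.
  enough (flux z - - (1 - 3 * K * d) * (hi P (px z) - lo P (px z)) <=
          flux (move z l) - - (1 - 3 * K * d) *
            (hi P (px z + l * vx z) - lo P (px z + l * vx z))) by lra.
  assert (Hl : 0 < l) by apply H.
  apply M; clear M; [lra| |].
  - intros s Hs. assert (A := step_flight_closed _ _ _ _ H Hs).
    apply is_derive_Rminus; [apply flux_derive, A|].
    apply is_derive_scal, gap_derive, A.
  - intros s Hs. assert (A := step_flight_closed _ _ _ _ H Hs).
    assert (B := flux_rate_ge _ A). assert (C := slope_gap_ge _ A).
    assert (Hc := curv_gap_pos P). assert (HK := curv_bnd_ge1 P).
    assert (0 < px (move z s)) by apply A.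
    assert (Hsd : px (move z s) <= d).
    { change (px (move z s)) with (px z + s * vx z). nra. }
    assert (Hv : vx z ^ 2 + vy z ^ 2 = 1) by apply A.
    set (w1 := hi1 P (px (move z s)) - lo1 P (px (move z s))) in *.
    assert (Hw : 0 <= w1) by nra.
    assert (Hr := reach_small P).
    assert (0 <= 1 - 3 * K * d) by nra.
    assert (w1 * (1 - 3 * K * d) <= w1 * (1 - 3 * K * px (move z s))).
    { apply Rmult_le_compat_l; nra. }
    assert (0 <= (w1 * (1 - 3 * K * d)) * (1 + vx z)).
    { apply Rmult_le_pos; [apply Rmult_le_pos; lra|nra]. }
    nra.
Qed.

(** The monotone quantity of [flux_plus_gap_step] tends to [0] with [x], so it is at
    most [0] now.  Its leading part is [w * (u + 1)], whence the bound. *)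
Lemma vx_toward_tip (st : nat -> state) (ls : nat -> R) (d : R) :
  (forall k, step (st k) (ls k) (st (S k))) ->
  (forall eps, 0 < eps -> exists k, px (st k) < eps) ->
  (forall k, px (st k) <= d) -> d <= a ->
  vx (st 0%nat) <= -1 + 5 * K * d.
Proof.
  intros H Hlim Hd Hda.
  set (Psi := fun z => flux z + (1 - 3 * K * d) * (hi P (px z) - lo P (px z))).
  assert (Hmon : forall k, Psi (st 0%nat) <= Psi (st k)).
  { induction k as [|k IH]; [lra|]. eapply Rle_trans; [exact IH|].
    now apply (flux_plus_gap_step _ _ (ls k) d). }
  assert (HK := curv_bnd_ge1 P). assert (Hr := reach_small P).
  assert (Hup : forall k, Psi (st k) <= px (st k)).
  { intros k. assert (A : admissible (st k)) by apply (H k).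
    assert (F := flux_bound _ A). apply Rabs_le_between in F.
    assert (B := curv_bnd_px_small _ A). destruct A as (Hx & _).
    assert (W := hi_range P _ Hx). assert (L := lo_range P _ Hx).
    assert (Hc := curv_gap_pos P).
    unfold Psi. set (w := hi P (px (st k)) - lo P (px (st k))).
    assert (0 <= w <= K * px (st k) ^ 2) by (unfold w; nra).
    assert ((1 - 3 * K * d) * w <= 1 * w).
    { apply Rmult_le_compat_r; [lra|]. specialize (Hd k). nra. }
    nra. }
  assert (Hneg : Psi (st 0%nat) <= 0).
  { destruct (Rle_or_lt (Psi (st 0%nat)) 0) as [|N]; [assumption|].
    destruct (Hlim _ N) as [k Hk]. specialize (Hmon k). specialize (Hup k). lra. }
  assert (A : admissible (st 0%nat)) by apply (H 0%nat).
  specialize (Hd 0%nat). clear - Hneg A Hd HK Hr Hda.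
  set (z := st 0%nat) in *. clearbody z.
  assert (C := slope_gap_ge _ A). destruct A as (Hx & Hy & Hv).
  assert (W := hi_range P _ Hx). assert (Hc := curv_gap_pos P).
  assert (L1 := lo1_range P _ Hx).
  unfold Psi, flux in Hneg. clear Psi.
  set (w := hi P (px z) - lo P (px z)) in *.
  set (h := py z - lo P (px z)) in *.
  set (w1 := hi1 P (px z) - lo1 P (px z)) in *.
  assert (0 < w) by (apply gap_pos, Hx).
  assert (0 <= h <= w) by (unfold h, w; lra).
  assert (-1 <= vy z) by nra.
  assert (0 <= w1 * h) by (apply Rmult_le_pos; nra).
  assert (w1 * h <= w1 * w) by (apply Rmult_le_compat_l; nra).
  assert (- (w1 * w) <= w1 * h * vy z) by nra.
  assert (- lo1 P (px z) <= lo1 P (px z) * vy z) by nra.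
  assert (w * (vx z - lo1 P (px z) - w1 + (1 - 3 * K * d)) <= 0).
  { assert (w * (vx z - lo1 P (px z)) <= w * (vx z + lo1 P (px z) * vy z))
      by (apply Rmult_le_compat_l; lra). nra. }
  assert (vx z - lo1 P (px z) - w1 + (1 - 3 * K * d) <= 0).
  { apply (Rmult_le_reg_l w); lra. }
  assert (K * px z <= K * d) by (apply Rmult_le_compat_l; lra).
  lra.
Qed.

(** Near the tip the floor is flat and the heights are small, so a velocity close
    to [(- 1, 0)] is close to the motion along the floor. *)
Lemma defect_le_near_tip (z : state) : admissible z ->
  vx z <= -1 + 5 * K * px z -> 1 + momentum z <= 8 * K * px z.
Proof.
  intros A Hu. assert (B := curv_bnd_px_small _ A). destruct A as (Hx & Hy & Hv).
  assert (L1 := lo1_range P _ Hx). assert (L2 := lo2_range P _ Hx).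
  assert (W := hi_range P _ Hx). assert (L := lo_range P _ Hx).
  assert (Hc := curv_gap_pos P). assert (HK := curv_bnd_ge1 P).
  assert (Q := slope_cos_sqr (px z)). assert (Mp := slope_cos_pos (px z)).
  unfold momentum, floor_curv.
  set (m := slope_cos (px z)) in *. set (p := lo1 P (px z)) in *.
  set (h := py z - lo P (px z)) in *. set (k := lo2 P (px z)) in *.
  assert (m <= 1) by nra.
  assert (1 - p <= m).
  { assert (m ^ 2 <= m) by nra. assert (0 <= p <= 1) by lra. nra. }
  assert (-1 <= vx z) by nra. assert (vy z <= 1) by nra.
  assert (m * vx z <= vx z + p) by nra.
  assert (0 <= m * p <= p) by nra.
  assert (m * p * vy z <= p) by nra.
  assert (0 <= h <= K * px z ^ 2) by (unfold h; nra).
  assert (h <= px z / 100) by nra.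
  assert (m ^ 3 <= 1) by (rewrite <- (pow1 3); apply pow_incr; lra).
  assert (0 <= m ^ 3) by (apply pow_le; lra).
  assert (0 <= k * m ^ 3 <= K) by nra.
  assert (h * (k * m ^ 3) <= px z / 100 * K) by (apply Rmult_le_compat; lra).
  assert (0 <= h * (k * m ^ 3)) by (apply Rmult_le_pos; lra).
  assert (- (h * (k * m ^ 3) * vx z) <= h * (k * m ^ 3)) by nra.
  nra.
Qed.

(** As [u <= - 1 / 2] throughout, [- 2 * x] is a clock in the sense of [no_decay]:
    the defect stays away from [0], against [defect_le_near_tip]. *)
Lemma not_into_tip (st : nat -> state) (ls : nat -> R) :
  (forall k, step (st k) (ls k) (st (S k))) ->
  ~ (forall eps, 0 < eps -> exists N, forall k, (N <= k)%nat -> px (st k) < eps).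
Proof.
  intros H Hlim.
  assert (HK := curv_bnd_ge1 P). assert (Hr := reach_small P).
  assert (Adm : forall k, admissible (st k)) by (intros k; apply (H k)).
  assert (Hshift : forall n d, (forall k, (n <= k)%nat -> px (st k) <= d) ->
            d <= a -> vx (st n) <= -1 + 5 * K * d).
  { intros n d Hd Hda.
    assert (V := vx_toward_tip (fun k => st (n + k)%nat) (fun k => ls (n + k)%nat) d).
    cbv beta in V. rewrite Nat.add_0_r in V. apply V; [| | |exact Hda].
    - intros k. rewrite Nat.add_succ_r. apply H.
    - intros eps He. destruct (Hlim eps He) as [N HN].
      exists N. apply HN. lia.
    - intros k. apply Hd. lia. }
  assert (Hhalf : forall n, vx (st n) <= - (1 / 2)).
  { intros n. assert (V := Hshift n a). enough (vx (st n) <= -1 + 5 * K * a) by lra.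
    apply V; [|lra]. intros k _. destruct (Adm k) as (Hx & _). lra. }
  assert (Hdec : forall n k, (n <= k)%nat -> px (st k) <= px (st n)).
  { intros n k Hk. induction Hk as [|k Hk IH]; [lra|].
    rewrite (step_px _ _ _ (H k)). specialize (Hhalf k).
    assert (0 < ls k) by apply (H k). nra. }
  destruct (no_decay (fun k => 1 - (-1) * momentum (st k)) ls
    (fun k => - 2 * px (st k)) drift_rate 0) as (eps & He & Hk).
  - apply Rlt_le, drift_rate_pos.
  - intros k. apply defect_step; [ring|apply H| |now left].
    specialize (Hhalf k). lra.
  - intros k. rewrite (step_px _ _ _ (H k)). specialize (Hhalf k).
    assert (0 < ls k) by apply (H k). nra.
  - intros k. destruct (Adm k) as (Hx & _). lra.
  - apply (defect_pos (-1) _ (ls 0%nat)); [ring|apply Adm|apply (H 0%nat)|].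
    specialize (Hhalf 0%nat). lra.
  - destruct (Hlim (eps / (16 * K))) as [N HN]; [apply Rdiv_lt_0_compat; lra|].
    specialize (HN N (le_n N)). specialize (Hk N). cbv beta in Hk.
    assert (D := defect_le_near_tip _ (Adm N)
      (Hshift N (px (st N)) (Hdec N) ltac:(destruct (Adm N) as (Hx & _); lra))).
    assert (8 * K * px (st N) <= 8 * K * (eps / (16 * K)))
      by (apply Rmult_le_compat_l; lra).
    replace (8 * K * (eps / (16 * K))) with (eps / 2) in * by (field; lra).
    lra.
Qed.

(** * Collisions cannot accumulate away from the tip *)

(** The gap between the walls is at least [c / 2 * r ^ 2], and the floor has slope
    at most [1]. *)
Lemma wall_change_takes_time (z z' : state) (l r : R) : step z l z' ->
  0 < r -> r <= px z -> r <= px z' -> 4 * l < c * r ^ 2 ->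
  ~ (py z = lo P (px z) /\ py z' = hi P (px z')) /\
  ~ (py z = hi P (px z) /\ py z' = lo P (px z')).
Proof.
  intros H Hr Hz Hz' Hl.
  assert (Ex := step_px _ _ _ H). assert (Ey := step_py _ _ _ H).
  destruct H as (A & (Hl0 & _) & A' & _).
  assert (B := curv_bnd_px_small _ A). assert (B' := curv_bnd_px_small _ A').
  destruct A as (Hx & _ & Hv). destruct A' as (Hx' & _ & _).
  destruct (mean_value (lo P) (lo1 P) (px z) (px z')) as (t & Ht & Et).
  { intros t Ht. apply lo_d. revert Ht. unfold Rmin, Rmax.
    destruct (Rle_dec (px z) (px z')); lra. }
  assert (Ht' : 0 < t < a /\ K * t <= 1).
  { assert (HK := curv_bnd_ge1 P). assert (Hs := reach_small P).
    assert (0 < t < a).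
    { revert Ht. unfold Rmin, Rmax. destruct (Rle_dec (px z) (px z')); lra. }
    split; [assumption|nra]. }
  assert (L1 := lo1_range P t (proj1 Ht')).
  assert (Rabs (vx z) <= 1) by (apply Rabs_le; nra).
  assert (Rabs (vy z) <= 1) by (apply Rabs_le; nra).
  assert (Hlo : Rabs (lo P (px z') - lo P (px z)) <= l).
  { rewrite Et, Ex, Rabs_mult, (Rabs_pos_eq (lo1 P t)) by lra.
    replace (px z + l * vx z - px z) with (l * vx z) by ring.
    rewrite Rabs_mult, (Rabs_pos_eq l) by lra.
    assert (0 <= Rabs (vx z)) by apply Rabs_pos.
    assert (l * Rabs (vx z) <= l) by nra.
    assert (0 <= l * Rabs (vx z)) by nra. nra. }
  assert (Hy : Rabs (py z' - py z) <= l).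
  { rewrite Ey. replace (py z + l * vy z - py z) with (l * vy z) by ring.
    rewrite Rabs_mult, (Rabs_pos_eq l) by lra. nra. }
  apply Rabs_le_between in Hlo. apply Rabs_le_between in Hy.
  assert (W := hi_range P _ Hx). assert (W' := hi_range P _ Hx').
  assert (Hc := curv_gap_pos P).
  assert (c / 2 * r ^ 2 <= c / 2 * px z ^ 2)
    by (apply Rmult_le_compat_l; [lra|apply pow_incr; lra]).
  assert (c / 2 * r ^ 2 <= c / 2 * px z' ^ 2)
    by (apply Rmult_le_compat_l; [lra|apply pow_incr; lra]).
  split; intros [E E']; rewrite E, E' in Hy; lra.
Qed.

(** The slope [q] of the chord is that of the floor at an intermediate point. *)
Lemma floor_chord (z z' : state) (l : R) : step z l z' ->
  py z = lo P (px z) -> py z' = lo P (px z') ->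
  exists q, 0 <= q <= 1 / 100 /\ vy z = q * vx z /\
    Rabs (q - lo1 P (px z)) <= K * l.
Proof.
  intros H E E'. assert (Ex := step_px _ _ _ H). assert (Ey := step_py _ _ _ H).
  destruct H as ((Hx & _ & Hv) & (Hl & _) & (Hx' & _) & _).
  assert (HK := curv_bnd_ge1 P). assert (Hs := reach_small P).
  assert (Hin : forall t, Rmin (px z) (px z') <= t <= Rmax (px z) (px z') -> 0 < t < a).
  { intros t. unfold Rmin, Rmax. destruct (Rle_dec (px z) (px z')); lra. }
  destruct (mean_value (lo P) (lo1 P) (px z) (px z')) as (t & Ht & Et).
  { intros t Ht. apply lo_d, Hin, Ht. }
  exists (lo1 P t). assert (Ht' := Hin t Ht). assert (L1 := lo1_range P t Ht').
  split; [nra|split].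
  - apply (Rmult_eq_reg_l l); [|lra].
    rewrite <- E, <- E', Ey, Ex in Et. lra.
  - destruct (mean_value (lo1 P) (lo2 P) (px z) t) as (r & Hr & Er).
    { intros r Hr. apply lo1_d, Hin. revert Hr Ht. unfold Rmin, Rmax.
      destruct (Rle_dec (px z) (px z')); destruct (Rle_dec (px z) t); lra. }
    assert (Hr' : 0 < r < a).
    { apply Hin. revert Hr Ht. unfold Rmin, Rmax.
      destruct (Rle_dec (px z) (px z')); destruct (Rle_dec (px z) t); lra. }
    assert (L2 := lo2_range P r Hr'). assert (Hc := curv_gap_pos P).
    rewrite Er, Rabs_mult, (Rabs_pos_eq (lo2 P r)) by lra.
    apply Rmult_le_compat; [lra|apply Rabs_pos|lra|].
    assert (Rabs (px z' - px z) <= l).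
    { rewrite Ex. replace (px z + l * vx z - px z) with (l * vx z) by ring.
      assert (Rabs (vx z) <= 1) by (apply Rabs_le; nra).
      rewrite Rabs_mult, (Rabs_pos_eq l) by lra.
      assert (0 <= Rabs (vx z)) by apply Rabs_pos. nra. }
    apply Rabs_le_between in H. apply Rabs_le. revert Ht. unfold Rmin, Rmax.
    destruct (Rle_dec (px z) (px z')); lra.
Qed.

Lemma unit_chord_speed (u v q : R) : u ^ 2 + v ^ 2 = 1 -> v = q * u ->
  0 <= q <= 1 / 100 -> 1 / 2 < u \/ u < - (1 / 2).
Proof.
  intros E -> Hq. assert (u ^ 2 * (1 + q ^ 2) = 1)
    by (transitivity (u ^ 2 + (q * u) ^ 2); [ring|exact E]).
  assert (q ^ 2 <= 1) by nra.
  destruct (Rle_or_lt 0 u); [left|right]; nra.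
Qed.

(** On a chord of the floor of length [l] the velocity makes an angle at most [K * l]
    with the floor, so the defect at its start is [O(l ^ 2)].  The velocity keeps its direction
    [sg], as the tangential velocity is preserved and the slopes are small.  The
    flux serves as the clock of [no_decay]. *)
Lemma no_floor_accumulation (st : nat -> state) (ls : nat -> R) (A M : R) :
  (forall k, step (st k) (ls k) (st (S k))) ->
  (forall k, py (st k) = lo P (px (st k))) ->
  (forall k, ls k <= A * (flux (st (S k)) - flux (st k))) ->
  (forall k, A * flux (st k) <= M) ->
  ~ (forall eps, 0 < eps -> exists k, ls k < eps).
Proof.
  intros H Hf Hl HM Hlim.
  assert (HK := curv_bnd_ge1 P). assert (Hs := reach_small P).
  assert (Ch := fun k => floor_chord _ _ _ (H k) (Hf k) (Hf (S k))).
  assert (Adm : forall k, admissible (st k)) by (intros k; apply (H k)).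
  assert (Sg : exists sg, sg ^ 2 = 1 /\ 1 / 2 < sg * vx (st 0%nat)).
  { destruct (Ch 0%nat) as (q & Hq & Ev & _).
    destruct (unit_chord_speed _ _ _ (proj2 (proj2 (Adm 0%nat))) Ev Hq).
    - exists 1. lra.
    - exists (-1). lra. }
  destruct Sg as (sg & Hsg & H0).
  assert (Lo1 : forall k, 0 <= lo1 P (px (st k)) <= 1 / 100).
  { intros k. destruct (Adm k) as (Hx & _). generalize (lo1_range P _ Hx). nra. }
  assert (Low : forall k, lower_bounce (move (st k) (ls k)) (st (S k))).
  { intros k. assert (Hk := H k). destruct Hk as (_ & F & A' & [|U]); [assumption|].
    exfalso. specialize (Hf (S k)). destruct A' as (Hx & _).
    destruct U as [E EU]. rewrite EU in Hf, Hx. simpl in E, Hf, Hx.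
    assert (W := hi_range P _ Hx). assert (Hc := curv_gap_pos P).
    assert (0 < c / 2 * (px (st k) + ls k * vx (st k)) ^ 2)
      by (apply Rmult_lt_0_compat; [lra|apply pow_lt; lra]).
    lra. }
  assert (Hdir : forall k, 1 / 2 < sg * vx (st k)).
  { induction k as [|k IH]; [exact H0|].
    destruct (Ch k) as (q & Hq & Ev & _).
    destruct (Ch (S k)) as (q' & Hq' & Ev' & _).
    assert (Hu := unit_chord_speed _ _ _ (proj2 (proj2 (Adm (S k)))) Ev' Hq').
    assert (T : vx (st (S k)) + lo1 P (px (st (S k))) * vy (st (S k))
              = vx (st k) + lo1 P (px (st (S k))) * vy (st k)).
    { destruct (Low k) as [_ ->]. simpl.
      set (p := lo1 P (px (st k) + ls k * vx (st k))). field. nra. }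
    specialize (Lo1 (S k)). set (p := lo1 P (px (st (S k)))) in *.
    rewrite Ev, Ev' in T.
    assert (T' : sg * vx (st (S k)) * (1 + p * q') = sg * vx (st k) * (1 + p * q)).
    { replace (sg * vx (st (S k)) * (1 + p * q'))
        with (sg * (vx (st (S k)) + p * (q' * vx (st (S k))))) by ring.
      rewrite T. ring. }
    assert (0 <= p * q) by (apply Rmult_le_pos; lra).
    assert (0 <= p * q') by (apply Rmult_le_pos; lra).
    assert (Hpos : 0 < sg * vx (st (S k))).
    { apply (Rmult_lt_reg_r (1 + p * q')); [lra|]. rewrite T', Rmult_0_l.
      apply Rmult_lt_0_compat; lra. }
    assert (Hsg' : (sg - 1) * (sg + 1) = 0) by (ring_simplify; lra).
    apply Rmult_integral in Hsg'. destruct Hsg' as [Hsg'|Hsg'].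
    - replace sg with 1 in * by lra. lra.
    - replace sg with (-1) in * by lra. lra. }
  destruct (no_decay (fun k => 1 - sg * momentum (st k)) ls
    (fun k => A * flux (st k)) drift_rate M) as (eps & He & Hk).
  - apply Rlt_le, drift_rate_pos.
  - intros k. apply defect_step; [exact Hsg|apply H| |right; apply Low].
    apply Rlt_le, Hdir.
  - intros k. specialize (Hl k). lra.
  - exact HM.
  - apply (defect_pos sg _ (ls 0%nat)); [exact Hsg|apply Adm|apply (H 0%nat)|].
    apply Rlt_le, H0.
  - assert (Hd : forall k, 1 - sg * momentum (st k) <= (K * ls k) ^ 2).
    { intros k. destruct (Ch k) as (q & Hq & Ev & Hqp).
      assert (T := tangent_normal_sqr (st k) (proj2 (proj2 (Adm k)))).
      assert (V := proj2 (proj2 (Adm k))).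
      specialize (Hdir k). specialize (Lo1 k).
      unfold momentum. rewrite (Hf k). rewrite Rminus_diag, !Rmult_0_l, Rminus_0_r.
      assert (Q := slope_cos_sqr (px (st k))). assert (Mp := slope_cos_pos (px (st k))).
      set (m := slope_cos (px (st k))) in *. set (p := lo1 P (px (st k))) in *.
      set (t := m * (vx (st k) + p * vy (st k))) in *.
      assert (0 <= sg * t).
      { unfold t. rewrite Ev.
        replace (sg * (m * (vx (st k) + p * (q * vx (st k)))))
          with (m * (1 + p * q) * (sg * vx (st k))) by ring.
        assert (0 <= p * q) by (apply Rmult_le_pos; lra).
        apply Rmult_le_pos; [apply Rmult_le_pos|]; lra. }
      assert (Est : (sg * t) ^ 2 = t ^ 2) by (rewrite Rpow_mult_distr, Hsg; ring).
      assert (0 <= m ^ 2 * (vy (st k) - p * vx (st k)) ^ 2)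
        by (apply Rmult_le_pos; apply pow2_ge_0).
      assert (1 - sg * t <= 1 - (sg * t) ^ 2) by nra.
      assert (m ^ 2 * (vy (st k) - p * vx (st k)) ^ 2 <= 1 * (q - p) ^ 2).
      { apply Rmult_le_compat; [apply pow2_ge_0|apply pow2_ge_0|nra|].
        rewrite Ev. replace ((q * vx (st k) - p * vx (st k)) ^ 2)
          with ((q - p) ^ 2 * vx (st k) ^ 2) by ring.
        assert (vx (st k) ^ 2 <= 1) by nra.
        rewrite <- (Rmult_1_r ((q - p) ^ 2)) at 2.
        apply Rmult_le_compat_l; [apply pow2_ge_0|lra]. }
      assert ((q - p) ^ 2 <= (K * ls k) ^ 2).
      { rewrite <- (pow2_abs (q - p)). apply pow_incr. split; [apply Rabs_pos|lra]. }
      lra. }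
    destruct (Hlim (Rmin 1 (eps / (2 * K ^ 2)))) as [k Hkl].
    { apply Rmin_case; [lra|]. apply Rdiv_lt_0_compat; nra. }
    specialize (Hk k). specialize (Hd k). cbv beta in Hk.
    assert (L0 : 0 < ls k) by apply (H k).
    assert (ls k < 1) by (eapply Rlt_le_trans; [exact Hkl|apply Rmin_l]).
    assert (ls k < eps / (2 * K ^ 2)) by (eapply Rlt_le_trans; [exact Hkl|apply Rmin_r]).
    assert (K ^ 2 * ls k <= K ^ 2 * (eps / (2 * K ^ 2)))
      by (apply Rmult_le_compat_l; nra).
    replace (K ^ 2 * (eps / (2 * K ^ 2))) with (eps / 2) in * by (field; nra).
    assert ((K * ls k) ^ 2 <= K ^ 2 * ls k).
    { replace ((K * ls k) ^ 2) with (K ^ 2 * (ls k * ls k)) by ring.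
      apply Rmult_le_compat_l; nra. }
    lra.
Qed.

(** Both [flux] and [4 / c * flux - x ^ 2] are monotone and bounded along the
    trajectory, so that [x ^ 2] converges. *)
Theorem no_infinite_trajectory (st : nat -> state) (ls : nat -> R) :
  ~ (forall k, step (st k) (ls k) (st (S k))).
Proof.
  intros H.
  assert (HK := curv_bnd_ge1 P). assert (Hs := reach_small P). assert (Hc := curv_gap_pos P).
  assert (Adm : forall k, admissible (st k)) by (intros k; apply (H k)).
  assert (Fs := fun k => flux_step _ _ _ (H k)).
  assert (Hpx : forall k, 0 < px (st k) < a) by (intros k; apply (Adm k)).
  assert (Hls : forall k, 0 < ls k) by (intros k; apply (H k)).
  assert (Hi : forall k, 0 <= ls k * (px (st k) + px (st (S k)))).
  { intros k. generalize (Hls k) (Hpx k) (Hpx (S k)); intros.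
    apply Rmult_le_pos; lra. }
  assert (Hfl : forall k, Rabs (flux (st k)) <= 1).
  { intros k. generalize (flux_bound _ (Adm k)) (curv_bnd_px_small _ (Adm k)) (Hpx k).
    intros. assert (a <= 1) by nra. nra. }
  destruct (ex_finite_lim_seq_incr (fun k => flux (st k)) 1) as [F HF].
  { intros k. specialize (Fs k). specialize (Hi k). nra. }
  { intros k. generalize (proj1 (Rabs_le_between _ _) (Hfl k)); lra. }
  destruct (ex_finite_lim_seq_incr
    (fun k => 4 / c * flux (st k) - px (st k) ^ 2) (4 / c)) as [G HG].
  { intros k. specialize (Fs k).
    assert (E : ls k * (px (st k) + px (st (S k))) <=
              4 / c * (flux (st (S k)) - flux (st k))).
    { replace (ls k * (px (st k) + px (st (S k)))) with
        (4 / c * (c / 4 * (ls k * (px (st k) + px (st (S k)))))) by (field; lra).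
      apply Rmult_le_compat_l; [apply Rlt_le, Rdiv_lt_0_compat; lra|exact Fs]. }
    assert (V : vx (st k) <= 1) by (destruct (Adm k) as (_ & _ & V); nra).
    assert (Ex := step_px _ _ _ (H k)).
    assert (px (st (S k)) ^ 2 - px (st k) ^ 2 <=
      ls k * (px (st k) + px (st (S k)))); [|lra].
    replace (px (st (S k)) ^ 2 - px (st k) ^ 2) with
      ((ls k * (px (st k) + px (st (S k)))) * vx (st k)) by (rewrite Ex; ring).
    specialize (Hi k). nra. }
  { intros k. generalize (proj1 (Rabs_le_between _ _) (Hfl k)); intros.
    assert (0 < 4 / c) by (apply Rdiv_lt_0_compat; lra).
    assert (0 <= px (st k) ^ 2) by apply pow2_ge_0. nra. }
  assert (HL : is_lim_seq (fun k => px (st k) ^ 2) (4 / c * F - G)).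
  { eapply is_lim_seq_ext; [|apply (is_lim_seq_minus' _ _ _ _
      (is_lim_seq_scal_l _ (4 / c) _ HF) HG)].
    intros k. cbv beta. ring. }
  set (L := 4 / c * F - G) in *.
  assert (HL' : forall eps, 0 < eps -> exists N, forall k, (N <= k)%nat ->
            Rabs (px (st k) ^ 2 - L) < eps).
  { intros eps He. apply is_lim_seq_spec in HL. exact (HL (mkposreal eps He)). }
  assert (L0 : 0 <= L).
  { destruct (Rle_or_lt 0 L) as [|N]; [assumption|].
    destruct (HL' (- L)) as [n Hn]; [lra|]. specialize (Hn n (le_n n)).
    apply Rabs_def2 in Hn. generalize (pow2_ge_0 (px (st n))). lra. }
  destruct (Rle_lt_or_eq_dec 0 L L0) as [Lpos|Lz].
  2:{
    apply (not_into_tip st ls H). intros eps He.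
    destruct (HL' (eps ^ 2)) as [N HN]; [apply pow_lt, He|].
    exists N. intros k Hk. specialize (HN k Hk). rewrite <- Lz in HN.
    apply Rabs_def2 in HN. specialize (Hpx k). nra. }
  set (r := Rmin (1 / 2) (L / 2)).
  assert (Hr : 0 < r <= 1 / 2 /\ r <= L / 2).
  { unfold r. split; [split; [apply Rmin_case; lra|apply Rmin_l]|apply Rmin_r]. }
  destruct (HL' (L / 2)) as [N1 HN1]; [lra|].
  assert (Hxr : forall k, (N1 <= k)%nat -> r <= px (st k)).
  { intros k Hk. specialize (HN1 k Hk). apply Rabs_def2 in HN1.
    destruct (Rle_or_lt r (px (st k))); [assumption|]. specialize (Hpx k). nra. }
  set (A := 2 / (c * r)).
  assert (HA : 0 < A) by (apply Rdiv_lt_0_compat; nra).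
  assert (Hl : forall k, (N1 <= k)%nat ->
            ls k <= A * (flux (st (S k)) - flux (st k))).
  { intros k Hk. specialize (Fs k).
    assert (X1 := Hxr k Hk). assert (X2 := Hxr (S k) ltac:(lia)).
    specialize (Hls k).
    assert (ls k * (2 * r) <= ls k * (px (st k) + px (st (S k))))
      by (apply Rmult_le_compat_l; lra).
    apply (Rmult_le_reg_l (c * r / 2)); [nra|].
    replace (c * r / 2 * (A * (flux (st (S k)) - flux (st k))))
      with (flux (st (S k)) - flux (st k)) by (unfold A; field; lra).
    nra. }
  assert (HF' : forall eps, 0 < eps -> exists N, forall k, (N <= k)%nat ->
            Rabs (flux (st k) - F) < eps).
  { intros eps He. apply is_lim_seq_spec in HF. exact (HF (mkposreal eps He)). }
  assert (Hl0 : forall eps, 0 < eps -> exists N, forall k, (N <= k)%nat -> ls k < eps).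
  { intros eps He. destruct (HF' (eps / (2 * A))) as [N HN];
      [apply Rdiv_lt_0_compat; lra|].
    exists (Nat.max N N1). intros k Hk. assert (Hk1 := Hl k ltac:(lia)).
    assert (X1 := HN k ltac:(lia)). assert (X2 := HN (S k) ltac:(lia)).
    apply Rabs_def2 in X1. apply Rabs_def2 in X2.
    assert (A * (flux (st (S k)) - flux (st k)) < A * (2 * (eps / (2 * A))))
      by (apply Rmult_lt_compat_l; lra).
    replace (A * (2 * (eps / (2 * A)))) with eps in * by (field; lra). lra. }
  destruct (Hl0 (c * r ^ 2 / 4)) as [N2 HN2].
  { assert (0 < r ^ 2) by (apply pow_lt; lra). nra. }
  set (N := S (Nat.max N1 N2)).
  assert (Wall : forall k, py (st (S k)) = lo P (px (st (S k))) \/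
                           py (st (S k)) = hi P (px (st (S k)))).
  { intros k. apply (step_on_wall _ _ _ (H k)). }
  assert (Floor : forall k, (N <= k)%nat -> py (st k) = lo P (px (st k))).
  { intros k Hk. destruct k as [|k]; [lia|].
    destruct (Wall k) as [E|E]; [exact E|exfalso].
    destruct (wall_change_takes_time _ _ _ r (H (S k))) as [_ W2].
    - lra.
    - apply Hxr; lia.
    - apply Hxr; lia.
    - specialize (HN2 (S k) ltac:(lia)). lra.
    - destruct (Wall (S k)) as [E'|E']; [now apply W2|].
      apply (no_ceiling_to_ceiling (st (S k)) (ls (S k))).
      + apply (H (S k)).
      + apply Hpx.
      + specialize (Hpx (S (S k))). rewrite (step_px _ _ _ (H (S k))) in Hpx. exact Hpx.
      + exact E.
      + transitivity (py (st (S (S k)))).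
        * symmetry. apply (step_py _ _ _ (H (S k))).
        * rewrite E', (step_px _ _ _ (H (S k))). reflexivity. }
  apply (no_floor_accumulation (fun k => st (N + k)%nat) (fun k => ls (N + k)%nat) A A).
  - intros k. rewrite Nat.add_succ_r. apply H.
  - intros k. apply Floor. lia.
  - intros k. rewrite Nat.add_succ_r. apply Hl. lia.
  - intros k. generalize (proj1 (Rabs_le_between _ _) (Hfl (N + k)%nat)); intros.
    nra.
  - intros eps He. destruct (Hl0 eps He) as [n Hn]. exists n. apply Hn. lia.
Qed.

(** * How flights begin and end *)

(** A line tangent to the convex floor stays outside the horn. *)
Lemma arrives_at_floor (z : state) (l : R) : flight z l ->
  0 < px (move z l) < a -> py (move z l) = lo P (px (move z l)) ->
  vx z ^ 2 + vy z ^ 2 = 1 ->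
  vy z - lo1 P (px (move z l)) * vx z < 0.
Proof.
  intros (Hl & Hf) Hx E Hv.
  destruct (Hf (l / 2)) as [Hx' [Hlo _]]; [lra|].
  set (x := px (move z l)) in *.
  assert (Ex : px (move z (l / 2)) = x - l / 2 * vx z)
    by (unfold x, move; simpl; field).
  assert (Ey : py (move z (l / 2)) = lo P x - l / 2 * vy z)
    by (rewrite <- E; unfold move; simpl; field).
  rewrite Ey, Ex in *.
  destruct (Req_dec (vx z) 0) as [V|V].
  - rewrite V in *. rewrite Rmult_0_r, Rminus_0_r in Hlo. nra.
  - assert (l / 2 * vx z <> 0) by (apply Rmult_integral_contrapositive; lra).
    assert (T := lo_above_tangent x (x - l / 2 * vx z) Hx Hx' ltac:(lra)). nra.
Qed.

Lemma slopes_le1 (x : R) : 0 < x < a -> 0 <= lo1 P x <= 1 /\ 0 <= hi1 P x <= 1.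
Proof.
  intros Hx. assert (L1 := lo1_range P _ Hx). assert (H1 := hi1_range P _ Hx).
  assert (HK := curv_bnd_ge1 P). assert (Hs := reach_small P). assert (Hc := curv_gap_pos P).
  assert (0 < c * x) by nra. assert (K * x <= 1 / 100) by nra. lra.
Qed.

Lemma walls_lipschitz (x u s : R) : 0 < x < a -> 0 < x + s * u < a ->
  0 <= s -> -1 <= u <= 1 ->
  lo P x - s <= lo P (x + s * u) <= lo P x + s /\
  hi P x - s <= hi P (x + s * u) <= hi P x + s.
Proof.
  intros Hx Hx' Hs Hu.
  destruct (Req_dec (s * u) 0) as [E|E].
  { rewrite E, Rplus_0_r. lra. }
  assert (D : - s <= s * u <= s) by nra.
  assert (S := slopes_le1 _ Hx). assert (S' := slopes_le1 _ Hx').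
  assert (T1 := lo_above_tangent x (x + s * u) Hx Hx' ltac:(lra)).
  assert (T2 := lo_above_tangent (x + s * u) x Hx' Hx ltac:(lra)).
  assert (T3 := hi_above_tangent x (x + s * u) Hx Hx' ltac:(lra)).
  assert (T4 := hi_above_tangent (x + s * u) x Hx' Hx ltac:(lra)).
  assert (Sl : forall p, 0 <= p <= 1 -> - s <= p * (s * u) <= s) by (intros; nra).
  assert (A1 := Sl _ (proj1 S)). assert (A2 := Sl _ (proj2 S)).
  assert (A3 := Sl _ (proj1 S')). assert (A4 := Sl _ (proj2 S')).
  lra.
Qed.

Lemma reach_open (x : R) : 0 < x < a -> exists eta, 0 < eta /\
  forall s u, 0 <= s < eta -> -1 <= u <= 1 -> 0 < x + s * u < a.
Proof.
  intros Hx. exists (Rmin x (a - x)). split; [apply Rmin_case; lra|].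
  intros s u Hs Hu. assert (Rmin x (a - x) <= x) by apply Rmin_l.
  assert (Rmin x (a - x) <= a - x) by apply Rmin_r. nra.
Qed.

Lemma inside_open (z : state) : inside z -> vx z ^ 2 + vy z ^ 2 = 1 ->
  exists eta, 0 < eta /\ forall s, 0 <= s < eta -> inside (move z s).
Proof.
  intros [Hx Hy] Hv. destruct (unit_components _ _ Hv) as [Hu Hw].
  destruct (reach_open _ Hx) as (eta & He & Hr).
  set (g := Rmin (py z - lo P (px z)) (hi P (px z) - py z) / 2).
  assert (Hg : 0 < g /\ 2 * g <= py z - lo P (px z) /\ 2 * g <= hi P (px z) - py z).
  { unfold g. unfold Rmin. destruct (Rle_dec _ _); lra. }
  exists (Rmin eta g). split; [apply Rmin_case; lra|].
  intros s Hs. assert (Rmin eta g <= eta) by apply Rmin_l.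
  assert (Rmin eta g <= g) by apply Rmin_r.
  assert (Hx' := Hr s (vx z) ltac:(lra) Hu).
  assert (W := walls_lipschitz (px z) (vx z) s Hx Hx' ltac:(lra) Hu).
  split; [exact Hx'|simpl]. nra.
Qed.

Lemma flight_ends_in_closure (z : state) (l : R) : flight z l ->
  0 < px (move z l) < a -> vx z ^ 2 + vy z ^ 2 = 1 ->
  lo P (px (move z l)) <= py (move z l) <= hi P (px (move z l)).
Proof.
  intros (Hl & Hf) Hx Hv. destruct (unit_components _ _ Hv) as [Hu Hw].
  assert (B : forall t, 0 < t < l ->
     lo P (px (move z l)) - 2 * t <= py (move z l) <= hi P (px (move z l)) + 2 * t).
  { intros t Ht. destruct (Hf (l - t)) as [Hx' Hy]; [lra|].
    assert (Ex : px (move z (l - t)) = px (move z l) + t * - vx z) by (simpl; ring).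
    assert (Ey : py (move z (l - t)) = py (move z l) - t * vy z) by (simpl; ring).
    rewrite Ey, Ex in *.
    assert (W := walls_lipschitz (px (move z l)) (- vx z) t Hx Hx' ltac:(lra) ltac:(lra)).
    nra. }
  set (lx := lo P (px (move z l))) in *. set (hx := hi P (px (move z l))) in *.
  set (y := py (move z l)) in *.
  split; apply Rnot_lt_le; intros N.
  - specialize (B (Rmin (l / 2) ((lx - y) / 4))).
    assert (Rmin (l / 2) ((lx - y) / 4) <= (lx - y) / 4) by apply Rmin_r.
    assert (Rmin (l / 2) ((lx - y) / 4) <= l / 2) by apply Rmin_l.
    assert (0 < Rmin (l / 2) ((lx - y) / 4)) by (apply Rmin_case; lra).
    specialize (B ltac:(lra)). lra.
  - specialize (B (Rmin (l / 2) ((y - hx) / 4))).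
    assert (Rmin (l / 2) ((y - hx) / 4) <= (y - hx) / 4) by apply Rmin_r.
    assert (Rmin (l / 2) ((y - hx) / 4) <= l / 2) by apply Rmin_l.
    assert (0 < Rmin (l / 2) ((y - hx) / 4)) by (apply Rmin_case; lra).
    specialize (B ltac:(lra)). lra.
Qed.

(** After the reflection the velocity points away from the floor; away from the
    ceiling it may be tangent, where strict convexity keeps the flight below. *)
Lemma departs (z z' : state) (l : R) : flight z l ->
  0 < px (move z l) < a -> vx z ^ 2 + vy z ^ 2 = 1 ->
  lower_bounce (move z l) z' \/ upper_bounce (move z l) z' ->
  exists l', flight z' l'.
Proof.
  intros F Hx Hv B.
  assert (Hv' : vx z' ^ 2 + vy z' ^ 2 = 1).
  { destruct B as [[_ ->]|[_ ->]]; now apply reflect_slope_unit. }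
  assert (Ex : px z' = px (move z l)) by (destruct B as [[_ ->]|[_ ->]]; reflexivity).
  assert (Ey : py z' = py (move z l)) by (destruct B as [[_ ->]|[_ ->]]; reflexivity).
  destruct (unit_components _ _ Hv') as [Hu Hw].
  assert (G := gap_pos _ Hx).
  destruct (reach_open _ Hx) as (eta & He & Hr).
  set (g := (hi P (px (move z l)) - lo P (px (move z l))) / 4).
  assert (Hg : 0 < g /\ 4 * g = hi P (px (move z l)) - lo P (px (move z l)))
    by (unfold g; lra).
  clearbody g.
  destruct B as [[E B]|[E B]].
  - assert (Q := arrives_at_floor z l F Hx E Hv).
    assert (Q' : 0 < vy z' - lo1 P (px z') * vx z').
    { rewrite Ex, B, reflect_slope_normal. simpl in *. lra. }
    rewrite <- Ex in *. rewrite <- Ey in E.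
    set (q := vy z' - lo1 P (px z') * vx z') in *.
    assert (HK := curv_bnd_ge1 P).
    set (l' := Rmin (Rmin eta g) (q / (2 * K))).
    assert (0 < q / (2 * K)) by (apply Rdiv_lt_0_compat; lra).
    assert (L0 : 0 < l') by (unfold l'; repeat apply Rmin_case; lra).
    assert (L1 : l' <= Rmin eta g) by apply Rmin_l.
    assert (L2 : l' <= q / (2 * K)) by apply Rmin_r.
    assert (Rmin eta g <= eta) by apply Rmin_l.
    assert (Rmin eta g <= g) by apply Rmin_r.
    exists l'. split; [exact L0|]. intros s Hs.
    assert (Hx' := Hr s (vx z') ltac:(lra) Hu).
    assert (W := walls_lipschitz (px z') (vx z') s Hx Hx' ltac:(lra) Hu).
    split; [exact Hx'|]. change (px (move z' s)) with (px z' + s * vx z').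
    change (py (move z' s)) with (py z' + s * vy z'). rewrite E.
    split; [|nra].
    destruct (Req_dec (s * vx z') 0) as [V|V].
    { assert (V0 : vx z' = 0) by (apply Rmult_integral in V; lra).
      unfold q in Q'. rewrite V0, Rmult_0_r, Rminus_0_r in Q'.
      rewrite V, Rplus_0_r. assert (0 < s * vy z') by (apply Rmult_lt_0_compat; lra).
      lra. }
    assert (T := lo_above_tangent (px z' + s * vx z') (px z') Hx' Hx ltac:(lra)).
    destruct (mean_value (lo1 P) (lo2 P) (px z') (px z' + s * vx z')) as (t & Ht & Et).
    { intros t Ht. apply lo1_d. revert Ht. unfold Rmin, Rmax.
      destruct (Rle_dec (px z') (px z' + s * vx z')); lra. }
    assert (Ht' : 0 < t < a).
    { revert Ht. unfold Rmin, Rmax. destruct (Rle_dec (px z') (px z' + s * vx z')); lra. }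
    assert (L := lo2_range P t Ht'). assert (Hc := curv_gap_pos P).
    replace (px z' + s * vx z' - px z') with (s * vx z') in Et by ring.
    assert (lo1 P (px z' + s * vx z') * (s * vx z') <=
            lo1 P (px z') * (s * vx z') + K * (s * vx z') ^ 2).
    { assert (lo2 P t * (s * vx z') ^ 2 <= K * (s * vx z') ^ 2)
        by (apply Rmult_le_compat_r; [apply pow2_ge_0|lra]). nra. }
    assert (vx z' ^ 2 <= 1) by nra.
    assert ((s * vx z') ^ 2 <= s ^ 2) by (rewrite Rpow_mult_distr; nra).
    assert (K * (s * vx z') ^ 2 <= K * s ^ 2) by (apply Rmult_le_compat_l; lra).
    assert (K * s < q).
    { assert (K * s <= K * (q / (2 * K))) by (apply Rmult_le_compat_l; lra).
      replace (K * (q / (2 * K))) with (q / 2) in * by (field; lra). lra. }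
    assert (s * (K * s) < s * q) by (apply Rmult_lt_compat_l; lra).
    unfold q in *. nra.
  - assert (Q := reaches_ceiling z l F Hx E).
    assert (Q' : vy z' - hi1 P (px z') * vx z' <= 0).
    { rewrite Ex, B, reflect_slope_normal. simpl in *. lra. }
    rewrite <- Ex in *. rewrite <- Ey in E.
    assert (L0 : 0 < Rmin eta g) by (apply Rmin_case; lra).
    assert (Rmin eta g <= eta) by apply Rmin_l.
    assert (Rmin eta g <= g) by apply Rmin_r.
    exists (Rmin eta g). split; [exact L0|]. intros s Hs.
    assert (Hx' := Hr s (vx z') ltac:(lra) Hu).
    assert (W := walls_lipschitz (px z') (vx z') s Hx Hx' ltac:(lra) Hu).
    split; [exact Hx'|]. change (px (move z' s)) with (px z' + s * vx z').
    change (py (move z' s)) with (py z' + s * vy z'). rewrite E.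
    split; [nra|].
    destruct (Req_dec (vx z') 0) as [V|V].
    + rewrite V, Rmult_0_r, Rplus_0_r. rewrite V in Q', Hv'.
      assert (vy z' < 0) by nra. nra.
    + assert (s * vx z' <> 0) by (apply Rmult_integral_contrapositive; lra).
      assert (T := hi_above_tangent (px z') (px z' + s * vx z') Hx Hx' ltac:(lra)).
      nra.
Qed.

(** Seen back from the tip, the height is affine and positive in the time [t], while
    the ceiling allows only [O(t ^ 2)]. *)
Lemma no_flight_ends_at_tip (z : state) (l : R) : flight z l ->
  px (move z l) = 0 -> False.
Proof.
  intros (Hl & Hf) E. assert (HK := curv_bnd_ge1 P).
  set (f := fun t => py (move z l) - t * vy z).
  assert (Hb : forall t, 0 < t < l -> 0 < f t < K * vx z ^ 2 * t ^ 2).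
  { intros t Ht. destruct (Hf (l - t)) as [Hx Hy]; [lra|].
    assert (Ex : px (move z (l - t)) = - t * vx z).
    { transitivity (px (move z l) - t * vx z); [simpl; ring|rewrite E; ring]. }
    assert (Ey : py (move z (l - t)) = f t) by (unfold f; simpl; ring).
    rewrite Ey, Ex in *. assert (L := lo_range P _ Hx). assert (H := hi_range P _ Hx).
    split; [lra|]. replace (K * vx z ^ 2 * t ^ 2) with (K * (- t * vx z) ^ 2) by ring.
    lra. }
  set (t0 := l / 2). set (C := K * vx z ^ 2) in *.
  assert (HC : 0 <= C) by (apply Rmult_le_pos; [lra|apply pow2_ge_0]).
  assert (B0 := Hb t0 ltac:(unfold t0; lra)).
  assert (Aff : forall m, f (m * t0) = m * f t0 + (1 - m) * f 0)
    by (intros m; unfold f; ring).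
  assert (Hin : forall m, 0 < m <= 1 -> 0 < m * t0 < l) by (unfold t0; intros; nra).
  assert (F0 : 0 <= f 0).
  { apply Rnot_lt_le. intros N.
    set (m := - f 0 / (2 * (f t0 - f 0))).
    assert (Hm : 0 < m <= 1).
    { split; [apply Rdiv_lt_0_compat; lra|].
      apply (Rmult_le_reg_r (2 * (f t0 - f 0))); [lra|].
      unfold m. field_simplify; lra. }
    assert (B := proj1 (Hb _ (Hin m Hm))). rewrite Aff in B.
    replace (m * f t0 + (1 - m) * f 0) with (f 0 / 2) in B
      by (unfold m; field; lra). lra. }
  set (m := Rmin 1 (f t0 / (2 * (C * t0 ^ 2 + 1)))).
  assert (HC2 : 0 <= C * t0 ^ 2) by (apply Rmult_le_pos; [lra|apply pow2_ge_0]).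
  assert (0 < f t0 / (2 * (C * t0 ^ 2 + 1))) by (apply Rdiv_lt_0_compat; lra).
  assert (Hm : 0 < m <= 1) by (split; [apply Rmin_case; lra|apply Rmin_l]).
  assert (Hm2 : m <= f t0 / (2 * (C * t0 ^ 2 + 1))) by apply Rmin_r.
  assert (B := proj2 (Hb _ (Hin m Hm))). rewrite Aff in B.
  assert ((C * t0 ^ 2 + 1) * m <= f t0 / 2).
  { replace (f t0 / 2) with ((C * t0 ^ 2 + 1) * (f t0 / (2 * (C * t0 ^ 2 + 1))))
      by (field; lra). apply Rmult_le_compat_l; lra. }
  assert (m * f t0 < m * ((C * t0 ^ 2) * m)) by nra.
  assert (f t0 < C * t0 ^ 2 * m) by (apply (Rmult_lt_reg_l m); lra).
  lra.
Qed.

End Billiard.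

(** * Charts of the horn near its tip *)

Definition along (e p : R * R) : R := dot e p.
(** The normal coordinate; [s] is [1] or [-1] and chooses the side to which the
    arcs bend as the positive one. *)
Definition across (s : R) (e p : R * R) : R := s * (fst e * snd p - snd e * fst p).

Lemma along_minus (e p q : R * R) :
  along e (minus p q) = fst e * (fst p - fst q) + snd e * (snd p - snd q).
Proof. reflexivity. Qed.

Lemma across_minus (s : R) (e p q : R * R) :
  across s e (minus p q) = s * (fst e * (snd p - snd q) - snd e * (fst p - fst q)).
Proof. reflexivity. Qed.

Lemma fst_plus (p q : R * R) : fst (plus p q) = fst p + fst q.
Proof. reflexivity. Qed.

Lemma snd_plus (p q : R * R) : snd (plus p q) = snd p + snd q.
Proof. reflexivity. Qed.

Lemma fst_scal (l : R) (p : R * R) : fst (scal l p) = l * fst p.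
Proof. reflexivity. Qed.

Lemma snd_scal (l : R) (p : R * R) : snd (scal l p) = l * snd p.
Proof. reflexivity. Qed.

Lemma dot_scal (l : R) (p q : R * R) : dot (scal l p) q = l * dot p q.
Proof. unfold dot. rewrite fst_scal, snd_scal. ring. Qed.

Lemma scal_inverse (c : R) (p q : R * R) : 0 < c -> q = scal c p -> p = scal (/ c) q.
Proof.
  intros Hc ->. apply injective_projections; rewrite ?fst_scal, ?snd_scal; field; lra.
Qed.

Lemma along_between (e tip p q : R * R) (lam : R) :
  along e (minus (plus (scal (1 - lam) p) (scal lam q)) tip) =
  (1 - lam) * along e (minus p tip) + lam * along e (minus q tip).
Proof.
  rewrite !along_minus, fst_plus, snd_plus, !fst_scal, !snd_scal. ring.
Qed.

Lemma across_between (s : R) (e tip p q : R * R) (lam : R) :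
  across s e (minus (plus (scal (1 - lam) p) (scal lam q)) tip) =
  (1 - lam) * across s e (minus p tip) + lam * across s e (minus q tip).
Proof.
  rewrite !across_minus, fst_plus, snd_plus, !fst_scal, !snd_scal. ring.
Qed.

Definition frame_x (tip e p : R * R) : R := along e (minus p tip).
Definition frame_y (tip e : R * R) (s : R) (p : R * R) : R := across s e (minus p tip).

Definition frame_state (tip e : R * R) (s : R) (p v : R * R) : state :=
  mk_state (frame_x tip e p) (frame_y tip e s p) (along e v) (across s e v).

(** Near the tip, the tables between the graphs of a profile and between two arcs
    agree, with the same walls and collisions.  The conditions are symmetric in the two
    arcs, so that either of them can be the floor. *)
Record horn_chart (gp gm : arc) (tip : R * R) := mk_horn_chart {
  ch_e : R * R;
  ch_s : R;
  ch_P : profile;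
  ch_rad : R;
  ch_e_unit : dot ch_e ch_e = 1;
  ch_s_unit : ch_s ^ 2 = 1;
  ch_rad_pos : 0 < ch_rad <= reach ch_P;
  ch_horn : forall p, let x := frame_x tip ch_e p in
    let y := frame_y tip ch_e ch_s p in
    Rabs x < ch_rad -> Rabs y < ch_rad ->
    (horn gp gm p <->
     (x = 0 /\ y = 0) \/ (0 < x /\ lo ch_P x <= y <= hi ch_P x));
  ch_on_arc : forall p, let x := frame_x tip ch_e p in
    let y := frame_y tip ch_e ch_s p in
    Rabs x < ch_rad -> Rabs y < ch_rad ->
    (on_arc gp p \/ on_arc gm p <->
     (x = 0 /\ y = 0) \/ (0 < x /\ (y = lo ch_P x \/ y = hi ch_P x)));
  ch_bounce : forall p v p' v',
    let z := frame_state tip ch_e ch_s p' v in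
    let z' := frame_state tip ch_e ch_s p' v' in
    Rabs (px z) < ch_rad -> Rabs (py z) < ch_rad ->
    bounce gp p v p' v' \/ bounce gm p v p' v' ->
    0 < px z /\ (lower_bounce ch_P z z' \/ upper_bounce ch_P z z');
  ch_can_bounce : forall p v p', let x := frame_x tip ch_e p' in
    let y := frame_y tip ch_e ch_s p' in
    Rabs x < ch_rad -> Rabs y < ch_rad -> 0 < x ->
    y = lo ch_P x \/ y = hi ch_P x ->
    exists v', bounce gp p v p' v' \/ bounce gm p v p' v'
}.

Arguments ch_e {gp gm tip} _.
Arguments ch_s {gp gm tip} _.
Arguments ch_P {gp gm tip} _.
Arguments ch_rad {gp gm tip} _.

Section Chart.
Context (gp gm : arc) (tip : R * R) (C : horn_chart gp gm tip).
Local Notation P := (ch_P C).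
Local Notation rad := (ch_rad C).

Definition chart_state (p v : R * R) : state := frame_state tip (ch_e C) (ch_s C) p v.

Definition in_box (r : R) (z : state) : Prop := Rabs (px z) < r /\ Rabs (py z) < r.

(** Half the size of the chart, so that the end point of a flight in this
    box is still in the chart. *)
Definition chart_box (p : R * R) : Prop := in_box (rad / 2) (chart_state p (0, 0)).

Lemma chart_state_fly (p v : R * R) (s : R) :
  chart_state (fly p v s) v = move (chart_state p v) s.
Proof.
  unfold chart_state, frame_state, move, frame_x, frame_y; simpl.
  rewrite !along_minus, !across_minus. unfold fly.
  rewrite fst_plus, snd_plus, fst_scal, snd_scal. unfold along, across, dot.
  f_equal; ring.
Qed.

Lemma chart_state_speed (p v : R * R) : enorm v = 1 ->
  vx (chart_state p v) ^ 2 + vy (chart_state p v) ^ 2 = 1.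
Proof.
  intros H. assert (E := ch_e_unit _ _ _ C). assert (S := ch_s_unit _ _ _ C).
  assert (V : dot v v = 1).
  { unfold enorm in H. rewrite <- (sqrt_sqrt (dot v v)).
    - rewrite H. ring.
    - unfold dot. nra. }
  unfold chart_state, frame_state, along, across; simpl. unfold dot in *.
  transitivity ((fst (ch_e C) * fst (ch_e C) + snd (ch_e C) * snd (ch_e C))
                * (fst v * fst v + snd v * snd v)
                + (ch_s C ^ 2 - 1) *
                  (fst (ch_e C) * snd v - snd (ch_e C) * fst v) ^ 2); [ring|].
  rewrite E, V, S. ring.
Qed.

Lemma chart_box_locally : locally tip chart_box.
Proof.
  assert (Hr := ch_rad_pos _ _ _ C).
  assert (E := ch_e_unit _ _ _ C). assert (S := ch_s_unit _ _ _ C).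
  assert (H4 : 0 < rad / 4) by lra.
  exists (mkposreal _ H4). intros p Hp.
  destruct Hp as [H1 H2]. simpl in H1, H2.
  assert (B1 : Rabs (fst p - fst tip) < rad / 4) by exact H1.
  assert (B2 : Rabs (snd p - snd tip) < rad / 4) by exact H2.
  clear H1 H2. unfold dot in E.
  apply Rabs_lt_between in B1. apply Rabs_lt_between in B2.
  assert (D : forall a b x y : R, -1 <= a <= 1 -> -1 <= b <= 1 ->
    - (rad / 4) < x < rad / 4 -> - (rad / 4) < y < rad / 4 ->
    Rabs (a * x + b * y) < rad / 2).
  { intros a b x y Ha Hb Hx Hy.
    apply Rabs_lt_between in Hx. apply Rabs_lt_between in Hy.
    apply Rabs_le_between in Ha. apply Rabs_le_between in Hb.
    eapply Rle_lt_trans; [apply Rabs_triang|]. rewrite !Rabs_mult.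
    generalize (Rabs_pos a) (Rabs_pos b) (Rabs_pos x) (Rabs_pos y). nra. }
  assert (-1 <= fst (ch_e C) <= 1) by nra.
  assert (-1 <= snd (ch_e C) <= 1) by nra.
  assert (-1 <= ch_s C <= 1) by nra.
  split.
  - apply (D _ _ _ _ H H0 B1 B2).
  - change (Rabs (ch_s C * (fst (ch_e C) * (snd p - snd tip)
      - snd (ch_e C) * (fst p - fst tip))) < rad / 2).
    replace (ch_s C * (fst (ch_e C) * (snd p - snd tip)
      - snd (ch_e C) * (fst p - fst tip))) with
      ((- (ch_s C * snd (ch_e C))) * (fst p - fst tip)
       + (ch_s C * fst (ch_e C)) * (snd p - snd tip)) by ring.
    apply D; try assumption; split; nra.
Qed.

Lemma chart_horn (p v : R * R) : in_box rad (chart_state p v) ->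
  (horn gp gm p <->
   (px (chart_state p v) = 0 /\ py (chart_state p v) = 0) \/
   (0 < px (chart_state p v) /\
    lo P (px (chart_state p v)) <= py (chart_state p v)
    <= hi P (px (chart_state p v)))).
Proof. intros [H1 H2]. apply (ch_horn _ _ _ C p H1 H2). Qed.

Lemma chart_on_arc (p v : R * R) : in_box rad (chart_state p v) ->
  (on_arc gp p \/ on_arc gm p <->
   (px (chart_state p v) = 0 /\ py (chart_state p v) = 0) \/
   (0 < px (chart_state p v) /\
    (py (chart_state p v) = lo P (px (chart_state p v)) \/
     py (chart_state p v) = hi P (px (chart_state p v))))).
Proof. intros [H1 H2]. apply (ch_on_arc _ _ _ C p H1 H2). Qed.

Lemma chart_horn_inside (p v : R * R) : in_box rad (chart_state p v) ->
  (horn_inside gp gm p <-> inside P (chart_state p v)).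
Proof.
  intros B. assert (H := chart_horn p v B). assert (A := chart_on_arc p v B).
  assert (Hr := ch_rad_pos _ _ _ C).
  destruct B as [B1 _]. apply Rabs_lt_between in B1.
  unfold horn_inside, inside. split.
  - intros (Hh & N1 & N2). apply H in Hh.
    assert (N : ~ (on_arc gp p \/ on_arc gm p)) by tauto.
    rewrite A in N. destruct Hh as [Hh|[Hx Hy]]; [tauto|].
    split; [lra|]. split.
    + destruct (proj1 Hy) as [|E]; [assumption|exfalso; apply N; right; auto].
    + destruct (proj2 Hy) as [|E]; [assumption|exfalso; apply N; right; auto].
  - intros [Hx Hy]. assert (N : ~ (on_arc gp p \/ on_arc gm p)).
    { rewrite A. intros [N|[_ [N|N]]]; lra. }
    split; [|tauto]. apply H. right. lra.
Qed.

Lemma in_box_move_end (z : state) (l : R) : 0 < l ->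
  (forall s, 0 < s < l -> in_box (rad / 2) (move z s)) ->
  in_box rad (move z l).
Proof.
  intros Hl H. assert (Hr := ch_rad_pos _ _ _ C).
  assert (D : forall x u, (forall s, 0 < s < l -> Rabs (x + s * u) < rad / 2) ->
            Rabs (x + l * u) < rad).
  { intros x u Hx.
    assert (x + l * u <= rad / 2).
    { apply affine_limit; [exact Hl|]. intros s Hs.
      assert (B := Hx s Hs). apply Rabs_def2 in B. lra. }
    assert (- x + l * - u <= rad / 2).
    { apply affine_limit; [exact Hl|]. intros s Hs.
      assert (B := Hx s Hs). apply Rabs_def2 in B. lra. }
    apply Rabs_def1; lra. }
  split; apply D; intros s Hs; apply (H s Hs).
Qed.

Lemma in_box_open (z : state) : in_box rad z -> exists eta, 0 < eta /\
  forall s, 0 <= s < eta -> in_box rad (move z s).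
Proof.
  intros [B1 B2].
  assert (D : forall x u, Rabs x < rad -> exists eta, 0 < eta /\
     forall s, 0 <= s < eta -> Rabs (x + s * u) < rad).
  { intros x u Hx. exists ((rad - Rabs x) / (Rabs u + 1)).
    assert (Hu : 0 <= Rabs u) by apply Rabs_pos.
    split; [apply Rdiv_lt_0_compat; lra|].
    intros s Hs. eapply Rle_lt_trans; [apply Rabs_triang|].
    rewrite Rabs_mult, (Rabs_pos_eq s) by lra.
    assert ((Rabs u + 1) * s < rad - Rabs x); [|nra].
    replace (rad - Rabs x) with ((Rabs u + 1) * ((rad - Rabs x) / (Rabs u + 1)))
      by (field; lra).
    apply Rmult_lt_compat_l; lra. }
  destruct (D _ (vx z) B1) as (e1 & He1 & H1).
  destruct (D _ (vy z) B2) as (e2 & He2 & H2).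
  exists (Rmin e1 e2). split; [apply Rmin_case; lra|].
  intros s Hs. assert (Rmin e1 e2 <= e1) by apply Rmin_l.
  assert (Rmin e1 e2 <= e2) by apply Rmin_r.
  split; [apply H1|apply H2]; lra.
Qed.

(** * Trajectories that stay in the chart *)

Context (tr : trajectory gp gm).
Hypothesis stays : forall k p, visits_after tr k p -> chart_box p.

Local Notation st k := (chart_state (tr_pos tr k) (tr_vel tr k)).

Lemma box_fly (p v : R * R) (s : R) :
  chart_box (fly p v s) <-> in_box (rad / 2) (move (chart_state p v) s).
Proof. rewrite <- chart_state_fly. reflexivity. Qed.

Lemma half_box (z : state) : in_box (rad / 2) z -> in_box rad z.
Proof.
  assert (Hr := ch_rad_pos _ _ _ C). intros [H1 H2]. split; lra.
Qed.

Lemma stays_on_flight (k : nat) (l s : R) : at_least (tr_ncoll tr) k ->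
  free_flight gp gm (tr_pos tr k) (tr_vel tr k) l -> 0 < s < l ->
  in_box (rad / 2) (move (st k) s).
Proof.
  intros Hk Hf Hs. apply box_fly. apply (stays k). split; [exact Hk|].
  exists s. split; [lra|]. split; [reflexivity|]. split.
  - intros t Ht. apply Hf. lra.
  - apply (Hf s Hs).
Qed.

Lemma chart_flight (k : nat) (l : R) : at_least (tr_ncoll tr) k ->
  0 < l -> free_flight gp gm (tr_pos tr k) (tr_vel tr k) l ->
  flight P (st k) l.
Proof.
  intros Hk Hl Hf. split; [exact Hl|]. intros s Hs.
  assert (B := half_box _ (stays_on_flight k l s Hk Hf Hs)).
  rewrite <- chart_state_fly in *. apply chart_horn_inside; [exact B|]. apply (Hf s Hs).
Qed.

Lemma at_least_S (N : option nat) (k : nat) :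
  at_least N (S k) -> more_than N k /\ at_least N k.
Proof. destruct N; simpl; [lia|tauto]. Qed.

Lemma chart_step (k : nat) : at_least (tr_ncoll tr) (S k) ->
  exists l, flight P (st k) l /\ in_box rad (move (st k) l) /\
    0 < px (move (st k) l) < reach P /\
    (lower_bounce P (move (st k) l) (st (S k)) \/
     upper_bounce P (move (st k) l) (st (S k))).
Proof.
  intros HS. destruct (at_least_S _ _ HS) as [Hm Hk].
  destruct (tr_step gp gm tr k Hm) as (l & Hl & Hf & Ep & Hb).
  exists l. split; [now apply chart_flight|].
  assert (B : in_box rad (move (st k) l)).
  { apply in_box_move_end; [exact Hl|]. intros s Hs. now apply (stays_on_flight k l). }
  split; [exact B|].
  assert (Em : move (st k) l = chart_state (tr_pos tr (S k)) (tr_vel tr k)).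
  { rewrite Ep. symmetry. apply chart_state_fly. }
  rewrite Em in *. destruct B as [B1 B2].
  destruct (ch_bounce _ _ _ C _ _ _ _ B1 B2 Hb) as [Hx Hbb].
  apply Rabs_lt_between in B1. split; [split; [exact Hx|]|exact Hbb].
  apply (Rlt_le_trans _ rad); [apply B1|apply (ch_rad_pos _ _ _ C)].
Qed.

Lemma chart_speed (k : nat) : at_least (tr_ncoll tr) k ->
  vx (st k) ^ 2 + vy (st k) ^ 2 = 1.
Proof.
  induction k as [|k IH]; intros Hk.
  - apply chart_state_speed, tr_unit.
  - specialize (IH (proj2 (at_least_S _ _ Hk))).
    destruct (chart_step k Hk) as (l & _ & _ & _ & [[_ ->]|[_ ->]]);
      now apply reflect_slope_unit.
Qed.

Lemma chart_admissible (k : nat) : at_least (tr_ncoll tr) (S k) ->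
  admissible P (st (S k)).
Proof.
  intros Hk. assert (V := chart_speed _ Hk).
  destruct (chart_step k Hk) as (l & _ & _ & Hx & Hb). assert (G := gap_pos _ _ Hx).
  assert (Ex : px (st (S k)) = px (move (st k) l)) by (destruct Hb as [[_ ->]|[_ ->]]; reflexivity).
  assert (Ey : py (st (S k)) = py (move (st k) l)) by (destruct Hb as [[_ ->]|[_ ->]]; reflexivity).
  split; [|split; [|exact V]]; rewrite Ex; [exact Hx|].
  rewrite Ey. destruct Hb as [[E _]|[E _]]; rewrite E; lra.
Qed.

Lemma not_infinitely_many_collisions : tr_ncoll tr <> None.
Proof.
  intros EN.
  assert (Hk : forall k, at_least (tr_ncoll tr) k) by (intros k; now rewrite EN).
  assert (Hs : forall k, exists l, step P (st (S k)) l (st (S (S k)))).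
  { intros k. destruct (chart_step (S k) (Hk _)) as (l & F & _ & _ & Hb).
    exists l. split; [apply chart_admissible, Hk|].
    split; [exact F|]. split; [apply chart_admissible, Hk|exact Hb]. }
  apply (no_infinite_trajectory P (fun k => st (S k))
    (fun k => proj1_sig (constructive_indefinite_description _ (Hs k)))).
  intros k. apply proj2_sig.
Qed.

(** After the reflection the velocity points away from the floor; away from the
    ceiling it may be tangent, where strict convexity keeps the flight below. *)
Lemma departs_after (k : nat) : at_least (tr_ncoll tr) k ->
  exists l, 0 < l /\ free_flight gp gm (tr_pos tr k) (tr_vel tr k) l.
Proof.
  intros Hk. destruct k as [|k]; [apply tr_starts|].
  destruct (chart_step k Hk) as (l & F & B & Hx & Hb).
  destruct (departs P _ _ _ F Hx (chart_speed k (proj2 (at_least_S _ _ Hk))) Hb)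
    as (l' & Hl' & F').
  assert (B' : in_box rad (st (S k))) by (destruct Hb as [[_ ->]|[_ ->]]; exact B).
  destruct (in_box_open _ B') as (eta & He & Hb').
  exists (Rmin l' eta). split; [apply Rmin_case; lra|].
  intros s Hs. assert (Rmin l' eta <= l') by apply Rmin_l.
  assert (Rmin l' eta <= eta) by apply Rmin_r.
  apply (chart_horn_inside _ (tr_vel tr (S k))); rewrite chart_state_fly.
  - apply Hb'. lra.
  - apply F'. lra.
Qed.

(** The supremum [L] of the durations of free flights after the last collision is
    attained.  The end of this flight is neither the tip, nor a point of an arc, by
    maximality of the trajectory, nor an inner point, where the flight continues. *)
Lemma not_finitely_many_collisions (n : nat) : tr_ncoll tr <> Some n.
Proof.
  intros EN. assert (Hn : at_least (tr_ncoll tr) n) by (rewrite EN; simpl; lia).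
  assert (Hr := ch_rad_pos _ _ _ C).
  assert (V := chart_speed n Hn).
  destruct (departs_after n Hn) as (l0 & Hl0 & F0).
  set (E := fun l => 0 < l /\ free_flight gp gm (tr_pos tr n) (tr_vel tr n) l).
  assert (Hbd : forall l, E l -> l <= 4 * rad).
  { intros l [Hl Hf]. apply Rnot_lt_le. intros N.
    assert (B1 := stays_on_flight n l (l / 8) Hn Hf ltac:(lra)).
    assert (B2 := stays_on_flight n l (7 * l / 8) Hn Hf ltac:(lra)).
    destruct B1 as [X1 Y1]. destruct B2 as [X2 Y2]. simpl in X1, X2, Y1, Y2.
    apply Rabs_def2 in X1. apply Rabs_def2 in X2.
    apply Rabs_def2 in Y1. apply Rabs_def2 in Y2.
    assert (Dx : (3 * l / 4 * vx (st n)) ^ 2 <= rad ^ 2)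
      by (apply pow_maj_Rabs, Rabs_le; simpl; lra).
    assert (Dy : (3 * l / 4 * vy (st n)) ^ 2 <= rad ^ 2)
      by (apply pow_maj_Rabs, Rabs_le; simpl; lra).
    assert (D : (3 * l / 4 * vx (st n)) ^ 2 + (3 * l / 4 * vy (st n)) ^ 2
      = (3 * l / 4) ^ 2 * (vx (st n) ^ 2 + vy (st n) ^ 2)) by ring.
    rewrite V in D. nra. }
  destruct (completeness E) as [L [HL1 HL2]].
  { exists (4 * rad). intros l Hl. apply (Hbd l Hl). }
  { exists l0. now split. }
  assert (L0 : l0 <= L) by (apply HL1; now split).
  assert (FL : free_flight gp gm (tr_pos tr n) (tr_vel tr n) L).
  { intros s Hs. destruct (classic (exists l, E l /\ s < l)) as [(l & [Hl Hf] & Hsl)|N].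
    - apply Hf. lra.
    - exfalso. enough (L <= s) by lra. apply HL2. intros l Hl.
      apply Rnot_lt_le. intros Hsl. apply N. now exists l. }
  assert (CF := chart_flight n L Hn ltac:(lra) FL).
  assert (B : in_box rad (move (st n) L)).
  { apply in_box_move_end; [lra|]. intros s Hs. now apply (stays_on_flight n L). }
  assert (X0 : 0 <= px (move (st n) L)).
  { assert (- px (st n) + L * - vx (st n) <= 0).
    { apply affine_limit; [lra|]. intros s Hs. destruct CF as [_ CF].
      destruct (CF s Hs) as [Hx _]. simpl in Hx. simpl. lra. }
    simpl in *. lra. }
  destruct X0 as [X0|X0].
  2:{ apply (no_flight_ends_at_tip P _ _ CF). now symmetry. }
  assert (X1 : 0 < px (move (st n) L) < reach P).
  { split; [exact X0|]. destruct B as [B _]. apply Rabs_def2 in B. lra. }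
  assert (Y := flight_ends_in_closure P _ _ CF X1 V).
  destruct (classic (py (move (st n) L) = lo P (px (move (st n) L)) \/
                     py (move (st n) L) = hi P (px (move (st n) L)))) as [W|W].
  - destruct B as [B1 B2]. rewrite <- chart_state_fly in *.
    destruct (ch_can_bounce _ _ _ C (tr_pos tr n) (tr_vel tr n) _ B1 B2 X0 W)
      as [v' Hv'].
    apply (tr_maximal gp gm tr n EN).
    exists (fly (tr_pos tr n) (tr_vel tr n) L), v'.
    exists L. split; [lra|]. split; [exact FL|]. split; [reflexivity|exact Hv'].
  - assert (I : inside P (move (st n) L)).
    { split; [exact X1|].
      destruct Y as [[Y1|Y1] [Y2|Y2]]; try tauto; symmetry in Y1; tauto. }
    destruct (inside_open P _ I V) as (e1 & He1 & H1).
    destruct (in_box_open _ B) as (e2 & He2 & H2).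
    set (e := Rmin e1 e2). assert (He : 0 < e) by (unfold e; apply Rmin_case; lra).
    assert (e <= e1) by apply Rmin_l. assert (e <= e2) by apply Rmin_r.
    enough (L + e <= L) by lra. apply HL1. split; [lra|].
    intros s Hs. destruct (Rlt_le_dec s L) as [Hs'|Hs']; [apply FL; lra|].
    assert (Em : move (move (st n) L) (s - L) = move (st n) s)
      by (unfold move; simpl; f_equal; ring).
    apply (chart_horn_inside _ (tr_vel tr n)); rewrite chart_state_fly, <- Em.
    + apply H2. lra.
    + apply H1. lra.
Qed.

End Chart.

Lemma leaves_of_chart (gp gm : arc) (tip : R * R) (C : horn_chart gp gm tip) :
  exists U : R * R -> Prop,
    locally tip U /\
    forall tr : trajectory gp gm,
      U (tr_pos tr 0%nat) ->
      leaves_after_finitely_many_collisions tr U.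
Proof.
  exists (chart_box gp gm tip C). split; [apply chart_box_locally|].
  intros tr _. apply NNPP. intros N.
  assert (stays : forall k p, visits_after tr k p -> chart_box gp gm tip C p).
  { intros k p Hv. apply NNPP. intros Hp. apply N. now exists k, p. }
  destruct (tr_ncoll tr) as [n|] eqn:E.
  - apply (not_finitely_many_collisions gp gm tip C tr stays n E).
  - apply (not_infinitely_many_collisions gp gm tip C tr stays E).
Qed.

(** * Regular curves are graphs near their starting point *)

Definition segment (b t : R) : Prop := 0 <= t <= b.

(** Composition with the projection of the line to the segment turns continuity
    relative to the segment into continuity on the line. *)
Definition clamp (b u : R) : R := Rmax 0 (Rmin b u).

Lemma clamp_segment (b u : R) : 0 < b -> segment b (clamp b u).
Proof.
  intros Hb. unfold segment, clamp. split; [apply Rmax_l|].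
  apply Rmax_lub; [lra|apply Rmin_l].
Qed.

Lemma clamp_id (b u : R) : segment b u -> clamp b u = u.
Proof.
  intros Hu. unfold segment in Hu. unfold clamp.
  rewrite Rmin_right, Rmax_right; lra.
Qed.

Lemma clamp_contracts (b u v : R) : Rabs (clamp b u - clamp b v) <= Rabs (u - v).
Proof.
  unfold clamp, Rmax, Rmin.
  destruct (Rle_dec b u); destruct (Rle_dec b v); repeat destruct (Rle_dec _ _);
    unfold Rabs; repeat destruct (Rcase_abs _); lra.
Qed.

Lemma clamp_continuity (b : R) (f : R -> R) : 0 < b ->
  (forall t, segment b t -> continue_in f (segment b) t) ->
  continuity (fun u => f (clamp b u)).
Proof.
  intros Hb H u eps He.
  destruct (H _ (clamp_segment b u Hb) eps He) as (alp & Ha & Hf).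
  exists alp. split; [exact Ha|]. intros v [_ Hv]. simpl in *. unfold Rdist in *.
  destruct (Req_dec (clamp b u) (clamp b v)) as [E|E].
  - rewrite E, Rminus_diag, Rabs_R0. exact He.
  - apply Hf. split; [split; [now apply clamp_segment|exact E]|].
    eapply Rle_lt_trans; [apply clamp_contracts|exact Hv].
Qed.

Lemma D_in_interior (b : R) (f df : R -> R) (t : R) : 0 < t < b ->
  D_in f df (segment b) t -> is_derive f t (df t).
Proof.
  intros Ht H. apply is_derive_Reals. intros eps He.
  destruct (H eps He) as (alp & Ha & Hf).
  assert (Hd : 0 < Rmin alp (Rmin t (b - t))) by (repeat apply Rmin_case; lra).
  exists (mkposreal _ Hd). intros h Hh Hl. simpl in Hl.
  assert (Rmin alp (Rmin t (b - t)) <= alp) by apply Rmin_l.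
  assert (Rmin alp (Rmin t (b - t)) <= Rmin t (b - t)) by apply Rmin_r.
  assert (Rmin t (b - t) <= t) by apply Rmin_l.
  assert (Rmin t (b - t) <= b - t) by apply Rmin_r.
  assert (Hl' : Rabs h < Rmin t (b - t)) by lra. apply Rabs_def2 in Hl'.
  specialize (Hf (t + h)). simpl in Hf. unfold Rdist in Hf.
  replace (t + h - t) with h in Hf by ring. apply Hf.
  split; [split; [unfold segment; lra|lra]|lra].
Qed.

(** One-sided derivatives at the ends of the segment suffice for continuity there, and
    the mean value theorem uses derivatives at inner points only. *)
Lemma D_in_mean_value (b : R) (f df : R -> R) (s t : R) : 0 < b ->
  (forall u, segment b u -> D_in f df (segment b) u) ->
  0 <= s <= t -> t <= b ->
  exists c, s <= c <= t /\ f t - f s = df c * (t - s).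
Proof.
  intros Hb H Hs Ht.
  destruct (MVT_gen (fun u => f (clamp b u)) s t df) as (c & Hc & E).
  - intros u Hu. rewrite Rmin_left, Rmax_right in Hu by lra.
    apply (is_derive_ext_loc f).
    + assert (Hd : 0 < Rmin u (b - u)) by (apply Rmin_case; lra).
      exists (mkposreal _ Hd). intros v Hv. symmetry. f_equal. apply clamp_id.
      assert (Hv' : Rabs (v - u) < Rmin u (b - u)) by exact Hv.
      assert (Rmin u (b - u) <= u) by apply Rmin_l.
      assert (Rmin u (b - u) <= b - u) by apply Rmin_r.
      apply Rabs_def2 in Hv'. unfold segment. lra.
    + apply (D_in_interior b); [lra|]. apply H. unfold segment. lra.
  - intros u _. apply clamp_continuity; [exact Hb|].
    intros v Hv. apply (cont_deriv _ df). now apply H.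
  - rewrite Rmin_left, Rmax_right in Hc by lra. exists c. split; [exact Hc|].
    rewrite !clamp_id in E by (unfold segment; lra). exact E.
Qed.

Definition near0 (b : R) (Q : R -> Prop) : Prop :=
  exists del, 0 < del /\ forall t, segment b t -> t <= del -> Q t.

Lemma near0_and (b : R) (Q Q' : R -> Prop) :
  near0 b Q -> near0 b Q' -> near0 b (fun t => Q t /\ Q' t).
Proof.
  intros (d & Hd & H) (d' & Hd' & H'). exists (Rmin d d').
  split; [apply Rmin_case; lra|]. intros t Ht Hl.
  assert (Rmin d d' <= d) by apply Rmin_l.
  assert (Rmin d d' <= d') by apply Rmin_r.
  split; [apply H|apply H']; try assumption; lra.
Qed.

Lemma near0_close (b : R) (f : R -> R) (eps : R) : 0 < eps ->
  continue_in f (segment b) 0 -> near0 b (fun t => Rabs (f t - f 0) < eps).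
Proof.
  intros He H. destruct (H eps He) as (alp & Ha & Hf).
  exists (alp / 2). split; [lra|]. intros t Ht Hl. simpl in Hf. unfold Rdist in Hf.
  destruct (Req_dec 0 t) as [<-|N].
  - rewrite Rminus_diag, Rabs_R0. exact He.
  - apply Hf. split; [split; [exact Ht|exact N]|].
    unfold segment in Ht. rewrite Rminus_0_r, Rabs_pos_eq; lra.
Qed.

(** An arc in the coordinates of a chart, with one-sided derivatives on the closed
    segment. *)
Record curve := mk_curve {
  cv_end : R;
  cX : R -> R; cX1 : R -> R; cX2 : R -> R; cX3 : R -> R;
  cY : R -> R; cY1 : R -> R; cY2 : R -> R; cY3 : R -> R;
  cv_end_pos : 0 < cv_end;
  cX_d : forall t, segment cv_end t -> D_in cX cX1 (segment cv_end) t;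
  cX1_d : forall t, segment cv_end t -> D_in cX1 cX2 (segment cv_end) t;
  cX2_d : forall t, segment cv_end t -> D_in cX2 cX3 (segment cv_end) t;
  cY_d : forall t, segment cv_end t -> D_in cY cY1 (segment cv_end) t;
  cY1_d : forall t, segment cv_end t -> D_in cY1 cY2 (segment cv_end) t;
  cY2_d : forall t, segment cv_end t -> D_in cY2 cY3 (segment cv_end) t;
  cX3_c : continue_in cX3 (segment cv_end) 0;
  cY3_c : continue_in cY3 (segment cv_end) 0;
  cX_0 : cX 0 = 0;
  cY_0 : cY 0 = 0;
  cX1_0 : 0 < cX1 0;
  cY1_0 : cY1 0 = 0;
  cv_simple : forall t, segment cv_end t -> cX t = 0 -> cY t = 0 -> t = 0
}.

(** The part of the curve with parameter below [g_par] is the graph of [g_f] over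
    [(0, g_reach)].  The rest of the curve is at a positive distance from the origin
    ([g_away]), and lies to the right of the graph as long as the curve moves to
    the right ([g_beyond]).  The second derivative of the
    graph is within [eta] of its value at the origin. *)
Record graph (G : curve) (eta : R) := mk_graph {
  g_par : R; g_reach : R; g_sep : R; g_bnd : R;
  g_f : R -> R; g_f1 : R -> R; g_f2 : R -> R; g_f3 : R -> R;
  g_par_range : 0 < g_par <= cv_end G;
  g_reach_pos : 0 < g_reach;
  g_sep_pos : 0 < g_sep;
  g_bnd_pos : 0 < g_bnd;
  g_forward : forall t, 0 <= t <= g_par -> 0 < cX1 G t;
  g_on_graph : forall t, 0 < t < g_par ->
    0 < cX G t < g_reach /\ cY G t = g_f (cX G t) /\
    cY1 G t = g_f1 (cX G t) * cX1 G t;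
  g_beyond : forall t, g_par <= t <= cv_end G ->
    (forall u, 0 <= u <= t -> 0 < cX1 G u) -> g_reach <= cX G t;
  g_away : forall t, g_par <= t <= cv_end G ->
    g_sep <= Rabs (cX G t) \/ g_sep <= Rabs (cY G t);
  g_onto : forall x, 0 < x < g_reach -> exists t, 0 < t < g_par /\ cX G t = x;
  g_f_d : forall x, 0 < x < g_reach -> is_derive g_f x (g_f1 x);
  g_f1_d : forall x, 0 < x < g_reach -> is_derive g_f1 x (g_f2 x);
  g_f2_d : forall x, 0 < x < g_reach -> is_derive g_f2 x (g_f3 x);
  g_f2_close : forall x, 0 < x < g_reach ->
    Rabs (g_f2 x - cY2 G 0 / cX1 G 0 ^ 2) < eta;
  g_f3_bound : forall x, 0 < x < g_reach -> Rabs (g_f3 x) <= g_bnd;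
  g_f1_bound : forall x, 0 < x < g_reach -> Rabs (g_f1 x) <= g_bnd * x;
  g_f_bound : forall x, 0 < x < g_reach -> Rabs (g_f x) <= g_bnd * x
}.

Arguments g_par {G eta} _.
Arguments g_reach {G eta} _.
Arguments g_sep {G eta} _.
Arguments g_bnd {G eta} _.
Arguments g_f {G eta} _ _.
Arguments g_f1 {G eta} _ _.
Arguments g_f2 {G eta} _ _.
Arguments g_f3 {G eta} _ _.

Section CurveGraph.
Context (G : curve).
Local Notation b := (cv_end G).
Local Notation X := (cX G).
Local Notation X1 := (cX1 G).
Local Notation X2 := (cX2 G).
Local Notation X3 := (cX3 G).
Local Notation Y := (cY G).
Local Notation Y1 := (cY1 G).
Local Notation Y2 := (cY2 G).
Local Notation Y3 := (cY3 G).

(** The second derivative of [Y] as a function of [X]. *)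
Definition second_slope (t : R) : R := (Y2 t * X1 t - Y1 t * X2 t) * / (X1 t * X1 t * X1 t).

(** The third derivative of [Y] as a function of [X]. *)
Definition third_slope (t : R) : R :=
  ((Y3 t * X1 t - Y1 t * X3 t) * X1 t - 3 * ((Y2 t * X1 t - Y1 t * X2 t) * X2 t))
  * / (X1 t * X1 t * X1 t * X1 t * X1 t).

Lemma segment_0 : segment b 0.
Proof. generalize (cv_end_pos G). unfold segment. lra. Qed.

Lemma second_slope_continuous : continue_in second_slope (segment b) 0.
Proof.
  assert (H0 := cX1_0 G).
  assert (C1 := cont_deriv _ _ _ _ (cX1_d G 0 segment_0)).
  assert (C2 := cont_deriv _ _ _ _ (cX2_d G 0 segment_0)).
  assert (C3 := cont_deriv _ _ _ _ (cY1_d G 0 segment_0)).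
  assert (C4 := cont_deriv _ _ _ _ (cY2_d G 0 segment_0)).
  unfold continue_in, second_slope in *.
  apply limit_mul; [apply limit_minus; apply limit_mul; assumption|].
  apply limit_inv; [repeat apply limit_mul; assumption|].
  repeat apply Rmult_integral_contrapositive_currified; lra.
Qed.

Lemma third_slope_continuous : continue_in third_slope (segment b) 0.
Proof.
  assert (H0 := cX1_0 G).
  assert (C1 := cont_deriv _ _ _ _ (cX1_d G 0 segment_0)).
  assert (C2 := cont_deriv _ _ _ _ (cX2_d G 0 segment_0)).
  assert (C3 := cont_deriv _ _ _ _ (cY1_d G 0 segment_0)).
  assert (C4 := cont_deriv _ _ _ _ (cY2_d G 0 segment_0)).
  assert (C5 := cX3_c G). assert (C6 := cY3_c G).
  unfold continue_in, third_slope in *.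
  apply limit_mul.
  - apply limit_minus.
    + apply limit_mul; [apply limit_minus; apply limit_mul; assumption|assumption].
    + apply limit_mul; [apply (limit_free (fun _ => 3) _ 0)|].
      apply limit_mul; [apply limit_minus; apply limit_mul; assumption|assumption].
  - apply limit_inv; [repeat apply limit_mul; assumption|].
    repeat apply Rmult_integral_contrapositive_currified; lra.
Qed.

(** By compactness, as the curve is simple. *)
Lemma away_from_start (t0 : R) : 0 < t0 <= b ->
  exists rho, 0 < rho /\ forall t, t0 <= t <= b ->
    rho <= Rabs (X t) \/ rho <= Rabs (Y t).
Proof.
  intros Ht0.
  assert (CX := clamp_continuity b X (cv_end_pos G)
    (fun t Ht => cont_deriv _ _ _ _ (cX_d G t Ht))).
  assert (CY := clamp_continuity b Y (cv_end_pos G)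
    (fun t Ht => cont_deriv _ _ _ _ (cY_d G t Ht))).
  destruct (continuity_ab_min
    (fun u => Rabs (X (clamp b u)) + Rabs (Y (clamp b u))) t0 b) as (m & Hm & Hmr).
  - lra.
  - intros u _.
    apply (continuity_pt_plus (fun u => Rabs (X (clamp b u)))
             (fun u => Rabs (Y (clamp b u)))).
    + apply (continuity_pt_comp (fun u => X (clamp b u)) Rabs); [apply CX|].
      apply Rcontinuity_abs.
    + apply (continuity_pt_comp (fun u => Y (clamp b u)) Rabs); [apply CY|].
      apply Rcontinuity_abs.
  - rewrite (clamp_id b m) in Hm by (unfold segment; lra).
    exists ((Rabs (X m) + Rabs (Y m)) / 2). split.
    + destruct (Req_dec (X m) 0) as [E|E].
      * destruct (Req_dec (Y m) 0) as [E'|E'].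
        -- assert (m = 0) by (apply (cv_simple G); try assumption; unfold segment; lra).
           lra.
        -- generalize (Rabs_pos_lt _ E') (Rabs_pos (X m)). lra.
      * generalize (Rabs_pos_lt _ E) (Rabs_pos (Y m)). lra.
    + intros t Ht. specialize (Hm t Ht).
      rewrite (clamp_id b t) in Hm by (unfold segment; lra).
      destruct (Rle_or_lt ((Rabs (X m) + Rabs (Y m)) / 2) (Rabs (X t))); [now left|right].
      lra.
Qed.

(** The bound [m <= X1] makes [tau] Lipschitz, so that the difference quotients of
    [X] and [tau] at corresponding points are inverse to each other. *)
Lemma inverse_derive (t0 m : R) (tau : R -> R) (x : R) : 0 < m -> t0 <= b ->
  (forall t, 0 <= t <= t0 -> m <= X1 t) ->
  (forall y, 0 < y < X t0 -> 0 < tau y < t0 /\ X (tau y) = y) ->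
  0 < x < X t0 -> is_derive tau x (/ X1 (tau x)).
Proof.
  intros Hm Ht0 Hm1 Htau Hx.
  destruct (Htau x Hx) as [Ht Et]. set (t := tau x) in *.
  assert (D := D_in_interior b X X1 t ltac:(lra)
    (cX_d G t ltac:(unfold segment; lra))).
  apply is_derive_Reals in D. apply is_derive_Reals. intros eps He.
  assert (Hinc : forall u, 0 <= u <= t0 -> m * Rabs (u - t) <= Rabs (X u - X t)).
  { assert (Hlt : forall u v, 0 <= u <= v -> v <= t0 -> m * (v - u) <= X v - X u).
    { intros u v Hu Hv.
      destruct (D_in_mean_value b X X1 u v (cv_end_pos G) (cX_d G) Hu ltac:(lra))
        as (c & Hc & ->).
      apply Rmult_le_compat_r; [lra|]. apply Hm1. lra. }
    intros u Hu. destruct (Rle_or_lt u t).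
    - assert (B := Hlt u t ltac:(lra) ltac:(lra)).
      rewrite Rabs_minus_sym, (Rabs_minus_sym (X u)), !Rabs_pos_eq; nra.
    - assert (B := Hlt t u ltac:(lra) ltac:(lra)).
      rewrite !Rabs_pos_eq; nra. }
  assert (Hmt := Hm1 t ltac:(lra)).
  destruct (D (eps * (m * m) / 2)) as [d Hd].
  { assert (0 < m * m) by nra. assert (0 < eps * (m * m)) by nra. lra. }
  assert (Hdel : 0 < Rmin (m * d) (Rmin x (X t0 - x))).
  { assert (0 < d) by apply cond_pos. assert (0 < m * d) by nra.
    repeat apply Rmin_case; lra. }
  exists (mkposreal _ Hdel). intros h Hh Hl. simpl in Hl.
  assert (Rmin (m * d) (Rmin x (X t0 - x)) <= m * d) by apply Rmin_l.
  assert (Rmin (m * d) (Rmin x (X t0 - x)) <= Rmin x (X t0 - x)) by apply Rmin_r.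
  assert (Rmin x (X t0 - x) <= x) by apply Rmin_l.
  assert (Rmin x (X t0 - x) <= X t0 - x) by apply Rmin_r.
  assert (Hl' : Rabs h < Rmin x (X t0 - x)) by lra. apply Rabs_def2 in Hl'.
  destruct (Htau (x + h) ltac:(lra)) as [Hs Es].
  set (s := tau (x + h)) in *.
  assert (Hst := Hinc s ltac:(lra)). rewrite Es, Et in Hst.
  replace (x + h - x) with h in Hst by ring.
  assert (Nst : s - t <> 0).
  { intros E. assert (s = t) by lra. rewrite H3 in Es. lra. }
  assert (Hsd : Rabs (s - t) < d) by (apply (Rmult_lt_reg_l m); lra).
  specialize (Hd (s - t) Nst Hsd).
  replace (t + (s - t)) with s in Hd by ring. rewrite Es, Et in Hd.
  replace (x + h - x) with h in Hd by ring.
  set (q := h / (s - t)) in *.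
  assert (Hq : m <= q).
  { destruct (D_in_mean_value b X X1 (Rmin s t) (Rmax s t) (cv_end_pos G) (cX_d G))
      as (c & Hc & Ec).
    - split; [apply Rmin_case; lra|apply Rmin_Rmax].
    - apply Rmax_lub; lra.
    - assert (Hcm : m <= X1 c).
      { apply Hm1. split; [|eapply Rle_trans; [apply Hc|apply Rmax_lub; lra]].
        eapply Rle_trans; [|apply Hc]. apply Rmin_case; lra. }
      replace q with (X1 c); [exact Hcm|].
      unfold q. apply (Rmult_eq_reg_r (s - t)); [|lra].
      transitivity h; [|field; lra]. clear Hc.
      revert Ec. unfold Rmin, Rmax. destruct (Rle_dec s t); rewrite Es, Et; lra. }
  change (tau x) with t.
  replace ((s - t) / h) with (/ q) by (unfold q; field; lra).
  replace (/ q - / X1 t) with ((X1 t - q) * / (q * X1 t)) by (field; lra).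
  rewrite Rabs_mult, Rabs_minus_sym.
  assert (Hqm : m * m <= q * X1 t) by (apply Rmult_le_compat; lra).
  assert (Hmm : 0 < m * m) by nra.
  rewrite (Rabs_pos_eq (/ (q * X1 t))) by (apply Rlt_le, Rinv_0_lt_compat; lra).
  apply (Rmult_lt_reg_r (q * X1 t)); [lra|].
  rewrite Rmult_assoc, Rinv_l, Rmult_1_r by lra.
  assert (eps * (m * m) <= eps * (q * X1 t)) by (apply Rmult_le_compat_l; lra).
  assert (0 < eps * (m * m)) by nra. lra.
Qed.

(** The graph is written with the inverse [tau] of the abscissa; continuity of all
    derivatives at the parameter [0] gives uniform bounds on a short initial
    part. *)
Lemma curve_graph (eta : R) : 0 < eta -> inhabited (graph G eta).
Proof.
  intros Heta. assert (Hb := cv_end_pos G). assert (H0 := cX1_0 G).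
  set (m := X1 0 / 2).
  assert (N : near0 b (fun t =>
    (Rabs (X1 t - X1 0) < m /\ Rabs (second_slope t - second_slope 0) < eta) /\
    (Rabs (third_slope t - third_slope 0) < 1 /\
     (Rabs (Y1 t - Y1 0) < 1 /\ Rabs (Y2 t - Y2 0) < 1)))).
  { repeat apply near0_and; apply near0_close; unfold m; try lra.
    - apply (cont_deriv _ _ _ _ (cX1_d G 0 segment_0)).
    - apply second_slope_continuous.
    - apply third_slope_continuous.
    - apply (cont_deriv _ _ _ _ (cY1_d G 0 segment_0)).
    - apply (cont_deriv _ _ _ _ (cY2_d G 0 segment_0)). }
  destruct N as (del & Hdel & N).
  set (t0 := Rmin b del).
  assert (Ht0 : 0 < t0 <= b) by (unfold t0; split; [apply Rmin_case; lra|apply Rmin_l]).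
  assert (Ht0d : t0 <= del) by apply Rmin_r.
  assert (N' := fun t (Ht : 0 <= t <= t0) =>
    N t ltac:(unfold segment; lra) ltac:(lra)).
  clear N. clearbody t0.
  assert (Hm : 0 < m) by (unfold m; lra).
  assert (M1 : forall t, 0 <= t <= t0 -> m <= X1 t).
  { intros t Ht. destruct (N' t Ht) as [[A _] _]. apply Rabs_def2 in A.
    unfold m in *. lra. }
  assert (Hlt : forall u v, 0 <= u <= v -> v <= t0 -> m * (v - u) <= X v - X u).
  { intros u v Hu Hv.
    destruct (D_in_mean_value b X X1 u v (cv_end_pos G) (cX_d G) Hu ltac:(lra))
      as (c & Hc & ->).
    apply Rmult_le_compat_r; [lra|]. apply M1. lra. }
  assert (Hinv : forall x, exists t, 0 < x < X t0 -> 0 < t < t0 /\ X t = x).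
  { intros x. destruct (classic (0 < x < X t0)) as [Hx|Hx]; [|exists 0; tauto].
    assert (CX := clamp_continuity b X Hb
      (fun t Ht => cont_deriv _ _ _ _ (cX_d G t Ht))).
    destruct (IVT_gen (fun u => X (clamp b u)) 0 t0 x CX) as (t & Ht & Et).
    - rewrite !clamp_id by (unfold segment; lra). rewrite cX_0.
      rewrite Rmin_left, Rmax_right; lra.
    - rewrite Rmin_left, Rmax_right in Ht by lra.
      rewrite clamp_id in Et by (unfold segment; lra).
      exists t. intros _. split; [|exact Et]. split.
      + destruct (proj1 Ht) as [|E]; [assumption|]. rewrite <- E, cX_0 in Et. lra.
      + destruct (proj2 Ht) as [|E]; [assumption|]. rewrite E in Et. lra. }
  set (tau := fun x => proj1_sig (constructive_indefinite_description _ (Hinv x))).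
  assert (Htau : forall x, 0 < x < X t0 -> 0 < tau x < t0 /\ X (tau x) = x)
    by (intros x; exact (proj2_sig (constructive_indefinite_description _ (Hinv x)))).
  clearbody tau.
  assert (Dtau : forall x, 0 < x < X t0 -> is_derive tau x (/ X1 (tau x))).
  { intros x Hx. apply (inverse_derive t0 m); try assumption; lra. }
  assert (Htx : forall t, 0 < t < t0 -> 0 < X t < X t0).
  { intros t Ht. assert (A := Hlt 0 t ltac:(lra) ltac:(lra)).
    assert (B := Hlt t t0 ltac:(lra) ltac:(lra)). rewrite cX_0 in A. nra. }
  assert (Htau' : forall t, 0 < t < t0 -> tau (X t) = t).
  { intros t Ht. destruct (Htau _ (Htx t Ht)) as [Hs Es].
    destruct (Rtotal_order (tau (X t)) t) as [L|[L|L]]; [|exact L|].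
    - assert (A := Hlt (tau (X t)) t ltac:(lra) ltac:(lra)). nra.
    - assert (A := Hlt t (tau (X t)) ltac:(lra) ltac:(lra)). nra. }
  assert (Dint : forall f df, (forall t, segment b t -> D_in f df (segment b) t) ->
    forall t, 0 < t < t0 -> is_derive f t (df t)).
  { intros f df H t Ht. apply (D_in_interior b); [lra|].
    apply H. unfold segment. lra. }
  destruct (away_from_start t0 Ht0) as (rho & Hrho & Haway).
  (* One constant for the bounds on [g_f3], [g_f1] and [g_f], in this order. *)
  set (B := (Rabs (third_slope 0) + 1) + (Rabs (Y2 0) + 1) / (m * m) + 1 / m).
  assert (Hmm : 0 < m * m) by nra.
  assert (B1 : 0 <= Rabs (third_slope 0)) by apply Rabs_pos.
  assert (B2 : 0 < (Rabs (Y2 0) + 1) / (m * m)).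
  { apply Rdiv_lt_0_compat; [generalize (Rabs_pos (Y2 0)); lra|lra]. }
  assert (B3 : 0 < 1 / m) by (apply Rdiv_lt_0_compat; lra).
  assert (Hxt : forall x, 0 < x < X t0 -> m * tau x <= x).
  { intros x Hx. destruct (Htau x Hx) as [Ht Et].
    assert (A := Hlt 0 (tau x) ltac:(lra) ltac:(lra)). rewrite cX_0 in A. lra. }
  constructor.
  refine (mk_graph G eta t0 (X t0) rho B (fun x => Y (tau x))
    (fun x => Y1 (tau x) / X1 (tau x)) (fun x => second_slope (tau x))
    (fun x => third_slope (tau x)) _ _ _ _ _ _ _ _ _ _ _ _ _ _ _ _).
  - exact Ht0.
  - assert (A := Hlt 0 t0 ltac:(lra) ltac:(lra)). rewrite cX_0 in A. nra.
  - exact Hrho.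
  - unfold B. lra.
  - intros t Ht. specialize (M1 t Ht). lra.
  - intros t Ht. split; [now apply Htx|]. rewrite (Htau' t Ht). split; [reflexivity|].
    specialize (M1 t ltac:(lra)). field. lra.
  - intros t Ht Hpos.
    destruct (D_in_mean_value b X X1 t0 t Hb (cX_d G) ltac:(lra) ltac:(lra))
      as (c & Hc & E).
    specialize (Hpos c ltac:(lra)). nra.
  - exact Haway.
  - intros x Hx. exists (tau x). now apply Htau.
  - intros x Hx. destruct (Htau x Hx) as [Ht Et].
    replace (Y1 (tau x) / X1 (tau x)) with (scal (/ X1 (tau x)) (Y1 (tau x)))
      by (unfold scal; simpl; unfold mult; simpl; unfold Rdiv; ring).
    apply (is_derive_comp Y tau).
    + apply (Dint Y Y1 (cY_d G)), Ht.
    + now apply Dtau.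
  - intros x Hx. destruct (Htau x Hx) as [Ht Et].
    assert (M := M1 (tau x) ltac:(lra)).
    assert (E1 := Dint _ _ (cX1_d G) _ Ht). assert (E2 := Dint _ _ (cY1_d G) _ Ht).
    replace (second_slope (tau x)) with
      (scal (/ X1 (tau x))
        ((Y2 (tau x) * X1 (tau x) - Y1 (tau x) * X2 (tau x)) / X1 (tau x) ^ 2)).
    2:{ unfold scal; simpl; unfold mult; simpl. unfold second_slope. field. lra. }
    apply (is_derive_comp (fun t => Y1 t / X1 t) tau); [|now apply Dtau].
    auto_derive.
    + repeat split; try (eexists; eassumption). lra.
    + rewrite (Derive_at Y1 _ _ E2), (Derive_at X1 _ _ E1). field. lra.
  - intros x Hx. destruct (Htau x Hx) as [Ht Et].
    assert (M := M1 (tau x) ltac:(lra)).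
    assert (E1 := Dint _ _ (cX1_d G) _ Ht). assert (E2 := Dint _ _ (cY1_d G) _ Ht).
    assert (E3 := Dint _ _ (cX2_d G) _ Ht). assert (E4 := Dint _ _ (cY2_d G) _ Ht).
    replace (third_slope (tau x)) with
      (scal (/ X1 (tau x)) (third_slope (tau x) * X1 (tau x))).
    2:{ unfold scal; simpl; unfold mult; simpl. field. lra. }
    apply (is_derive_comp second_slope tau); [|now apply Dtau].
    unfold second_slope, third_slope. auto_derive.
    + repeat split; try (eexists; eassumption).
      repeat apply Rmult_integral_contrapositive_currified; lra.
    + rewrite (Derive_at Y1 _ _ E2), (Derive_at X1 _ _ E1),
        (Derive_at Y2 _ _ E4), (Derive_at X2 _ _ E3). field. lra.
  - intros x Hx. destruct (Htau x Hx) as [Ht Et].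
    destruct (N' (tau x) ltac:(lra)) as [[_ A] _].
    replace (Y2 0 / X1 0 ^ 2) with (second_slope 0); [exact A|].
    unfold second_slope. rewrite cY1_0. field. lra.
  - intros x Hx. destruct (Htau x Hx) as [Ht Et].
    destruct (N' (tau x) ltac:(lra)) as [_ [A _]].
    assert (Rabs (third_slope (tau x)) <= Rabs (third_slope 0) + 1).
    { replace (third_slope (tau x)) with
        (third_slope 0 + (third_slope (tau x) - third_slope 0)) by ring.
      eapply Rle_trans; [apply Rabs_triang|lra]. }
    unfold B. lra.
  - intros x Hx. destruct (Htau x Hx) as [Ht Et].
    destruct (D_in_mean_value b Y1 Y2 0 (tau x) Hb (cY1_d G) ltac:(lra) ltac:(lra))
      as (c & Hc & E).
    rewrite cY1_0, !Rminus_0_r in E.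
    destruct (N' c ltac:(lra)) as [_ [_ [_ A]]].
    assert (A' : Rabs (Y2 c) <= Rabs (Y2 0) + 1).
    { replace (Y2 c) with (Y2 0 + (Y2 c - Y2 0)) by ring.
      eapply Rle_trans; [apply Rabs_triang|lra]. }
    assert (M := M1 (tau x) ltac:(lra)). specialize (Hxt x Hx).
    apply (Rle_trans _ ((Rabs (Y2 0) + 1) / (m * m) * x)).
    2:{ apply Rmult_le_compat_r; [lra|]. unfold B. lra. }
    unfold Rdiv. rewrite E, !Rabs_mult, (Rabs_pos_eq (tau x)) by lra.
    rewrite (Rabs_pos_eq (/ X1 (tau x))) by (apply Rlt_le, Rinv_0_lt_compat; lra).
    replace ((Rabs (Y2 0) + 1) * / (m * m) * x) with
      ((Rabs (Y2 0) + 1) * (x / m) * / m) by (field; lra).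
    assert (tau x <= x / m).
    { apply (Rmult_le_reg_l m); [lra|]. replace (m * (x / m)) with x by (field; lra).
      exact Hxt. }
    apply Rmult_le_compat.
    + apply Rmult_le_pos; [apply Rabs_pos|lra].
    + apply Rlt_le, Rinv_0_lt_compat; lra.
    + apply Rmult_le_compat; try lra. apply Rabs_pos.
    + apply Rinv_le_contravar; lra.
  - intros x Hx. destruct (Htau x Hx) as [Ht Et].
    destruct (D_in_mean_value b Y Y1 0 (tau x) Hb (cY_d G) ltac:(lra) ltac:(lra))
      as (c & Hc & E).
    rewrite cY_0, !Rminus_0_r in E.
    destruct (N' c ltac:(lra)) as [_ [_ [A _]]]. rewrite cY1_0, Rminus_0_r in A.
    specialize (Hxt x Hx).
    apply (Rle_trans _ (1 / m * x)).
    2:{ apply Rmult_le_compat_r; [lra|]. unfold B. lra. }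
    rewrite E, Rabs_mult, (Rabs_pos_eq (tau x)) by lra.
    assert (tau x <= x / m).
    { apply (Rmult_le_reg_l m); [lra|]. replace (m * (x / m)) with x by (field; lra).
      exact Hxt. }
    replace (1 / m * x) with (1 * (x / m)) by (field; lra).
    apply Rmult_le_compat; try lra. apply Rabs_pos.
Qed.

End CurveGraph.

(** * Second-order estimates for graphs *)

(** The curvature at the origin, where the tangent is the axis. *)
Definition graph_curvature (G : curve) : R := cY2 G 0 / cX1 G 0 ^ 2.

(** Integration of the bounds on the second derivative, from the origin where
    the function and its derivative vanish. *)
Lemma graph_bounds (G : curve) (eta : R) (F : graph G eta) (x : R) :
  0 < x < g_reach F ->
  (graph_curvature G - eta) * x <= g_f1 F x <= (graph_curvature G + eta) * x /\
  (graph_curvature G - eta) / 2 * x ^ 2 <= g_f F x <=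
    (graph_curvature G + eta) / 2 * x ^ 2.
Proof.
  intros Hx. set (a := g_reach F) in *.
  assert (HB := g_bnd_pos _ _ F). set (B := g_bnd F) in *.
  assert (K2 := g_f2_close _ _ F : forall t, 0 < t < a ->
    Rabs (g_f2 F t - graph_curvature G) < eta).
  set (k := graph_curvature G) in *.
  assert (L1 : forall t, 0 < t < a -> (k - eta) * t <= g_f1 F t <= (k + eta) * t).
  { intros t Ht. split.
    - enough (0 <= g_f1 F t - (k - eta) * t) by lra.
      apply (nonneg_from_zero (fun t => g_f1 F t - (k - eta) * t)
        (fun t => g_f2 F t - (k - eta)) a (B + Rabs (k - eta))); [| | |exact Ht].
      + intros s Hs. apply is_derive_Rminus; [now apply g_f1_d|].
        auto_derive; [exact I|ring].
      + intros s Hs. specialize (K2 s Hs). apply Rabs_def2 in K2. lra.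
      + intros s Hs. assert (A := g_f1_bound _ _ F s Hs). fold B in A.
        eapply Rle_trans; [apply Rabs_triang|].
        rewrite Rabs_Ropp, Rabs_mult, (Rabs_pos_eq s) by lra. lra.
    - enough (0 <= (k + eta) * t - g_f1 F t) by lra.
      apply (nonneg_from_zero (fun t => (k + eta) * t - g_f1 F t)
        (fun t => (k + eta) - g_f2 F t) a (B + Rabs (k + eta))); [| | |exact Ht].
      + intros s Hs. apply is_derive_Rminus; [|now apply g_f1_d].
        auto_derive; [exact I|ring].
      + intros s Hs. specialize (K2 s Hs). apply Rabs_def2 in K2. lra.
      + intros s Hs. assert (A := g_f1_bound _ _ F s Hs). fold B in A.
        eapply Rle_trans; [apply Rabs_triang|].
        rewrite Rabs_Ropp, Rabs_mult, (Rabs_pos_eq s) by lra. lra. }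
  assert (Sq : forall c s, 0 < s < a -> Rabs (c / 2 * s ^ 2) <= Rabs c * a * s).
  { intros c s Hs. unfold Rdiv. rewrite !Rabs_mult, (Rabs_pos_eq (s ^ 2)) by nra.
    rewrite (Rabs_pos_eq (/ 2)) by lra.
    assert (0 <= Rabs c) by apply Rabs_pos.
    assert (0 <= Rabs c * s) by nra.
    assert (Rabs c * s * s <= Rabs c * s * a) by (apply Rmult_le_compat_l; lra).
    nra. }
  split; [now apply L1|]. split.
  - enough (0 <= g_f F x - (k - eta) / 2 * x ^ 2) by lra.
    apply (nonneg_from_zero (fun t => g_f F t - (k - eta) / 2 * t ^ 2)
      (fun t => g_f1 F t - (k - eta) * t) a (B + Rabs (k - eta) * a)); [| | |exact Hx].
    + intros s Hs. apply is_derive_Rminus; [now apply g_f_d|].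
      auto_derive; [exact I|field].
    + intros s Hs. specialize (L1 s Hs). lra.
    + intros s Hs. assert (A := g_f_bound _ _ F s Hs). fold B in A.
      eapply Rle_trans; [apply Rabs_triang|]. rewrite Rabs_Ropp.
      generalize (Sq (k - eta) s Hs). lra.
  - enough (0 <= (k + eta) / 2 * x ^ 2 - g_f F x) by lra.
    apply (nonneg_from_zero (fun t => (k + eta) / 2 * t ^ 2 - g_f F t)
      (fun t => (k + eta) * t - g_f1 F t) a (B + Rabs (k + eta) * a)); [| | |exact Hx].
    + intros s Hs. apply is_derive_Rminus; [|now apply g_f_d].
      auto_derive; [exact I|field].
    + intros s Hs. specialize (L1 s Hs). lra.
    + intros s Hs. assert (A := g_f_bound _ _ F s Hs). fold B in A.
      eapply Rle_trans; [apply Rabs_triang|]. rewrite Rabs_Ropp.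
      generalize (Sq (k + eta) s Hs). lra.
Qed.

(** With [eta] at most a quarter of the smaller curvature and of the difference
    of curvatures, all strict inequalities between second derivatives at the tip
    persist along the graphs. *)
Lemma profile_of_graphs (Gl Gh : curve) (eta : R) (Fl : graph Gl eta) (Fh : graph Gh eta) :
  0 < eta -> 4 * eta <= graph_curvature Gl ->
  4 * eta <= graph_curvature Gh - graph_curvature Gl ->
  exists P : profile,
    reach P <= g_reach Fl /\ reach P <= g_reach Fh /\
    lo P = g_f Fl /\ lo1 P = g_f1 Fl /\ hi P = g_f Fh /\ hi1 P = g_f1 Fh.
Proof.
  intros He Hl Hh.
  set (kl := graph_curvature Gl) in *. set (kh := graph_curvature Gh) in *.
  set (K := 1 + 2 * kh + g_bnd Fl).
  assert (HB := g_bnd_pos _ _ Fl).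
  assert (HK : 1 <= K) by (unfold K; lra).
  set (a := Rmin (Rmin (g_reach Fl) (g_reach Fh)) (1 / (100 * K))).
  assert (R1 := g_reach_pos _ _ Fl). assert (R2 := g_reach_pos _ _ Fh).
  assert (HK' : 0 < 1 / (100 * K)) by (apply Rdiv_lt_0_compat; lra).
  assert (Ha : 0 < a) by (unfold a; repeat apply Rmin_case; lra).
  assert (Ha1 : a <= Rmin (g_reach Fl) (g_reach Fh)) by apply Rmin_l.
  assert (Ha2 : a <= 1 / (100 * K)) by apply Rmin_r.
  assert (Hal : a <= g_reach Fl) by (eapply Rle_trans; [exact Ha1|apply Rmin_l]).
  assert (Hah : a <= g_reach Fh) by (eapply Rle_trans; [exact Ha1|apply Rmin_r]).
  assert (Bl := fun x (Hx : 0 < x < a) => graph_bounds _ _ Fl x ltac:(lra)).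
  assert (Bh := fun x (Hx : 0 < x < a) => graph_bounds _ _ Fh x ltac:(lra)).
  assert (Cl := fun x (Hx : 0 < x < a) =>
    g_f2_close _ _ Fl x ltac:(lra) : Rabs (g_f2 Fl x - kl) < eta).
  assert (Ch := fun x (Hx : 0 < x < a) =>
    g_f2_close _ _ Fh x ltac:(lra) : Rabs (g_f2 Fh x - kh) < eta).
  fold kl in Bl. fold kh in Bh.
  assert (Hw : forall x, 0 < x < a ->
    g_f Fh x - g_f Fl x <= x * (g_f1 Fh x - g_f1 Fl x)).
  { intros x Hx.
    enough (0 <= x * (g_f1 Fh x - g_f1 Fl x) - (g_f Fh x - g_f Fl x)) by lra.
    apply (nonneg_from_zero
      (fun x => x * (g_f1 Fh x - g_f1 Fl x) - (g_f Fh x - g_f Fl x))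
      (fun x => x * (g_f2 Fh x - g_f2 Fl x)) a
      (a * (g_bnd Fh + g_bnd Fl) + (g_bnd Fh + g_bnd Fl))); [| | |exact Hx].
    - intros t Ht. assert (D1 := g_f1_d _ _ Fh t ltac:(lra)).
      assert (D2 := g_f1_d _ _ Fl t ltac:(lra)).
      assert (D3 := g_f_d _ _ Fh t ltac:(lra)).
      assert (D4 := g_f_d _ _ Fl t ltac:(lra)).
      auto_derive; [repeat split; eexists; eassumption|].
      rewrite (Derive_at (g_f1 Fh) _ _ D1), (Derive_at (g_f1 Fl) _ _ D2),
        (Derive_at (g_f Fh) _ _ D3), (Derive_at (g_f Fl) _ _ D4). ring.
    - intros t Ht. specialize (Cl t Ht). specialize (Ch t Ht).
      apply Rabs_def2 in Cl. apply Rabs_def2 in Ch. apply Rmult_le_pos; lra.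
    - intros t Ht. assert (A1 := g_f1_bound _ _ Fh t ltac:(lra)).
      assert (A2 := g_f1_bound _ _ Fl t ltac:(lra)).
      assert (A3 := g_f_bound _ _ Fh t ltac:(lra)).
      assert (A4 := g_f_bound _ _ Fl t ltac:(lra)).
      apply Rabs_le_between in A1. apply Rabs_le_between in A2.
      apply Rabs_le_between in A3. apply Rabs_le_between in A4.
      assert (- ((g_bnd Fh + g_bnd Fl) * t) <= g_f1 Fh t - g_f1 Fl t
              <= (g_bnd Fh + g_bnd Fl) * t) by lra.
      assert (HBh := g_bnd_pos _ _ Fh).
      assert (Hbt : 0 <= (g_bnd Fh + g_bnd Fl) * t) by nra.
      assert (t * ((g_bnd Fh + g_bnd Fl) * t) <= a * ((g_bnd Fh + g_bnd Fl) * t))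
        by (apply Rmult_le_compat_r; lra).
      apply Rabs_le. nra. }
  unshelve eexists (mk_profile a K (Rmin (kl / 2) ((kh - kl) / 2))
    (g_f Fl) (g_f1 Fl) (g_f2 Fl) (g_f3 Fl) (g_f Fh) (g_f1 Fh) (g_f2 Fh)
    _ _ _ _ _ _ _ _ _ _ _ _ _ _ _ _ _).
  18:{ simpl. repeat split; assumption. }
  all: try assumption; try (intros x Hx; specialize (Bl x Hx); specialize (Bh x Hx);
    specialize (Cl x Hx); specialize (Ch x Hx); apply Rabs_def2 in Cl;
    apply Rabs_def2 in Ch;
    assert (Rmin (kl / 2) ((kh - kl) / 2) <= kl / 2) by apply Rmin_l;
    assert (Rmin (kl / 2) ((kh - kl) / 2) <= (kh - kl) / 2) by apply Rmin_r).
  - apply Rmin_case; lra.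
  - replace (1 / 100) with (K * (1 / (100 * K))) by (field; lra).
    apply Rmult_le_compat_l; lra.
  - apply g_f_d; lra.
  - apply g_f1_d; lra.
  - apply g_f2_d; lra.
  - apply g_f_d; lra.
  - apply g_f1_d; lra.
  - unfold K. lra.
  - unfold K. lra.
  - eapply Rle_trans; [apply g_f3_bound; lra|]. unfold K. lra.
  - split; [|unfold K]; nra.
  - assert (Rmin (kl / 2) ((kh - kl) / 2) * x <= (kh - kl) / 2 * x)
      by (apply Rmult_le_compat_r; lra).
    split; [|unfold K]; nra.
  - assert (0 < x ^ 2) by (apply pow_lt; lra). nra.
  - assert (0 < x ^ 2) by (apply pow_lt; lra).
    assert (Rmin (kl / 2) ((kh - kl) / 2) / 2 * x ^ 2 <= (kh - kl) / 4 * x ^ 2)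
      by (apply Rmult_le_compat_r; lra).
    split; [|unfold K]; nra.
Qed.

(** * From arcs to charts *)

Lemma frame_injective (s : R) (e tip p q : R * R) : dot e e = 1 -> s ^ 2 = 1 ->
  along e (minus p tip) = along e (minus q tip) ->
  across s e (minus p tip) = across s e (minus q tip) -> p = q.
Proof.
  rewrite !along_minus, !across_minus. unfold dot. intros He Hs Ha Hc.
  destruct p as [p1 p2], q as [q1 q2], e as [e1 e2], tip as [c1 c2]; simpl in *.
  assert (N : s <> 0) by nra.
  assert (Hc' : e1 * (p2 - c2) - e2 * (p1 - c1) = e1 * (q2 - c2) - e2 * (q1 - c1))
    by (apply (Rmult_eq_reg_l s); assumption).
  assert (A : e1 * (p1 - q1) + e2 * (p2 - q2) = 0) by lra.
  assert (B : e1 * (p2 - q2) - e2 * (p1 - q1) = 0) by lra.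
  assert ((e1 * e1 + e2 * e2) * (p1 - q1) = 0).
  { transitivity (e1 * (e1 * (p1 - q1) + e2 * (p2 - q2))
      - e2 * (e1 * (p2 - q2) - e2 * (p1 - q1))); [ring|]. rewrite A, B. ring. }
  assert ((e1 * e1 + e2 * e2) * (p2 - q2) = 0).
  { transitivity (e2 * (e1 * (p1 - q1) + e2 * (p2 - q2))
      + e1 * (e1 * (p2 - q2) - e2 * (p1 - q1))); [ring|]. rewrite A, B. ring. }
  rewrite He in *. f_equal; lra.
Qed.

Lemma D_in_combination (al be ga : R) (f df g dg : R -> R) (D : R -> Prop) (t : R) :
  D_in f df D t -> D_in g dg D t ->
  D_in (fun s => al * f s + be * g s + ga) (fun s => al * df s + be * dg s) D t.
Proof.
  intros Hf Hg.
  assert (H := Dadd D _ _ _ _ t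
    (Dadd D _ _ _ _ t (Dmult_const D f df t al Hf) (Dmult_const D g dg t be Hg))
    (Dconst D ga t)).
  unfold D_in in *. rewrite Rplus_0_r in H. exact H.
Qed.

Lemma continue_in_combination (al be : R) (f g : R -> R) (D : R -> Prop) (t : R) :
  continue_in f D t -> continue_in g D t ->
  continue_in (fun s => al * f s + be * g s) D t.
Proof.
  intros Hf Hg. unfold continue_in in *.
  apply limit_plus; apply limit_mul; try assumption;
    apply (limit_free (fun x => x)).
Qed.

Lemma arc_curve (g : arc) (tip e : R * R) (s nu : R) :
  dot e e = 1 -> s ^ 2 = 1 -> pt g 0 = tip -> 0 < nu -> d1 g 0 = scal nu e ->
  exists G : curve, cv_end G = arc_end g /\
    (forall t, cX G t = along e (minus (pt g t) tip)) /\
    (forall t, cY G t = across s e (minus (pt g t) tip)) /\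
    (forall t, cX1 G t = along e (d1 g t)) /\
    (forall t, cY1 G t = across s e (d1 g t)) /\
    graph_curvature G = s * curvature g 0.
Proof.
  intros He Hs Ht Hnu Hd.
  set (e1 := fst e). set (e2 := snd e).
  set (cx := fun p : R -> R * R => fun t => e1 * fst (p t) + e2 * snd (p t)).
  set (cy := fun p : R -> R * R => fun t =>
     (- s * e2) * fst (p t) + (s * e1) * snd (p t)).
  set (ox := - (e1 * fst tip + e2 * snd tip)).
  set (oy := - ((- s * e2) * fst tip + (s * e1) * snd tip)).
  assert (EX : forall t, cx (pt g) t + ox = along e (minus (pt g t) tip)).
  { intros t. rewrite along_minus. unfold cx, ox, e1, e2. ring. }
  assert (EY : forall t, cy (pt g) t + oy = across s e (minus (pt g t) tip)).
  { intros t. rewrite across_minus. unfold cy, oy, e1, e2. ring. }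
  assert (D : forall p dp (al be ga : R), derivative_on 0 (arc_end g) p dp ->
    forall t, segment (arc_end g) t ->
    D_in (fun u => al * fst (p u) + be * snd (p u) + ga)
         (fun u => al * fst (dp u) + be * snd (dp u)) (segment (arc_end g)) t).
  { intros p dp al be ga Hp t Htt. destruct (Hp t Htt) as [P1 P2].
    now apply D_in_combination. }
  assert (D0 : forall p dp (al be : R), derivative_on 0 (arc_end g) p dp ->
    forall t, segment (arc_end g) t ->
    D_in (fun u => al * fst (p u) + be * snd (p u))
         (fun u => al * fst (dp u) + be * snd (dp u)) (segment (arc_end g)) t).
  { intros p dp al be Hp t Htt.
    assert (H := D p dp al be 0 Hp t Htt). unfold D_in in *.
    eapply limit1_ext; [|exact H]. intros u _. simpl. f_equal. ring. }
  assert (Hd1 : fst (d1 g 0) = nu * e1) by (rewrite Hd; reflexivity).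
  assert (Hd2 : snd (d1 g 0) = nu * e2) by (rewrite Hd; reflexivity).
  assert (He' : e1 * e1 + e2 * e2 = 1) by exact He.
  assert (S0 : segment (arc_end g) 0)
    by (generalize (arc_end_pos g); unfold segment; lra).
  assert (cx0 : cx (d1 g) 0 = nu).
  { unfold cx. rewrite Hd1, Hd2.
    transitivity (nu * (e1 * e1 + e2 * e2)); [ring|]. rewrite He'. ring. }
  unshelve eexists (mk_curve (arc_end g)
    (fun t => cx (pt g) t + ox) (cx (d1 g)) (cx (d2 g)) (cx (d3 g))
    (fun t => cy (pt g) t + oy) (cy (d1 g)) (cy (d2 g)) (cy (d3 g))
    _ _ _ _ _ _ _ _ _ _ _ _ _ _).
  - apply arc_end_pos.
  - apply D, arc_d1.
  - apply D0, arc_d2.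
  - apply D0, arc_d3.
  - apply D, arc_d1.
  - apply D0, arc_d2.
  - apply D0, arc_d3.
  - destruct (arc_d3_cont g 0 S0). now apply continue_in_combination.
  - destruct (arc_d3_cont g 0 S0). now apply continue_in_combination.
  - cbv beta. rewrite EX, Ht, along_minus. ring.
  - cbv beta. rewrite EY, Ht, across_minus. ring.
  - rewrite cx0. exact Hnu.
  - unfold cy. rewrite Hd1, Hd2. ring.
  - intros t Htt. cbv beta. rewrite EX, EY. intros A B.
    apply (arc_simple g); [exact Htt|exact S0|].
    rewrite Ht. apply (frame_injective s e tip); try assumption.
    + rewrite A, along_minus. ring.
    + rewrite B, across_minus. ring.
  - simpl. split; [reflexivity|]. split; [exact EX|]. split; [exact EY|].
    split; [reflexivity|]. split.
    + intros t. unfold cy, across, e1, e2. ring.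
    + unfold graph_curvature, curvature; simpl.
      assert (En : enorm (d1 g 0) = nu).
      { unfold enorm, dot. rewrite Hd1, Hd2.
        replace (nu * e1 * (nu * e1) + nu * e2 * (nu * e2)) with (nu * nu).
        - apply sqrt_square. lra.
        - transitivity (nu * nu * (e1 * e1 + e2 * e2)); [rewrite He'; ring|ring]. }
      rewrite cx0, En, Hd1, Hd2. unfold cy. field. lra.
Qed.

(** The unit normal of the arc is the rotated tangent; by [s ^ 2 = 1], the orientation of
    the frame disappears from the reflection, which is quadratic in the normal. *)
Lemma reflect_in_frame (g : arc) (e : R * R) (s p t : R) (v : R * R) :
  dot e e = 1 -> s ^ 2 = 1 -> 0 < along e (d1 g t) ->
  across s e (d1 g t) = p * along e (d1 g t) ->
  let v' := reflect (unit_normal g t) v in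
  along e v' = along e v + 2 * p * (across s e v - p * along e v) / (1 + p ^ 2) /\
  across s e v' = across s e v - 2 * (across s e v - p * along e v) / (1 + p ^ 2).
Proof.
  intros He Hs Hx Hy. unfold dot in He.
  set (x1 := along e (d1 g t)) in *.
  assert (Fx : fst (d1 g t) = x1 * (fst e - s * p * snd e)).
  { unfold across in Hy. fold x1 in Hy.
    transitivity ((fst e * fst e + snd e * snd e) * fst (d1 g t)
      + (1 - s ^ 2) * (fst e * snd (d1 g t) - snd e * fst (d1 g t)) * snd e);
      [rewrite He, Hs; ring|].
    transitivity (fst e * x1 - s * snd e * (s * (fst e * snd (d1 g t)
      - snd e * fst (d1 g t)))); [unfold x1, along, dot; ring|].
    rewrite Hy. ring. }
  assert (Fy : snd (d1 g t) = x1 * (snd e + s * p * fst e)).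
  { unfold across in Hy. fold x1 in Hy.
    transitivity ((fst e * fst e + snd e * snd e) * snd (d1 g t)
      - (1 - s ^ 2) * (fst e * snd (d1 g t) - snd e * fst (d1 g t)) * fst e);
      [rewrite He, Hs; ring|].
    transitivity (snd e * x1 + s * fst e * (s * (fst e * snd (d1 g t)
      - snd e * fst (d1 g t)))); [unfold x1, along, dot; ring|].
    rewrite Hy. ring. }
  set (r := sqrt (1 + p ^ 2)).
  assert (Hp : 0 < 1 + p ^ 2) by nra.
  assert (Hr : 0 < r) by (apply sqrt_lt_R0; lra).
  assert (Hr2 : r * r = 1 + p ^ 2) by (apply sqrt_sqrt; lra).
  assert (En : enorm (d1 g t) = x1 * r).
  { unfold enorm, dot. rewrite Fx, Fy.
    replace (_ + _) with (x1 ^ 2 * (1 + p ^ 2)).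
    - rewrite sqrt_mult; [|nra|lra]. f_equal. rewrite sqrt_pow2; lra.
    - transitivity (x1 ^ 2 * ((fst e * fst e + snd e * snd e) * (1 + s ^ 2 * p ^ 2)));
        [rewrite He, Hs; ring|ring]. }
  assert (N : unit_normal g t =
    (- (snd e + s * p * fst e) / r, (fst e - s * p * snd e) / r)).
  { unfold unit_normal. rewrite En, Fx, Fy. f_equal; field; lra. }
  intros v'. unfold v'. rewrite N. unfold reflect.
  rewrite along_minus, across_minus, !fst_scal, !snd_scal. unfold along, across, dot; simpl.
  set (a := fst e) in *. set (b := snd e) in *.
  set (v1 := fst v). set (v2 := snd v).
  replace (p * (p * 1)) with (r * r - 1) by (rewrite Hr2; ring).
  set (q := s * (a * v2 - b * v1) - p * (a * v1 + b * v2)).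
  set (dn := v1 * (- (b + s * p * a) / r) + v2 * ((a - s * p * b) / r)).
  assert (Ed : dn = s * q / r).
  { unfold dn, q. apply (Rmult_eq_reg_r r); [|lra].
    transitivity ((s ^ 2) * (a * v2 - b * v1) - s * p * (a * v1 + b * v2));
      [rewrite Hs|]; field; lra. }
  rewrite Ed. replace (1 + (r * r - 1)) with (r * r) by ring. split.
  - transitivity (a * v1 + b * v2 + 2 * s ^ 2 * (a * a + b * b) * p * q / (r * r));
      [field; lra|]. rewrite He, Hs. field. lra.
  - transitivity (s * (a * v2 - b * v1)
      - 2 * s ^ 2 * (a * a + b * b) * q / (r * r)); [field; lra|].
    rewrite He, Hs. field. lra.
Qed.

Section ArcInFrame.
Context (g : arc) (tip e : R * R) (s eta : R).
Context (He : dot e e = 1) (Hs : s ^ 2 = 1) (Htip : pt g 0 = tip).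
Context (G : curve) (Gend : cv_end G = arc_end g)
  (GX : forall t, cX G t = along e (minus (pt g t) tip))
  (GY : forall t, cY G t = across s e (minus (pt g t) tip))
  (GX1 : forall t, cX1 G t = along e (d1 g t))
  (GY1 : forall t, cY1 G t = across s e (d1 g t)).
Context (F : graph G eta).

Local Notation fx := (frame_x tip e).
Local Notation fy := (frame_y tip e s).

(** Later parts of the arc cannot meet a small neighborhood of the tip. *)
Lemma near_parameter (t : R) : 0 <= t <= arc_end g ->
  Rabs (fx (pt g t)) < g_sep F -> Rabs (fy (pt g t)) < g_sep F ->
  t < g_par F.
Proof.
  intros Ht Hx Hy. apply Rnot_le_lt. intros N.
  destruct (g_away _ _ F t) as [A|A]; [rewrite Gend; lra| |].
  - rewrite GX in A. unfold frame_x in Hx. lra.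
  - rewrite GY in A. unfold fy in Hy. lra.
Qed.

Lemma on_graph_at (t : R) : 0 < t < g_par F ->
  0 < fx (pt g t) < g_reach F /\ fy (pt g t) = g_f F (fx (pt g t)).
Proof.
  intros Ht. destruct (g_on_graph _ _ F t Ht) as (A & B & _).
  rewrite GX, GY in *. now split.
Qed.

Lemma start_at_tip : fx (pt g 0) = 0 /\ fy (pt g 0) = 0.
Proof. rewrite Htip. unfold frame_x, frame_y. rewrite along_minus, across_minus. split; ring. Qed.

Lemma graph_point (p : R * R) : 0 < fx p < g_reach F -> fy p = g_f F (fx p) ->
  exists t, 0 < t < g_par F /\ 0 < t <= arc_end g /\ pt g t = p.
Proof.
  intros Hx Hy. destruct (g_onto _ _ F _ Hx) as (t & Ht & Et).
  assert (R := g_par_range _ _ F). rewrite Gend in R.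
  exists t. split; [exact Ht|]. split; [lra|].
  destruct (on_graph_at t Ht) as [_ B]. rewrite GX in Et.
  apply (frame_injective s e tip); try assumption.
  unfold frame_x, frame_y in *. rewrite B, Hy, Et. reflexivity.
Qed.

Lemma on_arc_near (p : R * R) : Rabs (fx p) < g_sep F -> Rabs (fy p) < g_sep F ->
  Rabs (fx p) < g_reach F ->
  (on_arc g p <-> (fx p = 0 /\ fy p = 0) \/ (0 < fx p /\ fy p = g_f F (fx p))).
Proof.
  intros Hx Hy Hr. apply Rabs_def2 in Hr. split.
  - intros (t & Ht & <-). assert (T := near_parameter t Ht Hx Hy).
    destruct (Req_dec t 0) as [->|N]; [left; apply start_at_tip|right].
    destruct (on_graph_at t) as [A B]; [lra|]. split; [lra|exact B].
  - intros [[A B]|[A B]].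
    + exists 0. split; [generalize (arc_end_pos g); lra|].
      destruct start_at_tip as [A' B'].
      apply (frame_injective s e tip); try assumption; unfold frame_x, frame_y in *; congruence.
    + destruct (graph_point p) as (t & _ & Ht & E); [lra|exact B|].
      exists t. split; [lra|exact E].
Qed.

Lemma bounce_near (p v p' v' : R * R) :
  Rabs (fx p') < g_sep F -> Rabs (fy p') < g_sep F ->
  bounce g p v p' v' ->
  0 < fx p' /\ fy p' = g_f F (fx p') /\
  frame_state tip e s p' v' =
    reflect_slope (g_f1 F (fx p')) (frame_state tip e s p' v).
Proof.
  intros Hx Hy (t & Ht & -> & ->).
  assert (T := near_parameter t ltac:(lra) Hx Hy).
  destruct (on_graph_at t) as [A B]; [lra|]. split; [lra|]. split; [exact B|].
  destruct (g_on_graph _ _ F t ltac:(lra)) as (_ & _ & C).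
  assert (D := g_forward _ _ F t ltac:(lra)). rewrite GX1 in *. rewrite GY1, GX in C.
  destruct (reflect_in_frame g e s _ t v He Hs D C) as [R1 R2].
  unfold frame_state, reflect_slope; simpl. unfold frame_x. f_equal; assumption.
Qed.

Lemma can_bounce_near (p v p' : R * R) : 0 < fx p' < g_reach F ->
  fy p' = g_f F (fx p') -> exists v', bounce g p v p' v'.
Proof.
  intros Hx Hy. destruct (graph_point p' Hx Hy) as (t & _ & Ht & E).
  exists (reflect (unit_normal g t) v), t. split; [exact Ht|]. split; [now symmetry|reflexivity].
Qed.

Lemma graph_up_to_iff (mu t : R) (T : R * R) : 0 < mu -> T = scal mu e ->
  graph_up_to T g t <->
  0 <= t <= arc_end g /\ forall u, 0 <= u <= t -> 0 < cX1 G u.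
Proof.
  intros Hmu ->. unfold graph_up_to.
  assert (E : forall u, dot (scal mu e) (d1 g u) = mu * cX1 G u).
  { intros u. rewrite GX1. apply dot_scal. }
  split; intros [A B]; split; try exact A; intros u Hu; specialize (B u Hu);
    rewrite E in *.
  - apply (Rmult_lt_reg_l mu); lra.
  - apply Rmult_lt_0_compat; assumption.
Qed.

Lemma graph_up_to_near (t : R) : 0 <= t <= arc_end g ->
  (forall u, 0 <= u <= t -> 0 < cX1 G u) -> fx (pt g t) < g_reach F ->
  t < g_par F.
Proof.
  intros Ht Hu Hx. apply Rnot_le_lt. intros N.
  assert (A := g_beyond _ _ F t). rewrite GX in A. unfold frame_x in Hx.
  assert (g_reach F <= along e (minus (pt g t) tip)); [|lra].
  apply A; [rewrite Gend; lra|exact Hu].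
Qed.

End ArcInFrame.

Lemma horn_symmetric (gp gm : arc) (c : R) (p : R * R) : 0 < c ->
  d1 gm 0 = scal c (d1 gp 0) -> horn gp gm p -> horn gm gp p.
Proof.
  intros Hc Hd (tp & tm & lam & (A1 & A2) & (B1 & B2) & E & Hl & Ep).
  assert (Ed : forall w, dot (d1 gm 0) w = c * dot (d1 gp 0) w).
  { intros w. rewrite Hd. apply dot_scal. }
  exists tm, tp, (1 - lam). split; [|split; [|split; [|split]]].
  - split; [exact B1|]. intros u Hu. rewrite Ed. apply Rmult_lt_0_compat; auto.
  - split; [exact A1|]. intros u Hu. rewrite Ed. apply Rmult_lt_0_compat; auto.
  - rewrite Ed. transitivity (c * - dot (d1 gp 0) (minus (pt gp tp) (pt gm tm))).
    + rewrite <- Ropp_mult_distr_r, Ropp_mult_distr_r. f_equal.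
      change (along (d1 gp 0) (minus (pt gm tm) (pt gp tp)) =
              - along (d1 gp 0) (minus (pt gp tp) (pt gm tm))).
      rewrite !along_minus. ring.
    + rewrite E. ring.
  - lra.
  - rewrite Ep. apply injective_projections;
      rewrite ?fst_plus, ?snd_plus, ?fst_scal, ?snd_scal; ring.
Qed.

(** The sweep of the horn depends on the two arcs symmetrically, up to the
    positive factor between the tangent vectors. *)
Lemma horn_chart_symmetric (gp gm : arc) (c : R) (tip : R * R) : 0 < c ->
  d1 gm 0 = scal c (d1 gp 0) -> horn_chart gp gm tip -> horn_chart gm gp tip.
Proof.
  intros Hc Hd [e s P rad H1 H2 H3 H4 H5 H6 H7]. cbv zeta in *.
  assert (Hc' : 0 < / c) by now apply Rinv_0_lt_compat.
  assert (Hd' := scal_inverse c _ _ Hc Hd).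
  apply (mk_horn_chart gm gp tip e s P rad H1 H2 H3).
  - intros p x y Hx Hy. apply (iff_trans (B := horn gp gm p)); [|exact (H4 p Hx Hy)].
    split.
    + apply (horn_symmetric gm gp (/ c)); assumption.
    + apply (horn_symmetric gp gm c); assumption.
  - intros p x y Hx Hy. apply (iff_trans (or_comm _ _)). exact (H5 p Hx Hy).
  - intros p v p' v' z z' Hx Hy Hb. apply (H6 p v p' v' Hx Hy). tauto.
  - intros p v p' x y Hx Hy Hpos Hw.
    destruct (H7 p v p' Hx Hy Hpos Hw) as [v' Hv']. exists v'. tauto.
Qed.

(** Here [gl] is the focusing arc.  Points of the sweep near the tip come from
    parameters below [g_par], by [g_beyond], and points of the arcs near the tip
    by [g_away]. *)
Lemma horn_chart_of_arcs (gl gh : arc) (tip e : R * R) (s nul nuh : R) :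
  dot e e = 1 -> s ^ 2 = 1 -> pt gl 0 = tip -> pt gh 0 = tip ->
  0 < nul -> d1 gl 0 = scal nul e -> 0 < nuh -> d1 gh 0 = scal nuh e ->
  0 < s * curvature gl 0 -> s * curvature gl 0 < s * curvature gh 0 ->
  inhabited (horn_chart gl gh tip).
Proof.
  intros He Hs Tl Th Hnl Dl Hnh Dh Kl Kh.
  destruct (arc_curve gl tip e s nul He Hs Tl Hnl Dl)
    as (Gl & El & XL & YL & XL1 & YL1 & CL).
  destruct (arc_curve gh tip e s nuh He Hs Th Hnh Dh)
    as (Gh & Eh & XH & YH & XH1 & YH1 & CH).
  set (kl := s * curvature gl 0) in *. set (kh := s * curvature gh 0) in *.
  set (eta := Rmin kl (kh - kl) / 4).
  assert (Heta : 0 < eta).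
  { unfold eta. assert (0 < Rmin kl (kh - kl)) by (apply Rmin_case; lra). lra. }
  destruct (curve_graph Gl eta Heta) as [Fl]. destruct (curve_graph Gh eta Heta) as [Fh].
  destruct (profile_of_graphs Gl Gh eta Fl Fh Heta) as (P & Rl & Rh & Plo & Plo1 & Phi & Phi1).
  { rewrite CL. unfold eta. generalize (Rmin_l kl (kh - kl)). lra. }
  { rewrite CL, CH. unfold eta. generalize (Rmin_r kl (kh - kl)). lra. }
  set (rad := Rmin (reach P) (Rmin (g_sep Fl) (g_sep Fh))).
  assert (Hrad : 0 < rad).
  { unfold rad. generalize (reach_pos P) (g_sep_pos _ _ Fl) (g_sep_pos _ _ Fh); intros.
    repeat apply Rmin_case; lra. }
  assert (Hr1 : rad <= reach P) by apply Rmin_l.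
  assert (Hr23 : rad <= Rmin (g_sep Fl) (g_sep Fh)) by apply Rmin_r.
  assert (Hr2 : rad <= g_sep Fl) by (eapply Rle_trans; [exact Hr23|apply Rmin_l]).
  assert (Hr3 : rad <= g_sep Fh) by (eapply Rle_trans; [exact Hr23|apply Rmin_r]).
  constructor.
  apply (mk_horn_chart gl gh tip e s P rad He Hs (conj Hrad Hr1)).
  - intros p. cbv zeta. unfold frame_x, frame_y. intros Hx Hy.
    assert (Hx' := Hx). apply Rabs_def2 in Hx'.
    assert (Edot : forall w, dot (d1 gl 0) w = nul * along e w).
    { intros w. rewrite Dl. apply dot_scal. }
    split.
    + intros (tp & tm & lam & A & B & E & Hl & Ep).
      rewrite (graph_up_to_iff gl e Gl XL1 nul tp _ Hnl Dl) in A.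
      rewrite (graph_up_to_iff gh e Gh XH1 nul tm _ Hnl Dl) in B.
      destruct A as [A1 A2]. destruct B as [B1 B2].
      set (xl := frame_x tip e (pt gl tp)) in *. set (xh := frame_x tip e (pt gh tm)) in *.
      set (yl := frame_y tip e s (pt gl tp)). set (yh := frame_y tip e s (pt gh tm)).
      assert (Exx : xl = xh).
      { rewrite Edot in E. apply Rmult_integral in E. destruct E as [E|E]; [lra|].
        rewrite along_minus in E. unfold xl, xh, frame_x. rewrite !along_minus. lra. }
      assert (Ex : along e (minus p tip) = xl).
      { transitivity ((1 - lam) * xl + lam * xh); [|rewrite <- Exx; ring].
        rewrite Ep. apply along_between. }
      assert (Ey : across s e (minus p tip) = (1 - lam) * yl + lam * yh).
      { rewrite Ep. apply across_between. }
      rewrite Ex in *. rewrite Ey.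
      assert (Tp := graph_up_to_near gl tip e eta Gl El XL Fl tp A1 A2
        ltac:(fold xl; lra)).
      assert (Tm := graph_up_to_near gh tip e eta Gh Eh XH Fh tm B1 B2
        ltac:(fold xh; lra)).
      assert (Sl := start_at_tip gl tip e s Tl). assert (Sh := start_at_tip gh tip e s Th).
      destruct (Req_dec tp 0) as [Zp|Zp].
      * left. assert (X0 : xl = 0) by (unfold xl; rewrite Zp; apply Sl).
        assert (Zm : tm = 0).
        { destruct (Req_dec tm 0) as [|Zm]; [assumption|].
          destruct (on_graph_at gh tip e s eta Gh XH YH Fh tm) as [Q _]; [lra|].
          fold xh in Q. lra. }
        split; [exact X0|]. unfold yl, yh. rewrite Zp, Zm, (proj2 Sl), (proj2 Sh). ring.
      * right. destruct (on_graph_at gl tip e s eta Gl XL YL Fl tp) as [Q1 Q2]; [lra|].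
        assert (Zm : tm <> 0).
        { intros Zm. assert (xh = 0) by (unfold xh; rewrite Zm; apply Sh).
          fold xl in Q1. lra. }
        destruct (on_graph_at gh tip e s eta Gh XH YH Fh tm) as [Q3 Q4]; [lra|].
        fold xl yl in Q1, Q2. fold xh yh in Q3, Q4. rewrite <- Exx in Q4.
        split; [lra|]. rewrite Q2, Q4, Plo, Phi.
        assert (Gp := gap_pos P xl ltac:(lra)). rewrite Plo, Phi in Gp. nra.
    + intros H.
      assert (U0 : forall g G F, cv_end G = arc_end g ->
         (forall t, cX1 G t = along e (d1 g t)) ->
         forall t, 0 <= t <= g_par (F : graph G eta) -> graph_up_to (d1 gl 0) g t).
      { intros g G F EG X1 t Ht. apply (graph_up_to_iff g e G X1 nul t _ Hnl Dl).
        assert (R := g_par_range _ _ F). split; [lra|].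
        intros u Hu. apply (g_forward _ _ F). lra. }
      destruct H as [[Hx0 Hy0]|[Hpos Hlh]].
      * exists 0, 0, 0.
        assert (Rl' := g_par_range _ _ Fl). assert (Rh' := g_par_range _ _ Fh).
        split; [apply (U0 gl Gl Fl El XL1); lra|].
        split; [apply (U0 gh Gh Fh Eh XH1); lra|].
        split; [|split; [lra|]].
        -- rewrite Tl, Th, Edot, along_minus. ring.
        -- apply (frame_injective s e tip); try assumption.
           ++ rewrite Hx0, along_between, Tl, Th, along_minus. ring.
           ++ rewrite Hy0, across_between, Tl, Th, across_minus. ring.
      * set (x := along e (minus p tip)) in *. set (y := across s e (minus p tip)) in *.
        assert (Gp := gap_pos P x ltac:(lra)). rewrite Plo, Phi in *.
        destruct (g_onto _ _ Fl x ltac:(lra)) as (tp & Htp & Etp).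
        destruct (g_onto _ _ Fh x ltac:(lra)) as (tm & Htm & Etm).
        destruct (g_on_graph _ _ Fl tp Htp) as (_ & Yp & _).
        destruct (g_on_graph _ _ Fh tm Htm) as (_ & Ym & _).
        rewrite Etp in Yp. rewrite Etm in Ym. rewrite XL in Etp. rewrite XH in Etm.
        rewrite YL in Yp. rewrite YH in Ym.
        exists tp, tm, ((y - g_f Fl x) / (g_f Fh x - g_f Fl x)).
        split; [apply (U0 gl Gl Fl El XL1); lra|].
        split; [apply (U0 gh Gh Fh Eh XH1); lra|].
        split; [|split].
        -- rewrite Edot. rewrite along_minus in *. nra.
        -- split.
           ++ apply Rmult_le_pos; [lra|]. apply Rlt_le, Rinv_0_lt_compat. lra.
           ++ apply (Rmult_le_reg_r (g_f Fh x - g_f Fl x)); [lra|].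
              field_simplify; lra.
        -- set (lam := (y - g_f Fl x) / (g_f Fh x - g_f Fl x)).
           apply (frame_injective s e tip); try assumption.
           ++ fold x. rewrite along_between, Etp, Etm. ring.
           ++ fold y. rewrite across_between, Yp, Ym. unfold lam. field. lra.
  - intros p. cbv zeta. intros Hx Hy. rewrite Plo, Phi.
    rewrite (on_arc_near gl tip e s eta He Hs Tl Gl El XL YL Fl p)
      by lra.
    rewrite (on_arc_near gh tip e s eta He Hs Th Gh Eh XH YH Fh p)
      by lra.
    tauto.
  - intros p v p' v'. cbv zeta. intros Hx Hy Hb. simpl in Hx, Hy.
    unfold lower_bounce, upper_bounce. rewrite Plo, Plo1, Phi, Phi1.
    destruct Hb as [Hb|Hb].
    + destruct (bounce_near gl tip e s eta He Hs Gl El XL YL XL1 YL1 Fl p v p' v')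
        as (A & B & D); try assumption; try lra.
      split; [exact A|left]. split; [exact B|exact D].
    + destruct (bounce_near gh tip e s eta He Hs Gh Eh XH YH XH1 YH1 Fh p v p' v')
        as (A & B & D); try assumption; try lra.
      split; [exact A|right]. split; [exact B|exact D].
  - intros p v p'. cbv zeta. intros Hx Hy Hpos Hw. rewrite Plo, Phi in Hw.
    apply Rabs_def2 in Hx. destruct Hw as [Hw|Hw].
    + destruct (can_bounce_near gl tip e s eta He Hs Gl El XL YL Fl p v p') as [v' Hv'];
        [lra|exact Hw|]. exists v'. now left.
    + destruct (can_bounce_near gh tip e s eta He Hs Gh Eh XH YH Fh p v p') as [v' Hv'];
        [lra|exact Hw|]. exists v'. now right.
Qed.

(** The sign [s] makes both curvatures positive; the arc with the smaller one is
    the floor. *)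
Lemma horn_has_chart (gp gm : arc) (tip : R * R) :
  forms_horn gp gm tip -> inhabited (horn_chart gp gm tip).
Proof.
  intros (Tp & Tm & (c & Hc & Hd) & Kp & Km & Kpm & Kne).
  assert (Hreg : d1 gp 0 <> (0, 0)).
  { apply arc_regular. generalize (arc_end_pos gp). lra. }
  set (mu := enorm (d1 gp 0)).
  assert (Hdot : 0 < dot (d1 gp 0) (d1 gp 0)).
  { destruct (d1 gp 0) as [a b]. unfold dot; simpl.
    destruct (Req_dec a 0) as [->|Na].
    - destruct (Req_dec b 0) as [->|Nb]; [now elim Hreg|]. nra.
    - nra. }
  assert (Hmu : 0 < mu) by now apply sqrt_lt_R0.
  assert (Hmu2 : mu * mu = dot (d1 gp 0) (d1 gp 0)) by (apply sqrt_sqrt; lra).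
  set (e := (fst (d1 gp 0) / mu, snd (d1 gp 0) / mu)).
  assert (He : dot e e = 1).
  { transitivity (dot (d1 gp 0) (d1 gp 0) / (mu * mu)).
    - unfold dot, e; simpl. field. lra.
    - rewrite <- Hmu2. field. lra. }
  assert (Dp : d1 gp 0 = scal mu e).
  { apply injective_projections; rewrite ?fst_scal, ?snd_scal; simpl; field; lra. }
  assert (Dm : d1 gm 0 = scal (c * mu) e).
  { rewrite Hd, Dp. apply injective_projections; rewrite ?fst_scal, ?snd_scal; ring. }
  assert (Hcm : 0 < c * mu) by nra.
  assert (Hs : exists s, s ^ 2 = 1 /\ 0 < s * curvature gp 0 /\ 0 < s * curvature gm 0).
  { destruct (Rle_or_lt (curvature gp 0) 0).
    - exists (-1). assert (curvature gp 0 < 0) by lra.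
      split; [ring|]. split; [lra|]. nra.
    - exists 1. split; [ring|]. split; [lra|]. nra. }
  destruct Hs as (s & Hs & Sp & Sm).
  assert (Sne : s * curvature gp 0 <> s * curvature gm 0).
  { intros E. apply Kne. apply (Rmult_eq_reg_l s); [exact E|]. nra. }
  destruct (Rlt_or_le (s * curvature gp 0) (s * curvature gm 0)) as [L|L].
  - apply (horn_chart_of_arcs gp gm tip e s mu (c * mu)); assumption.
  - destruct (horn_chart_of_arcs gm gp tip e s (c * mu) mu) as [C]; try assumption; [lra|].
    constructor. apply (horn_chart_symmetric gm gp (/ c)).
    + now apply Rinv_0_lt_compat.
    + now apply scal_inverse.
    + exact C.
Qed.

Theorem theorem1 (gp gm : arc) (tip : R * R) (Hhorn : forms_horn gp gm tip) :
  exists U : R * R -> Prop,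
    locally tip U /\
    forall tr : trajectory gp gm,
      U (tr_pos tr 0%nat) ->
      leaves_after_finitely_many_collisions tr U.
Proof.
  destruct (horn_has_chart gp gm tip Hhorn) as [C].
  exact (leaves_of_chart gp gm tip C).
Qed.
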